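(* Let $0\le\alpha<1$ and let $f\in\mathcal{C}(\alpha)$ have logarithmic coefficients $\gamma_n$. Then $$\sum_{n=1}^{\infty}|\gamma_{n}|^{2}\leq \frac{1}{4}\sum_{n=1}^{\infty} \frac{\delta_n^2}{n^2}\leq (1-\beta(\alpha))^2\,\frac{\pi^2}{6},$$ where the real numbers $\delta_n$ are defined by $G_\alpha(z)-1=\sum_{n=1}^\infty\delta_n z^n$, and equality holds in the first inequality for $f=K_\alpha$. In particular, if $f\in\mathcal{C}(0)$ (i.e. $f$ is convex), then $$\sum_{n=1}^{\infty}|\gamma_{n}|^{2}\leq \frac{\pi^2}{24},$$ and this is sharp, with equality for the convex function $z/(1-z)$.
   Context: Let $\mathbb{D}=\{z\in\mathbb{C}:|z|<1\}$ and let $\mathcal{S}$ be the class of functions $f$ analytic and univalent in $\mathbb{D}$ with $f(0)=0$, $f'(0)=1$. For $0\le\beta<1$, $\mathcal{S}^{\star}(\beta)$ is the class of $f\in\mathcal{S}$ with $\mathrm{Re}\,(zf'(z)/f(z))>\beta$ for all $z\in\mathbb{D}$, and $\mathcal{C}(\beta)=\{f\in\mathcal{S}: zf'\in\mathcal{S}^{\star}(\beta)\}$ is the class of convex functions of order $\beta$. The logarithmic coefficients $\gamma_n$ of $f\in\mathcal{S}$ are defined by $\frac12\log\frac{f(z)}{z}=\sum_{n=1}^\infty\gamma_n z^n$, $z\in\mathbb{D}$, where the branch of the logarithm vanishes at $z=0$. For $0\le\alpha<1$ define (with principal branches and removable singularity at $z=0$) $$G_\alpha(z)=\begin{cases}\dfrac{(2\alpha-1)z}{(1-z)[(1-z)^{1-2\alpha}-1]}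 & \alpha\ne 1/2,\\[3mm] \dfrac{-z}{(1-z)\log(1-z)} & \alpha=1/2,\end{cases}\qquad K_\alpha(z)=\begin{cases}\dfrac{(1-z)^{2\alpha-1}-1}{1-2\alpha} & \alpha\ne 1/2,\\[3mm] -\log(1-z) & \alpha=1/2,\end{cases}$$ and $$\beta(\alpha)=G_\alpha(-1)=\begin{cases}\dfrac{1-2\alpha}{2[2^{1-2\alpha}-1]} & \alpha\ne 1/2,\\[3mm] \dfrac{1}{2\log 2} & \alpha=1/2.\end{cases}$$ *)

(* Defs.v *)
From Stdlib Require Import Reals Lra.
From Coquelicot Require Import Coquelicot.
Open Scope R_scope.

(** * Elementary complex functions *)

Definition Cexp (z : C) : C := (exp (Re z) * cos (Im z), exp (Re z) * sin (Im z)).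

(* Principal argument, with values in (-PI, PI]; [Arg 0 = PI] is a junk value. *)
Definition Arg (z : C) : R :=
  if Rlt_dec 0 (Re z) then atan (Im z / Re z)
  else if Rlt_dec 0 (Im z) then PI / 2 - atan (Re z / Im z)
  else if Rlt_dec (Im z) 0 then - (PI / 2) - atan (Re z / Im z)
  else PI.

(* Principal logarithm and principal power (meaningful for [z <> 0]). *)
Definition Clog (z : C) : C := (ln (Cmod z), Arg z).
Definition Cpower (z a : C) : C := Cexp (a * Clog z)%C.

(** * Univalent functions

    A function on the unit disk is represented by a total function [C -> C];
    its values outside the disk are irrelevant. *)

Definition in_disk (z : C) : Prop := Cmod z < 1.

(* Analytic = complex differentiable: [ex_derive] is taken over the field [C]. *)
Definition analytic_on_disk (f : C -> C) : Prop :=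
  forall z : C, in_disk z -> ex_derive f z.

Definition univalent_on_disk (f : C -> C) : Prop :=
  forall z w : C, in_disk z -> in_disk w -> f z = f w -> z = w.

Definition class_S (f : C -> C) : Prop :=
  analytic_on_disk f /\ univalent_on_disk f /\
  f (RtoC 0) = RtoC 0 /\ C_derive f (RtoC 0) = RtoC 1.

(* At [z = 0] the quotient z f'(z) / f(z) has the removable value 1 > beta, so
   the point 0, where Rocq's division returns junk, is left out. *)
Definition starlike_of_order (beta : R) (f : C -> C) : Prop :=
  class_S f /\
  forall z : C, in_disk z -> z <> RtoC 0 ->
    beta < Re (z * C_derive f z / f z)%C.

Definition convex_of_order (beta : R) (f : C -> C) : Prop :=
  class_S f /\ starlike_of_order beta (fun z : C => (z * C_derive f z)%C).

(** * Logarithmic coefficients *)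

(* [L] is the analytic branch of log (f(z)/z) on the disk vanishing at 0.  It
   need not be the principal logarithm of f(z)/z. *)
Definition log_branch (f L : C -> C) : Prop :=
  analytic_on_disk L /\ L (RtoC 0) = RtoC 0 /\
  forall z : C, in_disk z -> z <> RtoC 0 -> Cexp (L z) = (f z / z)%C.

(* [gamma n] is the n-th coefficient for n >= 1; [gamma 0] is not used, the
   series below starts at n = 1. *)
Definition log_coefficients (f : C -> C) (gamma : nat -> C) : Prop :=
  exists L : C -> C, log_branch f L /\
    forall z : C, in_disk z ->
      is_series (fun n : nat => (gamma (S n) * z ^ (S n))%C)
                (RtoC (1 / 2) * L z)%C.

(** * The extremal functions *)

Definition G (alpha : R) (z : C) : C :=
  if Ceq_dec z (RtoC 0) then RtoC 1   (* removable singularity *)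
  else if Req_EM_T alpha (1 / 2)
  then (- z / ((1 - z) * Clog (1 - z)))%C
  else (RtoC (2 * alpha - 1) * z
        / ((1 - z) * (Cpower (1 - z) (RtoC (1 - 2 * alpha)) - 1)))%C.

Definition K (alpha : R) (z : C) : C :=
  if Req_EM_T alpha (1 / 2)
  then (- Clog (1 - z))%C
  else ((Cpower (1 - z) (RtoC (2 * alpha - 1)) - 1) / RtoC (1 - 2 * alpha))%C.

Definition beta (alpha : R) : R :=
  if Req_EM_T alpha (1 / 2)
  then 1 / (2 * ln 2)
  else (1 - 2 * alpha) / (2 * (Rpower 2 (1 - 2 * alpha) - 1)).

(* [delta n] is the n-th Taylor coefficient of G_alpha - 1 for n >= 1;
   [delta 0] is not used. *)
Definition G_coefficients (alpha : R) (delta : nat -> R) : Prop :=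
  forall z : C, in_disk z ->
    is_series (fun n : nat => (RtoC (delta (S n)) * z ^ (S n))%C)
              (G alpha z - 1)%C.

Lemma Clog_2 : Clog (RtoC 2) = RtoC (ln 2).
Proof.
  unfold Clog, Arg, RtoC; simpl.
  destruct (Rlt_dec 0 2) as [_ | H]; [ | lra].
  unfold Rdiv; rewrite Rmult_0_l, atan_0.
  change (2, 0) with (RtoC 2); rewrite Cmod_R, Rabs_pos_eq by lra.
  reflexivity.
Qed.

Lemma Cpower_2 (a : R) : Cpower (RtoC 2) (RtoC a) = RtoC (Rpower 2 a).
Proof.
  unfold Cpower; rewrite Clog_2, <- RtoC_mult.
  unfold Cexp, RtoC, Rpower; simpl.
  rewrite cos_0, sin_0; f_equal; ring.
Qed.

Lemma beta_G (alpha : R) : G alpha (RtoC (-1)) = RtoC (beta alpha).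
Proof.
  unfold G, beta.
  destruct (Ceq_dec (RtoC (-1)) (RtoC 0)) as [H | _].
  { apply (f_equal Re) in H; simpl in H; lra. }
  replace (1 - RtoC (-1))%C with (RtoC 2)
    by (rewrite <- RtoC_minus; f_equal; ring).
  assert (Hln : 0 < ln 2) by (rewrite <- ln_1; apply ln_increasing; lra).
  destruct (Req_EM_T alpha (1 / 2)) as [_ | Ha].
  - rewrite Clog_2, <- RtoC_opp, <- RtoC_mult, <- RtoC_div by lra.
    f_equal; field; lra.
  - assert (Hp : Rpower 2 (1 - 2 * alpha) - 1 <> 0).
    { intros H.
      assert (E : Rpower 2 (1 - 2 * alpha) = Rpower 2 0)
        by (rewrite Rpower_O; lra).
      unfold Rpower in E; apply exp_inv in E.
      apply Rmult_eq_reg_r in E; [apply Ha | ]; lra. }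
    rewrite Cpower_2, <- RtoC_minus, <- !RtoC_mult, <- RtoC_div by lra.
    f_equal; field; exact Hp.
Qed.

(* Main.v *)
(** Put [a = 1 - 2 alpha] and [Q = 1 / G = K / (z K')], and for a convex [f] of order [alpha]
    let [p = z f' / f] and [P = 1 + z f'' / f' = p + z p' / p], so that [Re P > alpha]. The
    function [G] solves [G + z G' / G = h] with [h = (1 + a z) / (1 - z)], and the point is that
    [p] is subordinate to [G].

    [Q] is univalent: in the coordinate [u = log (1 - z)] the disk is convex, and [dQ/du] has
    positive real part. Lift [1/p] through [Q] to a function [w] with [w 0 = 0]. If the lift
    could not be continued, Jack's lemma at a point where [|w|] is large would give
    [z w' = m w] with [m >= 1], hence [P = h(w) + (m - 1) (h - G)(w)]. As [Re h] tends to
    [alpha] at the circle away from 1 while [Re G] stays above [alpha], this contradicts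
    [Re P > alpha]. (Near [w = 1] nothing happens, because [Q] tends to 0 there and [1/p] does not
    vanish.)

    So [p = G(w)] with [|w z| <= |z|]. The coefficient of [z^n] in [p] is [2 n gamma_n], so
    Rogosinski's theorem compares the partial sums of [|2 n gamma_n|^2] and [delta_n^2], and
    summation by parts with the weights [1 / n^2] gives the first inequality.
    The second one follows from [0 <= delta_n <= delta_1 = 1 - alpha], a consequence of the
    renewal equation [delta_n = sum b_k delta_(n-k)] for [1/Q = 1 / (1 - sum b_k z^k)], and from
    [1 - alpha <= 2 (1 - beta alpha)]. *)

Require Import Defs.
From Stdlib Require Import Reals Lra Lia Classical ClassicalEpsilon Arith.
From Coquelicot Require Import Coquelicot.
Open Scope R_scope.

(** * Complex differentiation *)

(** The reciprocal Q replaces G because G is unbounded near 1, whereas Q = 1 - sum b_n z^(n+1) with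
    b_n >= 0 and sum b_n = 1: Q is bounded, has no zero in the disc and tends to 0 at 1. The
    function h is 1 + z K''/K' for K' = (1 - z)^(-(1+a)), and the equation for G becomes z Q' = 1 -
    h Q, which is linear in Q. Defining everything by series in the parameter a, with -1 < a <= 1,
    treats alpha = 1/2 together with the other values. A bound Re G >= kappa with kappa > alpha
    strictly is wanted because the lifting argument is quantitative: on |z| <= r1 the real part of P
    exceeds alpha by a fixed margin, and Re h and Re G are both compared with that margin. The
    inequality 1 - alpha <= 2 (1 - beta) says beta <= (3 - a)/4, and comes down to 2^x >= (3 + x)/(3
    - x) on [0, 1], with equality at both ends. Holomorphic means here: with a continuous complex
    derivative. Cauchy's formula, power series expansions, the maximum principle and the Basel sum
    are all derived from real calculus. *)

Definition cder (f : C -> C) (z d : C) : Prop :=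
  forall eps, 0 < eps -> exists del, 0 < del /\
    forall w, Cmod (w - z) < del ->
      Cmod (f w - f z - d * (w - z)) <= eps * Cmod (w - z).

Definition ccont (f : C -> C) (z : C) : Prop :=
  forall eps, 0 < eps -> exists del, 0 < del /\
    forall w, Cmod (w - z) < del -> Cmod (f w - f z) < eps.

(** Componentwise, so that the real mean value theorem and the real integral apply to the parts of a
    curve. *)
Definition rder (g : R -> C) (t : R) (v : C) : Prop :=
  is_derive (fun u => Re (g u)) t (Re v) /\ is_derive (fun u => Im (g u)) t (Im v).

Lemma Cmod_le_Re_Im (z : C) : Cmod z <= Rabs (Re z) + Rabs (Im z).
Proof.
  destruct z as [x y]; unfold Cmod, Re, Im; simpl fst; simpl snd.
  rewrite <- (sqrt_Rsqr (Rabs x + Rabs y))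
    by (pose proof (Rabs_pos x); pose proof (Rabs_pos y); lra).
  apply sqrt_le_1_alt. unfold Rsqr. rewrite <- (pow2_abs x), <- (pow2_abs y).
  pose proof (Rabs_pos x); pose proof (Rabs_pos y); nra.
Qed.

Lemma Im_le_Cmod (z : C) : Rabs (Im z) <= Cmod z.
Proof. eapply Rle_trans; [apply Rmax_r | apply Rmax_Cmod]. Qed.

Lemma Cmod_minus_sym (z w : C) : Cmod (z - w) = Cmod (w - z).
Proof. rewrite <- Cmod_opp; f_equal; ring. Qed.

Lemma Cmod_triangle_rev (z w : C) : Cmod z - Cmod w <= Cmod (z - w).
Proof.
  pose proof (Cmod_triangle (z - w) w) as H.
  replace (z - w + w)%C with z in H by ring. lra.
Qed.

(** The bridge to the derivative over the field C in which the statement is phrased; the calculus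
    below works with explicit epsilons. *)
Lemma cder_is_derive (f : C -> C) (z d : C) :
  cder f z d <-> is_derive (K := C_AbsRing) (V := C_NormedModule) f z d.
Proof.
  split.
  - intros H; split; [apply is_linear_scal_l|].
    intros x Hx.
    apply (@is_filter_lim_locally_unique C_AbsRing (AbsRing_NormedModule C_AbsRing) z x) in Hx.
    subst x.
    intros [eps He]; destruct (H eps He) as [del [Hd Hw]].
    exists (mkposreal _ Hd); intros w Hb.
    change (Cmod ((f w - f z) - (w - z) * d) <= eps * Cmod (w - z)).
    replace ((w - z) * d)%C with (d * (w - z))%C by ring.
    apply Hw. exact Hb.
  - intros [_ H] eps He.
    specialize (H z (fun P HP => HP) (mkposreal _ He)).
    destruct H as [[del Hd] Hw]; exists del; split; [exact Hd|].
    intros w Hb; specialize (Hw w Hb).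
    change (Cmod ((f w - f z) - (w - z) * d) <= eps * Cmod (w - z)) in Hw.
    replace ((w - z) * d)%C with (d * (w - z))%C in Hw by ring. exact Hw.
Qed.

Lemma cder_ccont f z d : cder f z d -> ccont f z.
Proof.
  intros H eps He. destruct (H 1) as [del [Hd Hw]]; [lra|].
  pose proof (Cmod_ge_0 d) as Hd0.
  exists (Rmin del (eps / (2 + Cmod d))); split.
  { apply Rmin_pos; [lra|]. apply Rdiv_lt_0_compat; lra. }
  intros w Hb.
  assert (H1 := Rlt_le_trans _ _ _ Hb (Rmin_l _ _)).
  assert (H2 := Rlt_le_trans _ _ _ Hb (Rmin_r _ _)).
  specialize (Hw w H1).
  assert (Cmod (f w - f z) <= Cmod (f w - f z - d * (w - z)) + Cmod (d * (w - z))).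
  { eapply Rle_trans; [|apply Cmod_triangle]. right; f_equal; ring. }
  rewrite Cmod_mult in H0. pose proof (Cmod_ge_0 (w - z)).
  apply Rlt_div_r in H2; [|lra]. nra.
Qed.

Lemma cder_ext_loc f g z d r :
  0 < r -> (forall w, Cmod (w - z) < r -> f w = g w) -> cder f z d -> cder g z d.
Proof.
  intros Hr He H eps Heps. destruct (H eps Heps) as [del [Hd Hw]].
  exists (Rmin del r); split; [apply Rmin_pos; lra|]. intros w Hb.
  rewrite <- !He.
  - apply Hw. eapply Rlt_le_trans; [exact Hb | apply Rmin_l].
  - replace (z - z)%C with (RtoC 0) by ring. rewrite Cmod_0; lra.
  - eapply Rlt_le_trans; [exact Hb | apply Rmin_r].
Qed.

Lemma ccont_ext_loc f g z r :
  0 < r -> (forall w, Cmod (w - z) < r -> f w = g w) -> ccont f z -> ccont g z.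
Proof.
  intros Hr He H eps Heps. destruct (H eps Heps) as [del [Hd Hw]].
  exists (Rmin del r); split; [apply Rmin_pos; lra|]. intros w Hb.
  rewrite <- !He.
  - apply Hw. eapply Rlt_le_trans; [exact Hb | apply Rmin_l].
  - replace (z - z)%C with (RtoC 0) by ring. rewrite Cmod_0; lra.
  - eapply Rlt_le_trans; [exact Hb | apply Rmin_r].
Qed.

Lemma cder_const (c z : C) : cder (fun _ => c) z 0.
Proof.
  intros eps He; exists 1; split; [lra|]. intros w _.
  replace (c - c - 0 * (w - z))%C with (RtoC 0) by ring.
  rewrite Cmod_0. pose proof (Cmod_ge_0 (w - z)); nra.
Qed.

Lemma cder_id z : cder (fun w => w) z 1.
Proof.
  intros eps He; exists 1; split; [lra|]. intros w _.
  replace (w - z - 1 * (w - z))%C with (RtoC 0) by ring.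
  rewrite Cmod_0. pose proof (Cmod_ge_0 (w - z)); nra.
Qed.

Lemma cder_plus f g z df dg :
  cder f z df -> cder g z dg -> cder (fun w => f w + g w)%C z (df + dg).
Proof.
  intros Hf Hg eps He.
  destruct (Hf (eps / 2)) as [d1 [Hd1 H1]]; [lra|].
  destruct (Hg (eps / 2)) as [d2 [Hd2 H2]]; [lra|].
  exists (Rmin d1 d2); split; [apply Rmin_pos; lra|]. intros w Hw.
  specialize (H1 w (Rlt_le_trans _ _ _ Hw (Rmin_l _ _))).
  specialize (H2 w (Rlt_le_trans _ _ _ Hw (Rmin_r _ _))).
  replace (f w + g w - (f z + g z) - (df + dg) * (w - z))%C
    with ((f w - f z - df * (w - z)) + (g w - g z - dg * (w - z)))%C by ring.
  eapply Rle_trans; [apply Cmod_triangle|]. lra.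
Qed.

Lemma cder_mult f g z df dg :
  cder f z df -> cder g z dg ->
  cder (fun w => f w * g w)%C z (df * g z + f z * dg).
Proof.
  intros Hf Hg eps He.
  set (A := Cmod (f z)). set (B := Cmod (g z)). set (Df := Cmod df).
  assert (HA : 0 <= A) by apply Cmod_ge_0. assert (HB : 0 <= B) by apply Cmod_ge_0.
  assert (HD : 0 <= Df) by apply Cmod_ge_0.
  destruct (Hf (eps / 3 / (B + 1))) as [d1 [Hd1 H1]].
  { apply Rdiv_lt_0_compat; lra. }
  destruct (Hg (eps / 3 / (A + 1))) as [d2 [Hd2 H2]].
  { apply Rdiv_lt_0_compat; lra. }
  destruct (cder_ccont g z dg Hg 1) as [d3 [Hd3 H3]]; [lra|].
  destruct (cder_ccont g z dg Hg (eps / 3 / (Df + 1))) as [d4 [Hd4 H4]].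
  { apply Rdiv_lt_0_compat; lra. }
  exists (Rmin (Rmin d1 d2) (Rmin d3 d4)); split.
  { repeat apply Rmin_pos; lra. }
  intros w Hw.
  assert (Hw12 := Rlt_le_trans _ _ _ Hw (Rmin_l _ _)).
  assert (Hw34 := Rlt_le_trans _ _ _ Hw (Rmin_r _ _)).
  specialize (H1 w (Rlt_le_trans _ _ _ Hw12 (Rmin_l _ _))).
  specialize (H2 w (Rlt_le_trans _ _ _ Hw12 (Rmin_r _ _))).
  specialize (H3 w (Rlt_le_trans _ _ _ Hw34 (Rmin_l _ _))).
  specialize (H4 w (Rlt_le_trans _ _ _ Hw34 (Rmin_r _ _))).
  clear Hw Hw12 Hw34.
  replace (f w * g w - f z * g z - (df * g z + f z * dg) * (w - z))%C
    with ((f w - f z - df * (w - z)) * g w + f z * (g w - g z - dg * (w - z))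
          + df * (w - z) * (g w - g z))%C by ring.
  eapply Rle_trans; [apply Cmod_triangle|].
  eapply Rle_trans; [apply Rplus_le_compat_r, Cmod_triangle|].
  rewrite !Cmod_mult. fold A Df.
  assert (HG : Cmod (g w) <= B + 1).
  { pose proof (Cmod_triangle_rev (g w) (g z)). unfold B; lra. }
  set (h := Cmod (w - z)) in *. assert (Hh : 0 <= h) by apply Cmod_ge_0.
  assert (E1 : Cmod (f w - f z - df * (w - z)) * Cmod (g w) <= eps / 3 * h).
  { replace (eps / 3 * h) with (eps / 3 / (B + 1) * h * (B + 1)) by (field; lra).
    apply Rmult_le_compat; auto using Cmod_ge_0. }
  assert (E2 : A * Cmod (g w - g z - dg * (w - z)) <= eps / 3 * h).
  { replace (eps / 3 * h) with ((A + 1) * (eps / 3 / (A + 1) * h)) by (field; lra).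
    apply Rmult_le_compat; auto using Cmod_ge_0; lra. }
  assert (E3 : Df * h * Cmod (g w - g z) <= eps / 3 * h).
  { replace (eps / 3 * h) with ((Df + 1) * h * (eps / 3 / (Df + 1))) by (field; lra).
    apply Rmult_le_compat; auto using Cmod_ge_0; nra. }
  lra.
Qed.

Lemma cder_scal c f z d : cder f z d -> cder (fun w => c * f w)%C z (c * d).
Proof.
  intros H. replace (c * d)%C with (0 * f z + c * d)%C by ring.
  apply (cder_mult (fun _ => c)); [apply cder_const | exact H].
Qed.

Lemma cder_opp f z d : cder f z d -> cder (fun w => - f w)%C z (- d).
Proof.
  intros H. apply (cder_ext_loc (fun w => (-1) * f w)%C _ _ _ 1); [lra | intros; ring |].
  replace (- d)%C with ((-1) * d)%C by ring. now apply cder_scal.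
Qed.

Lemma cder_minus f g z df dg :
  cder f z df -> cder g z dg -> cder (fun w => f w - g w)%C z (df - dg).
Proof. intros; apply cder_plus; [|apply cder_opp]; assumption. Qed.

Lemma cder_comp f g z df dg :
  cder f (g z) df -> cder g z dg -> cder (fun w => f (g w)) z (df * dg).
Proof.
  intros Hf Hg eps He.
  set (D := Cmod df). set (E := Cmod dg).
  assert (HD : 0 <= D) by apply Cmod_ge_0. assert (HE : 0 <= E) by apply Cmod_ge_0.
  destruct (Hf (eps / 2 / (E + 1))) as [d1 [Hd1 H1]].
  { apply Rdiv_lt_0_compat; lra. }
  destruct (Hg (Rmin 1 (eps / 2 / (D + 1)))) as [d2 [Hd2 H2]].
  { apply Rmin_pos; [lra | apply Rdiv_lt_0_compat; lra]. }
  destruct (cder_ccont g z dg Hg d1 Hd1) as [d3 [Hd3 H3]].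
  exists (Rmin d2 d3); split; [apply Rmin_pos; lra|]. intros w Hw.
  specialize (H2 w (Rlt_le_trans _ _ _ Hw (Rmin_l _ _))).
  specialize (H3 w (Rlt_le_trans _ _ _ Hw (Rmin_r _ _))).
  specialize (H1 (g w) H3).
  set (h := Cmod (w - z)) in *. assert (Hh : 0 <= h) by apply Cmod_ge_0.
  replace (f (g w) - f (g z) - df * dg * (w - z))%C
    with ((f (g w) - f (g z) - df * (g w - g z))
          + df * (g w - g z - dg * (w - z)))%C by ring.
  eapply Rle_trans; [apply Cmod_triangle|]. rewrite Cmod_mult. fold D.
  assert (HG : Cmod (g w - g z) <= (E + 1) * h).
  { replace (g w - g z)%C with ((g w - g z - dg * (w - z)) + dg * (w - z))%C by ring.
    eapply Rle_trans; [apply Cmod_triangle|]. rewrite Cmod_mult. fold E h.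
    pose proof (Rmin_l 1 (eps / 2 / (D + 1))). nra. }
  assert (E1 : Cmod (f (g w) - f (g z) - df * (g w - g z)) <= eps / 2 * h).
  { eapply Rle_trans; [exact H1|].
    replace (eps / 2 * h) with (eps / 2 / (E + 1) * ((E + 1) * h)) by (field; lra).
    apply Rmult_le_compat_l; [|exact HG]. apply Rlt_le, Rdiv_lt_0_compat; lra. }
  assert (E2 : D * Cmod (g w - g z - dg * (w - z)) <= eps / 2 * h).
  { replace (eps / 2 * h) with ((D + 1) * (eps / 2 / (D + 1) * h)) by (field; lra).
    apply Rmult_le_compat; auto using Cmod_ge_0; [lra|].
    eapply Rle_trans; [exact H2|]. apply Rmult_le_compat_r; [lra | apply Rmin_r]. }
  lra.
Qed.

(** Only continuity is asked of [g]. This is how the logarithm, and later a lift through a conformal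
    map, obtain their derivatives. *)
Lemma cder_local_inverse f g z df dk :
  cder f (g z) df -> df <> RtoC 0 -> ccont g z ->
  cder (fun w => f (g w)) z dk -> cder g z (dk / df).
Proof.
  intros Hf Hdf Hg Hk eps He.
  assert (HD : 0 < Cmod df) by now apply Cmod_gt_0.
  set (D := Cmod df) in *. set (E := Cmod dk).
  assert (HE : 0 <= E) by apply Cmod_ge_0.
  (* A Lipschitz bound for [g] at [z]: if |b - df a| <= (D/2)|a| then |a| <= 2|b|/D, while |b| <= (E
     + 1) h. *)
  set (M := 2 * (E + 1) / D). assert (HM : 0 < M) by (apply Rdiv_lt_0_compat; lra).
  destruct (Hf (Rmin (D / 2) (eps * D / 2 / M))) as [d1 [Hd1 H1]].
  { apply Rmin_pos; [lra|]. apply Rdiv_lt_0_compat; nra. }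
  destruct (Hg d1 Hd1) as [d2 [Hd2 H2]].
  destruct (Hk (Rmin 1 (eps * D / 2))) as [d3 [Hd3 H3]].
  { apply Rmin_pos; nra. }
  exists (Rmin d2 d3); split; [apply Rmin_pos; lra|]. intros w Hw.
  specialize (H2 w (Rlt_le_trans _ _ _ Hw (Rmin_l _ _))).
  specialize (H3 w (Rlt_le_trans _ _ _ Hw (Rmin_r _ _))).
  specialize (H1 (g w) H2). simpl in H3.
  set (h := Cmod (w - z)) in *. assert (Hh : 0 <= h) by apply Cmod_ge_0.
  set (a := (g w - g z)%C) in *. set (b := (f (g w) - f (g z))%C) in *.
  assert (Ha0 : 0 <= Cmod a) by apply Cmod_ge_0.
  assert (H1a : Cmod (b - df * a) <= D / 2 * Cmod a).
  { eapply Rle_trans; [exact H1|]. apply Rmult_le_compat_r; [lra|apply Rmin_l]. }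
  assert (H1b : Cmod (b - df * a) <= eps * D / 2 / M * Cmod a).
  { eapply Rle_trans; [exact H1|]. apply Rmult_le_compat_r; [lra|apply Rmin_r]. }
  assert (H3a : Cmod (b - dk * (w - z)) <= h).
  { eapply Rle_trans; [exact H3|]. pose proof (Rmin_l 1 (eps * D / 2)); nra. }
  assert (H3b : Cmod (b - dk * (w - z)) <= eps * D / 2 * h).
  { eapply Rle_trans; [exact H3|]. apply Rmult_le_compat_r; [lra|apply Rmin_r]. }
  assert (Hb : Cmod b <= (E + 1) * h).
  { replace b with ((b - dk * (w - z)) + dk * (w - z))%C by ring.
    eapply Rle_trans; [apply Cmod_triangle|]. rewrite Cmod_mult. fold E h. lra. }
  assert (Ha : Cmod a <= M * h).
  { pose proof (Cmod_triangle_rev (df * a) b) as T. rewrite Cmod_mult in T. fold D in T.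
    rewrite Cmod_minus_sym in T.
    apply Rmult_le_reg_l with (D / 2); [lra|].
    replace (D / 2 * (M * h)) with ((E + 1) * h) by (unfold M; field; lra). lra. }
  replace (a - dk / df * (w - z))%C with ((b - dk * (w - z)) / df - (b - df * a) / df)%C
    by (field; exact Hdf).
  eapply Rle_trans; [apply Cmod_triangle|]. rewrite Cmod_opp, !Cmod_div by exact Hdf.
  fold D.
  apply Rmult_le_reg_l with D; [lra|].
  replace (D * (Cmod (b - dk * (w - z)) / D + Cmod (b - df * a) / D))
    with (Cmod (b - dk * (w - z)) + Cmod (b - df * a)) by (field; lra).
  assert (eps * D / 2 / M * Cmod a <= eps * D / 2 * h).
  { replace (eps * D / 2 * h) with (eps * D / 2 / M * (M * h)) by (field; lra).
    apply Rmult_le_compat_l; [apply Rlt_le, Rdiv_lt_0_compat; nra | exact Ha]. }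
  nra.
Qed.

Lemma ccont_id z : ccont (fun w => w) z.
Proof. eapply cder_ccont, cder_id. Qed.

Lemma ccont_const c z : ccont (fun w => c) z.
Proof. eapply cder_ccont, cder_const. Qed.

Lemma ccont_plus f g z : ccont f z -> ccont g z -> ccont (fun w => f w + g w)%C z.
Proof.
  intros Hf Hg eps He.
  destruct (Hf (eps / 2)) as [d1 [Hd1 H1]]; [lra|].
  destruct (Hg (eps / 2)) as [d2 [Hd2 H2]]; [lra|].
  exists (Rmin d1 d2); split; [apply Rmin_pos; lra|]. intros w Hw.
  specialize (H1 w (Rlt_le_trans _ _ _ Hw (Rmin_l _ _))).
  specialize (H2 w (Rlt_le_trans _ _ _ Hw (Rmin_r _ _))).
  replace (f w + g w - (f z + g z))%C with ((f w - f z) + (g w - g z))%C by ring.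
  eapply Rle_lt_trans; [apply Cmod_triangle|]. lra.
Qed.

Lemma ccont_comp f g z : ccont f (g z) -> ccont g z -> ccont (fun w => f (g w)) z.
Proof.
  intros Hf Hg eps He.
  destruct (Hf eps He) as [d1 [Hd1 H1]]. destruct (Hg d1 Hd1) as [d2 [Hd2 H2]].
  exists d2; split; auto.
Qed.

Lemma ccont_mult f g z : ccont f z -> ccont g z -> ccont (fun w => f w * g w)%C z.
Proof.
  intros Hf Hg eps He.
  set (A := Cmod (f z)). set (B := Cmod (g z)).
  assert (HA : 0 <= A) by apply Cmod_ge_0. assert (HB : 0 <= B) by apply Cmod_ge_0.
  destruct (Hf (eps / 2 / (B + 1))) as [d1 [Hd1 H1]].
  { apply Rdiv_lt_0_compat; lra. }
  destruct (Hg (eps / 2 / (A + 1))) as [d2 [Hd2 H2]].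
  { apply Rdiv_lt_0_compat; lra. }
  destruct (Hg 1) as [d3 [Hd3 H3]]; [lra|].
  exists (Rmin d1 (Rmin d2 d3)); split.
  { repeat apply Rmin_pos; lra. }
  intros w Hw.
  assert (Hw23 := Rlt_le_trans _ _ _ Hw (Rmin_r _ _)).
  specialize (H1 w (Rlt_le_trans _ _ _ Hw (Rmin_l _ _))).
  specialize (H2 w (Rlt_le_trans _ _ _ Hw23 (Rmin_l _ _))).
  specialize (H3 w (Rlt_le_trans _ _ _ Hw23 (Rmin_r _ _))).
  replace (f w * g w - f z * g z)%C with ((f w - f z) * g w + f z * (g w - g z))%C by ring.
  eapply Rle_lt_trans; [apply Cmod_triangle|]. rewrite !Cmod_mult. fold A.
  assert (HG : Cmod (g w) <= B + 1).
  { pose proof (Cmod_triangle_rev (g w) (g z)). unfold B; lra. }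
  assert (E1 : Cmod (f w - f z) * Cmod (g w) <= Cmod (f w - f z) * (B + 1)).
  { apply Rmult_le_compat_l; [apply Cmod_ge_0 | exact HG]. }
  assert (E2 : Cmod (f w - f z) * (B + 1) < eps / 2).
  { replace (eps / 2) with (eps / 2 / (B + 1) * (B + 1)) by (field; lra).
    apply Rmult_lt_compat_r; lra. }
  assert (E3 : A * Cmod (g w - g z) <= (A + 1) * Cmod (g w - g z)).
  { apply Rmult_le_compat_r; [apply Cmod_ge_0 | lra]. }
  assert (E4 : (A + 1) * Cmod (g w - g z) < eps / 2).
  { replace (eps / 2) with ((A + 1) * (eps / 2 / (A + 1))) by (field; lra).
    apply Rmult_lt_compat_l; lra. }
  lra.
Qed.

Lemma ccont_inv z : z <> RtoC 0 -> ccont Cinv z.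
Proof.
  intros Hz eps He. assert (HA : 0 < Cmod z) by now apply Cmod_gt_0.
  set (A := Cmod z) in *.
  exists (Rmin (A / 2) (eps * A * A / 2)); split.
  { apply Rmin_pos; [lra|]. assert (0 < A * A) by nra. nra. }
  intros w Hw.
  assert (H1 := Rlt_le_trans _ _ _ Hw (Rmin_l _ _)).
  assert (H2 := Rlt_le_trans _ _ _ Hw (Rmin_r _ _)). clear Hw.
  assert (HB : A / 2 < Cmod w).
  { pose proof (Cmod_triangle_rev z w). rewrite Cmod_minus_sym in H. fold A in H. lra. }
  assert (Hw : w <> RtoC 0) by (apply Cmod_gt_0; lra).
  replace (/ w - / z)%C with (- (w - z) / (w * z))%C by (field; auto).
  rewrite Cmod_div by now apply Cmult_neq_0.
  rewrite Cmod_opp, Cmod_mult. fold A.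
  apply Rlt_div_l; [nra|]. eapply Rlt_le_trans; [exact H2|].
  replace (eps * A * A / 2) with (eps * (A / 2 * A)) by field.
  apply Rmult_le_compat_l; [lra|]. nra.
Qed.

Lemma cder_inv z : z <> RtoC 0 -> cder Cinv z (- / (z * z)).
Proof.
  intros Hz eps He. assert (HA : 0 < Cmod z) by now apply Cmod_gt_0.
  destruct (ccont_inv z Hz (eps * Cmod z)) as [d1 [Hd1 H1]]; [nra|].
  exists (Rmin d1 (Cmod z)); split; [apply Rmin_pos; lra|]. intros w Hw.
  specialize (H1 w (Rlt_le_trans _ _ _ Hw (Rmin_l _ _))).
  assert (H2 := Rlt_le_trans _ _ _ Hw (Rmin_r _ _)).
  assert (Hw0 : w <> RtoC 0).
  { intros ->. replace (0 - z)%C with (- z)%C in H2 by ring. rewrite Cmod_opp in H2; lra. }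
  replace (/ w - / z - - / (z * z) * (w - z))%C
    with (- (w - z) * (/ w - / z) / z)%C by (field; auto).
  rewrite Cmod_div, Cmod_mult, Cmod_opp by exact Hz.
  apply Rle_div_l; [lra|]. pose proof (Cmod_ge_0 (w - z)). nra.
Qed.

Lemma cder_pow n z : cder (fun w => w ^ n)%C z (INR n * z ^ (pred n)).
Proof.
  induction n as [|n IH].
  - replace (INR 0 * z ^ pred 0)%C with (RtoC 0) by (simpl; ring). exact (cder_const 1 z).
  - replace (INR (S n) * z ^ pred (S n))%C with (1 * z ^ n + z * (INR n * z ^ pred n))%C.
    { apply (cder_mult (fun w => w) (fun w => w ^ n)%C); [apply cder_id | exact IH]. }
    rewrite S_INR, RtoC_plus. destruct n; simpl; ring.
Qed.

Lemma cder_eq f z d d' : cder f z d -> d = d' -> cder f z d'.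
Proof. now intros H <-. Qed.

Lemma rder_eps g t v : rder g t v <->
  forall eps, 0 < eps -> exists del, 0 < del /\
    forall u, Rabs (u - t) < del ->
      Cmod (g u - g t - v * RtoC (u - t)) <= eps * Rabs (u - t).
Proof.
  assert (Hr : forall (k : R -> R) l, is_derive k t l <->
     forall eps, 0 < eps -> exists del, 0 < del /\ forall u, Rabs (u - t) < del ->
       Rabs (k u - k t - l * (u - t)) <= eps * Rabs (u - t)).
  { intros k l; split.
    - intros [_ H] eps He.
      specialize (H t (fun P HP => HP) (mkposreal _ He)).
      destruct H as [[del Hd] Hw]; exists del; split; [exact Hd|].
      intros u Hu; specialize (Hw u Hu).
      change (Rabs ((k u - k t) - (u - t) * l) <= eps * Rabs (u - t)) in Hw.
      now rewrite (Rmult_comm l).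
    - intros H; split; [apply is_linear_scal_l|].
      intros x Hx.
      apply (@is_filter_lim_locally_unique R_AbsRing (AbsRing_NormedModule R_AbsRing) t x) in Hx.
      subst x. intros [eps He]. destruct (H eps He) as [del [Hd Hw]].
      exists (mkposreal _ Hd); intros u Hu.
      change (Rabs ((k u - k t) - (u - t) * l) <= eps * Rabs (u - t)).
      rewrite (Rmult_comm _ l). now apply Hw. }
  unfold rder; rewrite !Hr; split.
  - intros [H1 H2] eps He.
    destruct (H1 (eps / 2)) as [d1 [Hd1 K1]]; [lra|].
    destruct (H2 (eps / 2)) as [d2 [Hd2 K2]]; [lra|].
    exists (Rmin d1 d2); split; [apply Rmin_pos; lra|]. intros u Hu.
    specialize (K1 u (Rlt_le_trans _ _ _ Hu (Rmin_l _ _))).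
    specialize (K2 u (Rlt_le_trans _ _ _ Hu (Rmin_r _ _))).
    eapply Rle_trans; [apply Cmod_le_Re_Im|].
    replace (Re (g u - g t - v * RtoC (u - t))) with (Re (g u) - Re (g t) - Re v * (u - t))
      by (unfold Re; simpl; ring).
    replace (Im (g u - g t - v * RtoC (u - t))) with (Im (g u) - Im (g t) - Im v * (u - t))
      by (unfold Im; simpl; ring).
    lra.
  - intros H; split; intros eps He; destruct (H eps He) as [d [Hd K]];
      exists d; (split; [exact Hd|]); intros u Hu; specialize (K u Hu);
      (eapply Rle_trans; [|exact K]).
    + replace (Re (g u) - Re (g t) - Re v * (u - t)) with (Re (g u - g t - v * RtoC (u - t)))
        by (unfold Re; simpl; ring). apply re_le_Cmod.
    + replace (Im (g u) - Im (g t) - Im v * (u - t)) with (Im (g u - g t - v * RtoC (u - t)))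
        by (unfold Im; simpl; ring). apply Im_le_Cmod.
Qed.

Lemma rder_comp F g t d v :
  cder F (g t) d -> rder g t v -> rder (fun u => F (g u)) t (d * v).
Proof.
  rewrite !rder_eps. intros Hf Hg eps He.
  set (D := Cmod d). set (E := Cmod v).
  assert (HD : 0 <= D) by apply Cmod_ge_0. assert (HE : 0 <= E) by apply Cmod_ge_0.
  destruct (Hf (eps / 2 / (E + 1))) as [d1 [Hd1 H1]].
  { apply Rdiv_lt_0_compat; lra. }
  destruct (Hg (Rmin 1 (eps / 2 / (D + 1)))) as [d2 [Hd2 H2]].
  { apply Rmin_pos; [lra | apply Rdiv_lt_0_compat; lra]. }
  exists (Rmin d2 (d1 / (E + 1))); split.
  { apply Rmin_pos; [lra|]. apply Rdiv_lt_0_compat; lra. }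
  intros u Hu.
  specialize (H2 u (Rlt_le_trans _ _ _ Hu (Rmin_l _ _))).
  assert (Hu2 := Rlt_le_trans _ _ _ Hu (Rmin_r _ _)).
  set (h := Rabs (u - t)) in *. assert (Hh : 0 <= h) by apply Rabs_pos.
  assert (HG : Cmod (g u - g t) <= (E + 1) * h).
  { replace (g u - g t)%C with ((g u - g t - v * RtoC (u - t)) + v * RtoC (u - t))%C by ring.
    eapply Rle_trans; [apply Cmod_triangle|]. rewrite Cmod_mult, Cmod_R. fold E h.
    pose proof (Rmin_l 1 (eps / 2 / (D + 1))). nra. }
  assert (H3 : Cmod (g u - g t) < d1).
  { eapply Rle_lt_trans; [exact HG|]. rewrite Rmult_comm. apply Rlt_div_r; [lra|exact Hu2]. }
  specialize (H1 (g u) H3).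
  replace (F (g u) - F (g t) - d * v * RtoC (u - t))%C
    with ((F (g u) - F (g t) - d * (g u - g t))
          + d * (g u - g t - v * RtoC (u - t)))%C by ring.
  eapply Rle_trans; [apply Cmod_triangle|]. rewrite Cmod_mult. fold D.
  assert (E1 : Cmod (F (g u) - F (g t) - d * (g u - g t)) <= eps / 2 * h).
  { eapply Rle_trans; [exact H1|].
    replace (eps / 2 * h) with (eps / 2 / (E + 1) * ((E + 1) * h)) by (field; lra).
    apply Rmult_le_compat_l; [|exact HG]. apply Rlt_le, Rdiv_lt_0_compat; lra. }
  assert (E2 : D * Cmod (g u - g t - v * RtoC (u - t)) <= eps / 2 * h).
  { replace (eps / 2 * h) with ((D + 1) * (eps / 2 / (D + 1) * h)) by (field; lra).
    apply Rmult_le_compat; auto using Cmod_ge_0; [lra|].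
    eapply Rle_trans; [exact H2|]. apply Rmult_le_compat_r; [lra | apply Rmin_r]. }
  lra.
Qed.

Lemma rder_affine a b t : rder (fun u => a + RtoC u * b)%C t b.
Proof.
  apply rder_eps; intros eps He; exists 1; split; [lra|]. intros u _.
  replace (a + RtoC u * b - (a + RtoC t * b) - b * RtoC (u - t))%C with (RtoC 0).
  - rewrite Cmod_0. pose proof (Rabs_pos (u - t)); nra.
  - rewrite RtoC_minus; ring.
Qed.

Lemma cder_along F a b t d :
  cder F (a + RtoC t * b)%C d -> rder (fun u => F (a + RtoC u * b)%C) t (d * b).
Proof. intros H; apply (rder_comp F (fun u => a + RtoC u * b)%C); [exact H | apply rder_affine]. Qed.

(** Testing a curve against a constant [e] reduces complex estimates to real functions; [e] will be
    unimodular, a conjugate, or [- Ci] to read off an imaginary part. *)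
Lemma is_derive_Re_mult e g t v : rder g t v -> is_derive (fun u => Re (e * g u)) t (Re (e * v)).
Proof.
  intros H.
  assert (K : cder (fun w => e * w)%C (g t) e).
  { eapply cder_eq; [apply cder_scal, cder_id | ring]. }
  exact (proj1 (rder_comp _ _ _ _ _ K H)).
Qed.

Lemma rder_RtoC k t l : is_derive k t l -> rder (fun u => RtoC (k u)) t (RtoC l).
Proof. intros H; split; [exact H | apply (is_derive_const 0)]. Qed.

Lemma is_derive_Rmult p q t p' q' : is_derive p t p' -> is_derive q t q' ->
  is_derive (fun u => p u * q u) t (p' * q t + p t * q').
Proof. intros Hp Hq. apply (is_derive_mult p q t p' q' Hp Hq). exact Rmult_comm. Qed.

Lemma rder_mult g h t v w :
  rder g t v -> rder h t w -> rder (fun u => g u * h u)%C t (v * h t + g t * w).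
Proof.
  intros [G1 G2] [H1 H2].
  split.
  - replace (Re (v * h t + g t * w))
      with (Re v * Re (h t) + Re (g t) * Re w - (Im v * Im (h t) + Im (g t) * Im w))
      by (unfold Re, Im; simpl; ring).
    apply (is_derive_minus (fun u => Re (g u) * Re (h u)) (fun u => Im (g u) * Im (h u)));
      now apply is_derive_Rmult.
  - replace (Im (v * h t + g t * w))
      with (Re v * Im (h t) + Re (g t) * Im w + (Im v * Re (h t) + Im (g t) * Re w))
      by (unfold Re, Im; simpl; ring).
    apply (is_derive_plus (fun u => Re (g u) * Im (h u)) (fun u => Im (g u) * Re (h u)));
      now apply is_derive_Rmult.
Qed.

Lemma rder_eq g t v v' : rder g t v -> v = v' -> rder g t v'.
Proof. now intros H <-. Qed.

Lemma rder_minus g h t v w : rder g t v -> rder h t w -> rder (fun u => g u - h u)%C t (v - w).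
Proof.
  intros [G1 G2] [H1 H2]. split.
  - apply (is_derive_minus (fun u => Re (g u)) (fun u => Re (h u))); assumption.
  - apply (is_derive_minus (fun u => Im (g u)) (fun u => Im (h u))); assumption.
Qed.

(** * Power series *)

Notation is_cseries := (@is_series C_AbsRing C_NormedModule).

Lemma incr_01 (g g' : R -> R) :
  (forall t, 0 <= t <= 1 -> is_derive g t (g' t)) ->
  (forall t, 0 < t < 1 -> 0 <= g' t) -> g 0 <= g 1.
Proof.
  intros Hd Hp.
  destruct (MVT_cor2 g g' 0 1) as [c [Hc1 Hc2]]; [lra| |].
  - intros c Hc; apply is_derive_Reals, Hd, Hc.
  - specialize (Hp c Hc2); nra.
Qed.

Lemma strict_incr_01 (g g' : R -> R) :
  (forall t, 0 <= t <= 1 -> is_derive g t (g' t)) ->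
  (forall t, 0 < t < 1 -> 0 < g' t) -> g 0 < g 1.
Proof.
  intros Hd Hp.
  destruct (MVT_cor2 g g' 0 1) as [c [Hc1 Hc2]]; [lra| |].
  - intros c Hc; apply is_derive_Reals, Hd, Hc.
  - specialize (Hp c Hc2); nra.
Qed.

Lemma C_ext (z w : C) : Re z = Re w -> Im z = Im w -> z = w.
Proof. destruct z, w; unfold Re, Im; simpl; congruence. Qed.

Lemma Re_le_Cmod' z : Re z <= Cmod z.
Proof. eapply Rle_trans; [apply Rle_abs | apply re_le_Cmod]. Qed.

(** The rotation [Cconj z / Cmod z] turns [z] into its modulus. Bounds on complex increments and
    means thus follow from real inequalities. *)
Lemma Cmod_le_of_Re z k : (forall e, Cmod e = 1 -> Re (e * z) <= k) -> Cmod z <= k.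
Proof.
  intros H. destruct (Ceq_dec z 0) as [->|Hz].
  - specialize (H 1%C Cmod_1). rewrite Cmod_0.
    replace (Re (1 * 0)) with 0 in H by (unfold Re; simpl; ring). exact H.
  - assert (Hm : 0 < Cmod z) by now apply Cmod_gt_0.
    assert (Hn : RtoC (Cmod z) <> 0) by (intros E; apply RtoC_inj in E; lra).
    specialize (H (Cconj z / Cmod z)%C).
    rewrite Cmod_div, Cmod_conj, Cmod_R, Rabs_pos_eq in H by (auto; lra).
    replace (Cconj z / Cmod z * z)%C with (RtoC (Cmod z)) in H.
    + apply H. field; lra.
    + replace (Cconj z / Cmod z * z)%C with (z * Cconj z / Cmod z)%C by (field; auto).
      rewrite <- Cmod2_conj, RtoC_pow. field; auto.
Qed.

(** A complex curve has no mean value equality, so each rotated real part is compared with [k]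
    separately. *)
Lemma Cmod_diff_le_rder (g g' : R -> C) k k' :
  (forall t, 0 <= t <= 1 -> rder g t (g' t)) ->
  (forall t, 0 <= t <= 1 -> is_derive k t (k' t)) ->
  (forall t, 0 < t < 1 -> Cmod (g' t) <= k' t) ->
  Cmod (g 1 - g 0) <= k 1 - k 0.
Proof.
  intros Hg Hk Hb. apply Cmod_le_of_Re; intros e He.
  assert (k 0 - Re (e * g 0) <= k 1 - Re (e * g 1)).
  { apply (incr_01 (fun t => k t - Re (e * g t)) (fun t => k' t - Re (e * g' t))).
    - intros t Ht. apply (is_derive_minus k (fun t => Re (e * g t))); [now apply Hk|].
      apply is_derive_Re_mult; auto.
    - intros t Ht. pose proof (Re_le_Cmod' (e * g' t)) as T. rewrite Cmod_mult, He in T.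
      specialize (Hb t Ht); lra. }
  replace (Re (e * (g 1 - g 0))) with (Re (e * g 1) - Re (e * g 0)) by (unfold Re; simpl; ring).
  lra.
Qed.

Lemma cder_unique F z d d' : cder F z d -> cder F z d' -> d = d'.
Proof.
  intros H H'. apply cder_is_derive, is_C_derive_unique in H, H'. congruence.
Qed.

(** The origin is exempted because the derivatives to be killed are computed after a division by z.
    The segment from 0 to z meets 0 only at its end, where the mean value inequality asks for no
    bound. *)
Lemma cder_zero_const F r :
  (forall z, Cmod z < r -> exists d, cder F z d /\ (z <> RtoC 0 -> d = RtoC 0)) ->
  forall z, Cmod z < r -> F z = F 0.
Proof.
  intros H z Hz.
  assert (Hin : forall t, 0 <= t <= 1 -> Cmod (0 + t * z) < r).
  { intros t Ht. replace (0 + t * z)%C with (t * z)%C by ring.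
    rewrite Cmod_mult, Cmod_R, Rabs_pos_eq by lra. pose proof (Cmod_ge_0 z); nra. }
  destruct (Ceq_dec z 0) as [->|Hz0]; [reflexivity|].
  assert (Hd : forall t, 0 <= t <= 1 -> cder F (0 + t * z) (C_derive F (0 + t * z))).
  { intros t Ht. destruct (H _ (Hin t Ht)) as [d [Hd _]].
    replace (C_derive F (0 + t * z)) with d; [exact Hd|]. symmetry.
    now apply is_C_derive_unique, cder_is_derive. }
  assert (E : Cmod (F (0 + 1 * z)%C - F (0 + 0 * z)%C) <= 0 - 0).
  { apply (Cmod_diff_le_rder (fun t => F (0 + RtoC t * z)%C)
             (fun t => C_derive F (0 + RtoC t * z)%C * z)%C (fun _ => 0) (fun _ => 0)).
    - intros t Ht. now apply cder_along, Hd.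
    - intros; auto_derive; trivial.
    - intros t Ht. destruct (H (0 + t * z)%C) as [d [Hd' E]]; [apply Hin; lra|].
      apply cder_is_derive, is_C_derive_unique in Hd'. rewrite Hd', E.
      + replace (0 * z)%C with (RtoC 0) by ring. rewrite Cmod_0; lra.
      + replace (0 + t * z)%C with (t * z)%C by ring. apply Cmult_neq_0; [|exact Hz0].
        intros E'; apply RtoC_inj in E'; lra. }
  replace (0 + 1 * z)%C with z in E by ring. replace (0 + 0 * z)%C with (RtoC 0) in E by ring.
  pose proof (Cmod_ge_0 (F z - F 0)).
  assert (E0 : Cmod (F z - F 0) = 0) by lra. apply Cmod_eq_0 in E0.
  replace (F z) with (F z - F 0 + F 0)%C by ring. rewrite E0; ring.
Qed.

Lemma sum_n_Re (a : nat -> C) n : Re (sum_n a n) = sum_n (fun k => Re (a k)) n.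
Proof.
  induction n; [now rewrite !sum_O|]. rewrite !sum_Sn. rewrite <- IHn. reflexivity.
Qed.
Lemma sum_n_Im (a : nat -> C) n : Im (sum_n a n) = sum_n (fun k => Im (a k)) n.
Proof.
  induction n; [now rewrite !sum_O|]. rewrite !sum_Sn. rewrite <- IHn. reflexivity.
Qed.

Lemma is_series_R_eps (a : nat -> R) l : is_series a l <->
  forall eps, 0 < eps -> exists N, forall n, (N <= n)%nat -> Rabs (sum_n a n - l) < eps.
Proof.
  split.
  - intros H eps He.
    destruct (proj1 (filterlim_locally (sum_n a) l) H (mkposreal _ He)) as [N HN].
    exists N. intros n Hn. exact (HN n Hn).
  - intros H. apply filterlim_locally. intros [eps He].
    destruct (H eps He) as [N HN]. exists N; intros n Hn; exact (HN n Hn).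
Qed.

Lemma is_cseries_eps (a : nat -> C) (l : C) : is_cseries a l <->
  forall eps, 0 < eps -> exists N, forall n, (N <= n)%nat -> Cmod (sum_n a n - l) < eps.
Proof.
  split.
  - intros H eps He.
    (* The balls of C are squares, so passing to the modulus costs a factor sqrt 2, which is less
       than 2. *)
    assert (He2 : 0 < eps / 2) by lra.
    destruct (proj1 (filterlim_locally (sum_n a) l) H (mkposreal _ He2)) as [N HN].
    exists N. intros n Hn.
    specialize (HN n Hn). apply C_NormedModule_mixin_compat2 in HN.
    change (Cmod (sum_n a n - l) < sqrt 2 * (eps / 2)) in HN.
    assert (sqrt 2 < 2).
    { rewrite <- (sqrt_Rsqr 2) at 2 by lra. apply sqrt_lt_1; unfold Rsqr; lra. }
    nra.
  - intros H. apply filterlim_locally. intros [eps He].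
    destruct (H eps He) as [N HN]. exists N; intros n Hn.
    apply C_NormedModule_mixin_compat1. exact (HN n Hn).
Qed.

Lemma is_cseries_Re_Im (a : nat -> C) (l : C) :
  is_cseries a l <-> is_series (fun n => Re (a n)) (Re l) /\ is_series (fun n => Im (a n)) (Im l).
Proof.
  rewrite is_cseries_eps, !is_series_R_eps. split.
  - intros H; split; intros eps He; destruct (H eps He) as [N HN]; exists N; intros n Hn;
      (eapply Rle_lt_trans; [|exact (HN n Hn)]).
    + rewrite <- sum_n_Re. replace (Re (sum_n a n) - Re l) with (Re (sum_n a n - l))
        by (unfold Re; simpl; ring). apply re_le_Cmod.
    + rewrite <- sum_n_Im. replace (Im (sum_n a n) - Im l) with (Im (sum_n a n - l))
        by (unfold Im; simpl; ring). apply Im_le_Cmod.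
  - intros [H1 H2] eps He.
    destruct (H1 (eps / 2)) as [N1 K1]; [lra|]. destruct (H2 (eps / 2)) as [N2 K2]; [lra|].
    exists (max N1 N2); intros n Hn. specialize (K1 n ltac:(lia)). specialize (K2 n ltac:(lia)).
    rewrite <- sum_n_Re in K1. rewrite <- sum_n_Im in K2.
    eapply Rle_lt_trans; [apply Cmod_le_Re_Im|].
    replace (Re (sum_n a n - l)) with (Re (sum_n a n) - Re l) by (unfold Re; simpl; ring).
    replace (Im (sum_n a n - l)) with (Im (sum_n a n) - Im l) by (unfold Im; simpl; ring).
    lra.
Qed.

Lemma is_cseries_unique (a : nat -> C) (l1 l2 : C) : is_cseries a l1 -> is_cseries a l2 -> l1 = l2.
Proof.
  rewrite !is_cseries_Re_Im. intros [A B] [A' B'].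
  apply is_series_unique in A, B, A', B'. apply C_ext; congruence.
Qed.

Lemma is_cseries_ext (a b : nat -> C) (l : C) : (forall n, a n = b n) -> is_cseries a l -> is_cseries b l.
Proof. apply is_series_ext. Qed.

Lemma is_cseries_plus (a b : nat -> C) (l m : C) :
  is_cseries a l -> is_cseries b m -> is_cseries (fun n => a n + b n)%C (l + m)%C.
Proof. apply (is_series_plus a b). Qed.

Lemma is_cseries_scal (c : C) (a : nat -> C) (l : C) :
  is_cseries a l -> is_cseries (fun n => c * a n)%C (c * l)%C.
Proof. apply (is_series_scal (c : C_AbsRing) a). Qed.

Lemma is_cseries_S (a : nat -> C) (l : C) :
  is_cseries a l -> is_cseries (fun n => a (S n)) (l - a O)%C.
Proof.
  intros H. apply (is_series_incr_1 a (l - a O)%C).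
  change (is_cseries a (l - a O + a O)%C). replace (l - a O + a O)%C with l by ring. exact H.
Qed.

Lemma is_cseries_S_rev (a : nat -> C) (l : C) :
  is_cseries (fun n => a (S n)) l -> is_cseries a (a O + l)%C.
Proof.
  intros H. apply (is_series_decr_1 a (a O + l)%C).
  change (is_cseries (fun n => a (S n)) (a O + l + - a O)%C).
  replace (a O + l + - a O)%C with l by ring. exact H.
Qed.

Definition Csum (a : nat -> C) : C := (Series (fun n => Re (a n)), Series (fun n => Im (a n))).

Lemma ex_series_le_R (a b : nat -> R) :
  (forall n, 0 <= a n <= b n) -> ex_series b -> ex_series a.
Proof.
  intros H Hb. apply (@ex_series_le R_AbsRing R_CompleteNormedModule a b); [|exact Hb].
  intros n. change (Rabs (a n) <= b n). rewrite Rabs_pos_eq; apply H.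
Qed.

Lemma Csum_correct (a : nat -> C) : ex_series (fun n => Cmod (a n)) -> is_cseries a (Csum a).
Proof.
  intros H. apply is_cseries_Re_Im; split; apply Series_correct;
    apply ex_series_Rabs; apply (ex_series_le_R _ (fun n => Cmod (a n)));
      try exact H; intros n; split; try apply Rabs_pos;
      [apply re_le_Cmod | apply Im_le_Cmod].
Qed.

Lemma Cmod_sum_n (a : nat -> C) n : Cmod (sum_n a n) <= sum_n (fun k => Cmod (a k)) n.
Proof.
  induction n; [rewrite !sum_O; apply Rle_refl|]. rewrite !sum_Sn.
  eapply Rle_trans; [apply Cmod_triangle|]. apply Rplus_le_compat_r, IHn.
Qed.

Lemma is_cseries_Cmod_le (a : nat -> C) (b : nat -> R) (l : C) (m : R) :
  is_cseries a l -> is_series b m -> (forall n, Cmod (a n) <= b n) -> Cmod l <= m.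
Proof.
  intros Ha Hb Hab. apply le_epsilon; intros eps He.
  rewrite is_cseries_eps in Ha. rewrite is_series_R_eps in Hb.
  destruct (Ha (eps / 2)) as [N1 K1]; [lra|]. destruct (Hb (eps / 2)) as [N2 K2]; [lra|].
  specialize (K1 (max N1 N2) ltac:(lia)). specialize (K2 (max N1 N2) ltac:(lia)).
  set (n := max N1 N2) in *.
  assert (S1 : Cmod (sum_n a n) <= sum_n b n).
  { eapply Rle_trans; [apply Cmod_sum_n|]. apply sum_n_m_le; intros; apply Hab. }
  rewrite Cmod_minus_sym in K1.
  pose proof (Cmod_triangle_rev l (sum_n a n)).
  apply Rabs_def2 in K2. lra.
Qed.

Lemma sum_n_le_is_series (a : nat -> R) l n :
  is_series a l -> (forall k, 0 <= a k) -> sum_n a n <= l.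
Proof.
  intros H Ha. apply (is_lim_seq_incr_compare (sum_n a) l); [exact H|].
  intros k. rewrite sum_Sn. unfold plus; simpl. specialize (Ha (S k)); lra.
Qed.

Lemma is_series_nonneg (a : nat -> R) l : is_series a l -> (forall k, 0 <= a k) -> 0 <= l.
Proof.
  intros H Ha. eapply Rle_trans; [|apply (sum_n_le_is_series a l 0 H Ha)].
  rewrite sum_O. apply Ha.
Qed.

Definition pser (r : R) (f : C -> C) (a : nat -> C) : Prop :=
  forall z, Cmod z < r -> is_cseries (fun n => a n * z ^ n)%C (f z).

(** Says that the radius of convergence is at least [r], in a form visibly stable under shifting and
    differentiating the coefficients. *)
Definition cbd (r : R) (a : nat -> C) : Prop :=
  forall rho, 0 <= rho < r -> exists B, forall n, Cmod (a n) * rho ^ n <= B.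

Definition PS (a : nat -> C) (z : C) : C := Csum (fun n => a n * z ^ n)%C.

Lemma is_series_bounded (a : nat -> R) : ex_series a -> exists B, forall n, Rabs (a n) <= B.
Proof.
  intros H. apply ex_series_lim_0 in H.
  destruct (filterlim_bounded (V := R_NormedModule) a) as [B HB].
  - exists 0. exact H.
  - exists B. exact HB.
Qed.

Lemma pser_cbd r f a : pser r f a -> cbd r a.
Proof.
  intros H rho Hr.
  assert (Hs := H rho). rewrite Cmod_R, Rabs_pos_eq in Hs by lra.
  specialize (Hs ltac:(lra)). rewrite is_cseries_Re_Im in Hs. destruct Hs as [H1 H2].
  destruct (is_series_bounded _ (ex_intro _ _ H1)) as [B1 K1].
  destruct (is_series_bounded _ (ex_intro _ _ H2)) as [B2 K2].
  exists (B1 + B2); intros n.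
  replace (Cmod (a n) * rho ^ n) with (Cmod (a n * rho ^ n)%C).
  - eapply Rle_trans; [apply Cmod_le_Re_Im|]. apply Rplus_le_compat; auto.
  - rewrite Cmod_mult, Cmod_pow, Cmod_R, Rabs_pos_eq by lra. reflexivity.
Qed.

(** The bound at the intermediate radius [s] makes the terms at [rho] decay like (rho/s)^n. *)
Lemma cbd_ex_series r a rho :
  cbd r a -> 0 <= rho < r -> ex_series (fun n => Cmod (a n) * rho ^ n).
Proof.
  intros H Hr. set (s := (rho + r) / 2).
  destruct (H s) as [B HB]; [unfold s; lra|].
  assert (Hs : rho < s /\ 0 < s) by (unfold s; lra).
  apply ex_series_le_R with (fun n => B * (rho / s) ^ n).
  - intros n; split; [apply Rmult_le_pos; [apply Cmod_ge_0 | apply pow_le; lra]|].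
    replace (Cmod (a n) * rho ^ n) with (Cmod (a n) * s ^ n * (rho / s) ^ n).
    + apply Rmult_le_compat_r; [apply pow_le, Rdiv_le_0_compat; lra | apply HB].
    + replace rho with (s * (rho / s)) at 2 by (field; lra). rewrite Rpow_mult_distr. ring.
  - apply (@ex_series_scal R_AbsRing R_NormedModule B), ex_series_geom.
    rewrite Rabs_pos_eq by (apply Rdiv_le_0_compat; lra).
    apply Rlt_div_l; lra.
Qed.

Lemma cbd_pser r a : cbd r a -> pser r (PS a) a.
Proof.
  intros H z Hz. apply Csum_correct.
  eapply ex_series_ext; [|apply (cbd_ex_series r a (Cmod z) H)].
  - intros n. simpl. now rewrite Cmod_mult, Cmod_pow.
  - split; [apply Cmod_ge_0 | exact Hz].
Qed.

Lemma pser_PS r f a z : pser r f a -> Cmod z < r -> PS a z = f z.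
Proof.
  intros H Hz. eapply is_cseries_unique; [|now apply H].
  apply (cbd_pser r); [|exact Hz]. eapply pser_cbd, H.
Qed.

(* Since [s^n <= s^k] for [k <= n], [(n+1) s^n] is at most the geometric sum. *)
Lemma lin_geom rho sig : 0 <= rho < sig ->
  exists K, 0 < K /\ forall n, INR (S n) * rho ^ n <= K * sig ^ n.
Proof.
  intros Hr. set (s := rho / sig).
  assert (Hs : 0 <= s < 1).
  { split; [apply Rdiv_le_0_compat; lra | apply Rlt_div_l; lra]. }
  exists (/ (1 - s)); split; [apply Rinv_0_lt_compat; lra|]. intros n.
  assert (H : INR (S n) * s ^ n <= / (1 - s)).
  { assert (H1 : INR (S n) * s ^ n <= sum_f_R0 (fun k => s ^ k) n).
    { rewrite Rmult_comm, <- (sum_cte (s ^ n) n).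
      apply sum_Rle. intros k Hk.
      replace n with (k + (n - k))%nat by lia. rewrite pow_add.
      rewrite <- (Rmult_1_r (s ^ k)) at 2. apply Rmult_le_compat_l; [apply pow_le; lra|].
      rewrite <- (pow1 (n - k)); apply pow_incr; lra. }
    eapply Rle_trans; [exact H1|]. rewrite tech3 by lra.
    unfold Rdiv. rewrite <- (Rmult_1_l (/ (1 - s))) at 2.
    apply Rmult_le_compat_r; [apply Rlt_le, Rinv_0_lt_compat; lra|].
    pose proof (pow_le s (S n) (proj1 Hs)). lra. }
  replace rho with (s * sig) by (unfold s; field; lra).
  rewrite Rpow_mult_distr, <- Rmult_assoc.
  apply Rmult_le_compat_r; [apply pow_le; lra | exact H].
Qed.

Lemma cbd_lin r a : cbd r a -> cbd r (fun n => INR (S n) * a n)%C.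
Proof.
  intros H rho Hr. destruct (H ((rho + r) / 2)) as [B HB]; [lra|].
  destruct (lin_geom rho ((rho + r) / 2)) as [K [HK HK']]; [lra|].
  exists (K * B); intros n. rewrite Cmod_mult, Cmod_R, Rabs_pos_eq by apply pos_INR.
  specialize (HB n); specialize (HK' n). pose proof (Cmod_ge_0 (a n)).
  pose proof (pow_le rho n (proj1 Hr)).
  replace (INR (S n) * Cmod (a n) * rho ^ n) with (Cmod (a n) * (INR (S n) * rho ^ n)) by ring.
  eapply Rle_trans; [apply Rmult_le_compat_l; [assumption | exact HK']|]. nra.
Qed.

Lemma cbd_shift r a : 0 < r -> cbd r a -> cbd r (fun n => a (S n)).
Proof.
  intros Hr0 H rho Hr. set (s := (rho + r) / 2).
  assert (Hs : rho <= s /\ 0 < s < r) by (unfold s; lra).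
  destruct (H s) as [B HB]; [lra|].
  exists (B / s); intros n. specialize (HB (S n)).
  apply (proj1 (Rle_div_r _ _ s (proj1 (proj2 Hs)))). eapply Rle_trans; [|exact HB].
  rewrite Rmult_assoc. apply Rmult_le_compat_l; [apply Cmod_ge_0|].
  simpl. rewrite (Rmult_comm s). apply Rmult_le_compat_r; [lra|]. apply pow_incr; lra.
Qed.

Definition dseq (a : nat -> C) (n : nat) : C := (INR (S n) * a (S n))%C.

Lemma cbd_dseq r a : 0 < r -> cbd r a -> cbd r (dseq a).
Proof.
  intros Hr H rho Hrho.
  destruct (cbd_lin r _ (cbd_shift r a Hr H) rho Hrho) as [B HB]. exists B. exact HB.
Qed.

Lemma Cmod_pow_diff_le (z w : C) rho n :
  Cmod z <= rho -> Cmod w <= rho ->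
  Cmod (w ^ S n - z ^ S n) <= INR (S n) * rho ^ n * Cmod (w - z).
Proof.
  intros Hz Hw. assert (Hr : 0 <= rho) by (pose proof (Cmod_ge_0 z); lra).
  set (h := Cmod (w - z)). assert (Hh : 0 <= h) by apply Cmod_ge_0.
  induction n as [|m IH].
  - simpl. replace (w * 1 - z * 1)%C with (w - z)%C by ring. fold h; lra.
  - replace (w ^ S (S m) - z ^ S (S m))%C
      with (w * (w ^ S m - z ^ S m) + (w - z) * z ^ S m)%C by (simpl; ring).
    eapply Rle_trans; [apply Cmod_triangle|]. rewrite !Cmod_mult, Cmod_pow. fold h.
    assert (Cmod z ^ S m <= rho ^ S m) by (apply pow_incr; split; [apply Cmod_ge_0 | lra]).
    assert (Cmod w * Cmod (w ^ S m - z ^ S m) <= rho * (INR (S m) * rho ^ m * h))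
      by (apply Rmult_le_compat; auto using Cmod_ge_0).
    rewrite (S_INR (S m)). simpl (rho ^ S m) in *. nra.
Qed.

(** The constant is twice the sharp one: it is the coefficient of the twice differentiated series,
    whose summability is already known. *)
Lemma pow_taylor_bound (z w : C) rho n :
  Cmod z <= rho -> Cmod w <= rho ->
  Cmod (w ^ (S (S n)) - z ^ (S (S n)) - INR (S (S n)) * z ^ (S n) * (w - z))
    <= INR (S n) * INR (S (S n)) * rho ^ n * Cmod (w - z) ^ 2.
Proof.
  intros Hz Hw. assert (Hr : 0 <= rho) by (pose proof (Cmod_ge_0 z); lra).
  set (h := Cmod (w - z)). assert (Hh : 0 <= h) by apply Cmod_ge_0.
  induction n as [|n IHn].
  - replace (w ^ 2 - z ^ 2 - INR 2 * z ^ 1 * (w - z))%C with ((w - z) * (w - z))%C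
      by (simpl; rewrite RtoC_plus; ring).
    rewrite Cmod_mult. fold h. simpl. nra.
  - replace (w ^ S (S (S n)) - z ^ S (S (S n)) - INR (S (S (S n))) * z ^ S (S n) * (w - z))%C
      with (z * (w ^ S (S n) - z ^ S (S n) - INR (S (S n)) * z ^ S n * (w - z))
            + (w ^ S (S n) - z ^ S (S n)) * (w - z))%C.
    2:{ rewrite (S_INR (S (S n))), RtoC_plus. simpl (z ^ _)%C. simpl (w ^ _)%C. ring. }
    eapply Rle_trans; [apply Cmod_triangle|]. rewrite !Cmod_mult. fold h.
    assert (D := Cmod_pow_diff_le z w rho (S n) Hz Hw). fold h in D.
    assert (E1 : Cmod z * Cmod (w ^ S (S n) - z ^ S (S n) - INR (S (S n)) * z ^ S n * (w - z))
        <= rho * (INR (S n) * INR (S (S n)) * rho ^ n * h ^ 2))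
      by (apply Rmult_le_compat; auto using Cmod_ge_0).
    assert (E2 : Cmod (w ^ S (S n) - z ^ S (S n)) * h <= INR (S (S n)) * rho ^ S n * h * h)
      by (apply Rmult_le_compat_r; auto).
    eapply Rle_trans; [apply Rplus_le_compat; [exact E1 | exact E2]|].
    rewrite !(S_INR (S (S n))), !(S_INR (S n)), (S_INR n).
    pose proof (pos_INR n) as P. set (x := INR n) in *. simpl pow.
    pose proof (pow_le rho n Hr).
    assert (0 <= rho * rho ^ n * (h * (h * 1))) as Q by (apply Rmult_le_pos; nra).
    set (q := rho * rho ^ n * (h * (h * 1))) in *.
    replace (rho * ((x + 1) * (x + 1 + 1) * rho ^ n * (h * (h * 1))))
      with ((x + 1) * (x + 1 + 1) * q) by (unfold q; ring).
    replace ((x + 1 + 1) * (rho * rho ^ n) * h * h) with ((x + 1 + 1) * q) by (unfold q; ring).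
    replace ((x + 1 + 1) * (x + 1 + 1 + 1) * (rho * rho ^ n) * (h * (h * 1)))
      with ((x + 1 + 1) * (x + 1 + 1 + 1) * q) by (unfold q; ring).
    nra.
Qed.

Lemma cder_PS r a z : 0 < r -> cbd r a -> Cmod z < r -> cder (PS a) z (PS (dseq a) z).
Proof.
  intros Hr H Hz. set (rho := (Cmod z + r) / 2).
  assert (Hz0 := Cmod_ge_0 z).
  assert (Hrho : Cmod z < rho /\ 0 <= rho < r) by (unfold rho; lra).
  assert (H2 : cbd r (dseq (fun n => INR (S n) * a (S n))%C)).
  { apply cbd_dseq; [exact Hr|]. apply (cbd_lin r (fun n => a (S n))), cbd_shift; auto. }
  assert (H3 := cbd_ex_series _ _ _ H2 (proj2 Hrho)).
  destruct H3 as [M HM].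
  intros eps He.
  assert (HM0 : 0 <= M).
  { apply (is_series_nonneg _ _ HM). intros n.
    apply Rmult_le_pos; [apply Cmod_ge_0 | apply pow_le; lra]. }
  exists (Rmin (rho - Cmod z) (eps / (M + 1))); split.
  { apply Rmin_pos; [lra | apply Rdiv_lt_0_compat; lra]. }
  intros w Hw. assert (Hw1 := Rlt_le_trans _ _ _ Hw (Rmin_l _ _)).
  assert (Hw2 := Rlt_le_trans _ _ _ Hw (Rmin_r _ _)).
  assert (Hwr : Cmod w <= rho).
  { pose proof (Cmod_triangle_rev w z). lra. }
  set (h := Cmod (w - z)) in *. assert (Hh : 0 <= h) by apply Cmod_ge_0.
  assert (B : Cmod (PS a w - PS a z - PS (dseq a) z * (w - z)) <= M * h ^ 2).
  { assert (Sw := cbd_pser r a H w ltac:(lra)). assert (Sz := cbd_pser r a H z Hz).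
    assert (Sd := cbd_pser r _ (cbd_dseq r a Hr H) z Hz).
    (* Degrees 0 and 1 contribute nothing to the remainder: two terms are dropped from the function
       and one from its derivative. *)
    apply is_cseries_S in Sw, Sz. apply is_cseries_S in Sw, Sz, Sd.
    assert (S1 := is_cseries_plus _ _ _ _ (is_cseries_plus _ _ _ _ Sw (is_cseries_scal (-1) _ _ Sz))
                   (is_cseries_scal (- (w - z)) _ _ Sd)).
    assert (HMM : is_series (fun n => Cmod (dseq (fun n => INR (S n) * a (S n))%C n) * rho ^ n * h ^ 2) (M * h ^ 2)).
    { apply (is_series_scal_r (h ^ 2) _ M HM). }
    match type of S1 with is_series _ ?l =>
      replace (PS a w - PS a z - PS (dseq a) z * (w - z))%C with l end.
    - eapply is_cseries_Cmod_le; [exact S1 | exact HMM |].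
      intros n. cbv beta.
      replace (a (S (S n)) * w ^ S (S n) + -1 * (a (S (S n)) * z ^ S (S n))
               + - (w - z) * (dseq a (S n) * z ^ S n))%C
        with (a (S (S n)) * (w ^ S (S n) - z ^ S (S n) - INR (S (S n)) * z ^ S n * (w - z)))%C
        by (unfold dseq; ring).
      rewrite Cmod_mult.
      eapply Rle_trans.
      { apply Rmult_le_compat_l; [apply Cmod_ge_0|]. apply pow_taylor_bound with (rho := rho); lra. }
      fold h. unfold dseq. rewrite !Cmod_mult, !Cmod_R, !Rabs_pos_eq by apply pos_INR.
      right; ring.
    - unfold dseq. simpl. ring. }
  eapply Rle_trans; [exact B|].
  assert (M * h <= eps).
  { assert (h * (M + 1) < eps) by (apply Rlt_div_r; [lra | exact Hw2]). nra. }
  nra.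
Qed.

Lemma pser_cder r f a z : pser r f a -> Cmod z < r -> cder f z (PS (dseq a) z).
Proof.
  intros H Hz.
  assert (Hr : 0 < r) by (pose proof (Cmod_ge_0 z); lra).
  apply (cder_ext_loc (PS a) f z _ (r - Cmod z)); [lra | |].
  - intros w Hw. apply (pser_PS r); [exact H|]. pose proof (Cmod_triangle_rev w z); lra.
  - apply (cder_PS r); auto. eapply pser_cbd, H.
Qed.

Lemma pser_dseq r f a : 0 < r -> pser r f a -> pser r (PS (dseq a)) (dseq a).
Proof. intros Hr H. apply cbd_pser, cbd_dseq; [exact Hr|]. eapply pser_cbd, H. Qed.

Lemma pser_shift r f a : 0 < r -> pser r f a -> pser r (PS (fun n => a (S n))) (fun n => a (S n)).
Proof. intros Hr H. apply cbd_pser, cbd_shift; [exact Hr|]. eapply pser_cbd, H. Qed.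

Lemma pser_0 r f a : 0 < r -> pser r f a -> f 0 = a O.
Proof.
  intros Hr H. eapply is_cseries_unique; [apply H; rewrite Cmod_0; exact Hr|].
  apply is_cseries_eps; intros eps He; exists O; intros n _.
  replace (sum_n (fun n => a n * 0 ^ n)%C n) with (a O).
  - replace (a O - a O)%C with (RtoC 0) by ring. now rewrite Cmod_0.
  - induction n; [rewrite sum_O; simpl; ring|]. rewrite sum_Sn, <- IHn.
    change (a O = a O + a (S n) * 0 ^ S n)%C. simpl; ring.
Qed.

Lemma pser_factor r f a z : pser r f a -> Cmod z < r ->
  f z = (a O + z * PS (fun n => a (S n)) z)%C.
Proof.
  intros H Hz. assert (Hr : 0 < r) by (pose proof (Cmod_ge_0 z); lra).
  eapply is_cseries_unique; [apply H; exact Hz|].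
  assert (Hs := is_cseries_scal z _ _ (pser_shift r f a Hr H z Hz)).
  assert (E : is_cseries (fun n => a n * z ^ n)%C (a O * z ^ O + z * PS (fun n => a (S n)) z)%C).
  { apply (is_cseries_S_rev (fun n => a n * z ^ n)%C).
    eapply is_cseries_ext; [|exact Hs]. intros n; simpl; ring. }
  replace (a O * z ^ 0)%C with (a O) in E by (simpl; ring). exact E.
Qed.

Lemma pser_ext r f g a : (forall z, Cmod z < r -> f z = g z) -> pser r f a -> pser r g a.
Proof. intros E H z Hz. rewrite <- E by exact Hz. now apply H. Qed.

Lemma pser_mult_z r f a : pser r f a ->
  pser r (fun z => z * f z)%C (fun n => match n with O => 0%C | S m => a m end).
Proof.
  intros H z Hz.
  replace (z * f z)%C with (0 * z ^ 0 + z * f z)%C by (simpl; ring).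
  apply (is_cseries_S_rev (fun n => (match n with O => 0 | S m => a m end) * z ^ n)%C).
  eapply is_cseries_ext; [|apply is_cseries_scal, H, Hz]. intros n; simpl; ring.
Qed.

Lemma pser_plus r f g a b : pser r f a -> pser r g b ->
  pser r (fun z => f z + g z)%C (fun n => a n + b n)%C.
Proof.
  intros Ha Hb z Hz. eapply is_cseries_ext; [|apply is_cseries_plus; [apply Ha|apply Hb]; exact Hz].
  intros n; simpl; ring.
Qed.

Lemma pser_scal r c f a : pser r f a -> pser r (fun z => c * f z)%C (fun n => c * a n)%C.
Proof.
  intros Ha z Hz. eapply is_cseries_ext; [|apply is_cseries_scal, Ha, Hz].
  intros n; simpl; ring.
Qed.

(** A vanishing series has zero constant term, and the series divided by z vanishes again, so
    induction applies to the shifted coefficients. *)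
Lemma pser_unique r f a b : 0 < r -> pser r f a -> pser r f b -> forall n, a n = b n.
Proof.
  intros Hr Ha Hb.
  assert (K : forall n (d : nat -> C), pser r (fun _ => 0%C) d -> d n = 0%C).
  { induction n; intros d Hd.
    - rewrite <- (pser_0 r _ d Hr Hd). reflexivity.
    - apply (IHn (fun k => d (S k))).
      apply pser_ext with (PS (fun k => d (S k))); [|now apply (pser_shift r (fun _ => 0%C))].
      assert (Hd0 : d O = 0%C) by (rewrite <- (pser_0 r _ d Hr Hd); reflexivity).
      assert (Hz : forall z, Cmod z < r -> z <> 0%C -> PS (fun k => d (S k)) z = 0%C).
      { intros z Hz Hz0. pose proof (pser_factor _ _ _ z Hd Hz) as E. rewrite Hd0 in E.
        apply (f_equal (fun x => x / z)%C) in E.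
        replace (0 / z)%C with (RtoC 0) in E by (field; auto). rewrite E; field; auto. }
      intros z Hzr. destruct (Ceq_dec z 0) as [->|Hz0]; [|auto].
      (* Division by z says nothing at 0; the value there is recovered by continuity from small
         positive reals. *)
      apply NNPP; intros Hn. apply Cmod_gt_0 in Hn.
      destruct (cder_ccont _ _ _ (pser_cder r _ _ 0 (pser_shift r _ d Hr Hd) Hzr) _ Hn) as [del [Hdel Hc]].
      set (x := Rmin (del / 2) (r / 2)).
      assert (Hx : 0 < x /\ x < del /\ x < r).
      { unfold x; pose proof (Rmin_l (del / 2) (r / 2)); pose proof (Rmin_r (del / 2) (r / 2)).
        split; [apply Rmin_pos; lra | lra]. }
      assert (Hxm : Cmod (x - 0) = x).
      { replace (RtoC x - 0)%C with (RtoC x) by ring. rewrite Cmod_R, Rabs_pos_eq; lra. }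
      specialize (Hc (RtoC x)). rewrite Hxm, Hz in Hc.
      + replace (0 - PS (fun n0 => d (S n0)) 0)%C with (- PS (fun n0 => d (S n0)) 0)%C in Hc by ring.
        rewrite Cmod_opp in Hc. specialize (Hc ltac:(lra)). lra.
      + rewrite Cmod_R, Rabs_pos_eq; lra.
      + intros E; apply RtoC_inj in E; lra. }
  intros n. assert (E : (a n + (-1) * b n)%C = 0%C).
  { apply (K n (fun n => a n + (-1) * b n)%C).
    eapply pser_ext; [|apply pser_plus; [exact Ha | apply pser_scal, Hb]].
    intros; simpl; ring. }
  replace (a n) with (a n + (-1) * b n + b n)%C by ring. rewrite E; ring.
Qed.

Lemma pser_const r c : pser r (fun _ => c) (fun n => match n with O => c | S _ => 0%C end).
Proof.
  intros z _. apply is_cseries_eps; intros eps He; exists O; intros n _.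
  assert (E : forall n, sum_n (fun n => (match n with O => c | S _ => 0%C end) * z ^ n)%C n = c).
  { clear n. induction n as [|n IH]; [rewrite sum_O; simpl; ring|]. rewrite sum_Sn, IH.
    change (c + 0 * z ^ S n = c)%C. ring. }
  rewrite E. replace (c - c)%C with (RtoC 0) by ring. now rewrite Cmod_0.
Qed.

(** * Means over a circle *)

(* A curve is tested for continuity as a function of the real part of a complex
   variable, and a two-parameter family as a function of both parts, so that the
   rules for [ccont] apply to them. *)
Definition rcont (g : R -> C) : Prop := forall t, ccont (fun p => g (Re p)) (RtoC t).

Lemma ccont_Re z : ccont (fun p => RtoC (Re p)) z.
Proof.
  intros eps He; exists eps; split; [exact He|]. intros w Hw.
  eapply Rle_lt_trans; [|exact Hw]. rewrite <- RtoC_minus, Cmod_R.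
  replace (Re w - Re z) with (Re (w - z)) by (unfold Re; simpl; ring). apply re_le_Cmod.
Qed.

Lemma ccont_Im z : ccont (fun p => RtoC (Im p)) z.
Proof.
  intros eps He; exists eps; split; [exact He|]. intros w Hw.
  eapply Rle_lt_trans; [|exact Hw]. rewrite <- RtoC_minus, Cmod_R.
  replace (Im w - Im z) with (Im (w - z)) by (unfold Im; simpl; ring). apply Im_le_Cmod.
Qed.

Lemma ccont_rder_Im g p v : rder g (Im p) v -> ccont (fun q => g (Im q)) p.
Proof.
  intros H eps He. rewrite rder_eps in H. destruct (H 1) as [d [Hd K]]; [lra|].
  pose proof (Cmod_ge_0 v).
  exists (Rmin d (eps / (2 + Cmod v))); split.
  { apply Rmin_pos; [lra|]. apply Rdiv_lt_0_compat; lra. }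
  intros w Hb.
  assert (Hi : Rabs (Im w - Im p) <= Cmod (w - p)).
  { replace (Im w - Im p) with (Im (w - p)) by (unfold Im; simpl; ring). apply Im_le_Cmod. }
  assert (H1 := Rlt_le_trans _ _ _ Hb (Rmin_l _ _)).
  assert (H2 := Rlt_le_trans _ _ _ Hb (Rmin_r _ _)).
  specialize (K (Im w) ltac:(lra)).
  replace (g (Im w) - g (Im p))%C
    with (g (Im w) - g (Im p) - v * RtoC (Im w - Im p) + v * RtoC (Im w - Im p))%C by ring.
  eapply Rle_lt_trans; [apply Cmod_triangle|]. rewrite Cmod_mult, Cmod_R.
  apply Rlt_div_r in H2; [|lra]. pose proof (Rabs_pos (Im w - Im p)). nra.
Qed.

Lemma ccont_along g t v : rder g t v -> ccont (fun p => g (Re p)) (RtoC t).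
Proof.
  intros H.
  (* Multiplication by i moves the real part to the imaginary part, so the preceding lemma
     applies. *)
  apply (ccont_ext_loc (fun p => g (Im (Ci * p))) _ _ 1); [lra | |].
  - intros w _. f_equal. unfold Im, Re; simpl; ring.
  - apply (ccont_comp (fun q => g (Im q)) (fun p => Ci * p)%C).
    + apply ccont_rder_Im with v. replace (Im (Ci * t)) with t; [exact H|].
      unfold Im; simpl; ring.
    + apply ccont_mult; [apply ccont_const | apply ccont_id].
Qed.

Lemma ccont_continuous_Re g t : ccont (fun p => g (Re p)) (RtoC t) -> continuous (fun u => Re (g u)) t.
Proof.
  intros H. apply filterlim_locally. intros [eps He].
  destruct (H eps He) as [d [Hd K]]. exists (mkposreal _ Hd). intros y Hy.
  specialize (K (RtoC y)). rewrite <- RtoC_minus, Cmod_R in K. specialize (K Hy).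
  change (Rabs (Re (g y) - Re (g t)) < eps). eapply Rle_lt_trans; [|exact K].
  replace (Re (g y) - Re (g t)) with (Re (g y - g t)) by (unfold Re; simpl; ring).
  apply re_le_Cmod.
Qed.

Lemma Re_mult_Copp_Ci z : Re (- Ci * z) = Im z.
Proof. unfold Re, Im; simpl; ring. Qed.

Lemma rcont_mult g h : rcont g -> rcont h -> rcont (fun t => g t * h t)%C.
Proof. intros Hg Hh t; apply (ccont_mult (fun p => g (Re p)) (fun p => h (Re p))); auto. Qed.
Lemma rcont_plus g h : rcont g -> rcont h -> rcont (fun t => g t + h t)%C.
Proof. intros Hg Hh t; apply (ccont_plus (fun p => g (Re p)) (fun p => h (Re p))); auto. Qed.
Lemma rcont_const c : rcont (fun _ => c).
Proof. intros t; apply ccont_const. Qed.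
Lemma rcont_comp F g : rcont g -> (forall t, ccont F (g t)) -> rcont (fun t => F (g t)).
Proof. intros Hg HF t; apply (ccont_comp F (fun p => g (Re p))); auto. Qed.
Lemma rcont_pow g n : rcont g -> rcont (fun t => g t ^ n)%C.
Proof.
  intros Hg; induction n; [exact (rcont_const 1)|]. apply (rcont_mult g _ Hg IHn).
Qed.

Definition mean (g : R -> C) : C :=
  (RInt (fun t => Re (g t)) 0 (2 * PI) / (2 * PI), RInt (fun t => Im (g t)) 0 (2 * PI) / (2 * PI)).

Definition meanR (g : R -> R) : R := RInt g 0 (2 * PI) / (2 * PI).

Lemma two_PI_pos : 0 < 2 * PI.
Proof. pose proof PI_RGT_0; lra. Qed.

Lemma rcont_continuous_Re g : rcont g -> forall t, continuous (fun u => Re (g u)) t.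
Proof. intros H t. apply ccont_continuous_Re, H. Qed.

Lemma rcont_continuous_Im g : rcont g -> forall t, continuous (fun u => Im (g u)) t.
Proof.
  intros H t. apply continuous_ext with (fun u => Re (- Ci * g u)).
  - intros; apply Re_mult_Copp_Ci.
  - apply (rcont_continuous_Re (fun u => - Ci * g u)%C). apply rcont_mult; [apply rcont_const | exact H].
Qed.

Lemma rcont_continuous_Cmod2 g : rcont g -> forall t, continuous (fun u => Cmod (g u) ^ 2) t.
Proof.
  intros H t. apply continuous_ext with (fun u => Re (g u) * Re (g u) + Im (g u) * Im (g u)).
  - intros u. rewrite Cmod2_alt. change (Re (g u) * Re (g u) + Im (g u) * Im (g u) = Re (g u) ^ 2 + Im (g u) ^ 2). ring.
  - pose proof (rcont_continuous_Re g H t) as H1. pose proof (rcont_continuous_Im g H t) as H2.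
    apply (continuous_plus (fun u => Re (g u) * Re (g u)) (fun u => Im (g u) * Im (g u)));
      [exact (continuous_mult _ _ t H1 H1) | exact (continuous_mult _ _ t H2 H2)].
Qed.

Lemma ex_RInt_cont (g : R -> R) a b : (forall t, continuous g t) -> ex_RInt g a b.
Proof. intros H. apply (ex_RInt_continuous (V := R_CompleteNormedModule)). intros; apply H. Qed.

Lemma meanR_plus (g h : R -> R) : (forall t, continuous g t) -> (forall t, continuous h t) ->
  meanR (fun t => g t + h t) = meanR g + meanR h.
Proof.
  intros Hg Hh. unfold meanR.
  rewrite (RInt_plus (V := R_CompleteNormedModule) g h) by (now apply ex_RInt_cont).
  unfold plus; simpl. field. pose proof two_PI_pos; lra.
Qed.

Lemma meanR_scal c (g : R -> R) : (forall t, continuous g t) -> meanR (fun t => c * g t) = c * meanR g.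
Proof.
  intros Hg. unfold meanR.
  rewrite (RInt_scal (V := R_CompleteNormedModule) g) by (now apply ex_RInt_cont).
  unfold scal; simpl; unfold mult; simpl. field. pose proof two_PI_pos; lra.
Qed.

Lemma meanR_const c : meanR (fun _ => c) = c.
Proof.
  unfold meanR. rewrite RInt_const. unfold scal; simpl; unfold mult; simpl.
  field. pose proof two_PI_pos; lra.
Qed.

Lemma meanR_le (g h : R -> R) : (forall t, continuous g t) -> (forall t, continuous h t) ->
  (forall t, 0 <= t <= 2 * PI -> g t <= h t) -> meanR g <= meanR h.
Proof.
  intros Hg Hh H. unfold meanR, Rdiv. pose proof two_PI_pos.
  apply Rmult_le_compat_r; [apply Rlt_le, Rinv_0_lt_compat; lra|].
  apply RInt_le; [lra | now apply ex_RInt_cont | now apply ex_RInt_cont | intros; apply H; lra].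
Qed.

Lemma Re_mean g : Re (mean g) = meanR (fun t => Re (g t)). Proof. reflexivity. Qed.
Lemma Im_mean g : Im (mean g) = meanR (fun t => Im (g t)). Proof. reflexivity. Qed.

Lemma meanR_ext g h : (forall t, g t = h t) -> meanR g = meanR h.
Proof. intros H. unfold meanR. f_equal. apply RInt_ext. intros; apply H. Qed.

Lemma mean_ext g h : (forall t, g t = h t) -> mean g = mean h.
Proof.
  intros H. apply C_ext; rewrite ?Re_mean, ?Im_mean; apply meanR_ext; intros; now rewrite H.
Qed.

Lemma mean_const c : mean (fun _ => c) = c.
Proof. apply C_ext; rewrite ?Re_mean, ?Im_mean; apply meanR_const. Qed.

Lemma mean_plus g h : rcont g -> rcont h -> mean (fun t => g t + h t)%C = (mean g + mean h)%C.
Proof.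
  intros Hg Hh. apply C_ext.
  - change (Re (mean g + mean h)) with (Re (mean g) + Re (mean h)). rewrite !Re_mean.
    apply (meanR_plus (fun t => Re (g t)) (fun t => Re (h t)));
      now apply rcont_continuous_Re.
  - change (Im (mean g + mean h)) with (Im (mean g) + Im (mean h)). rewrite !Im_mean.
    apply (meanR_plus (fun t => Im (g t)) (fun t => Im (h t)));
      now apply rcont_continuous_Im.
Qed.

Lemma Re_Cmult z w : Re (z * w) = Re z * Re w + - Im z * Im w.
Proof. unfold Re, Im; simpl; ring. Qed.
Lemma Im_Cmult z w : Im (z * w) = Re z * Im w + Im z * Re w.
Proof. unfold Re, Im; simpl; ring. Qed.

Lemma continuous_scal_R c (g : R -> R) : (forall t, continuous g t) -> forall t, continuous (fun t => c * g t) t.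
Proof. intros H t. apply (continuous_scal_r c g); apply H. Qed.

Lemma mean_scal c g : rcont g -> mean (fun t => c * g t)%C = (c * mean g)%C.
Proof.
  intros Hg. pose proof (rcont_continuous_Re g Hg) as HR. pose proof (rcont_continuous_Im g Hg) as HI.
  apply C_ext.
  - rewrite Re_Cmult, !Re_mean, Im_mean, <- !meanR_scal, <- meanR_plus by auto using continuous_scal_R.
    apply meanR_ext; intros; apply Re_Cmult.
  - rewrite Im_Cmult, !Im_mean, Re_mean, <- !meanR_scal, <- meanR_plus by auto using continuous_scal_R.
    apply meanR_ext; intros; apply Im_Cmult.
Qed.

Lemma mean_bound g B : rcont g -> (forall t, 0 <= t <= 2 * PI -> Cmod (g t) <= B) -> Cmod (mean g) <= B.
Proof.
  intros Hg HB. apply Cmod_le_of_Re. intros e He.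
  rewrite <- mean_scal by exact Hg. rewrite Re_mean, <- (meanR_const B).
  apply meanR_le.
  - apply (rcont_continuous_Re (fun t => e * g t)%C), rcont_mult; [apply rcont_const | exact Hg].
  - intros; apply continuous_const.
  - intros t Ht. eapply Rle_trans; [apply Re_le_Cmod'|].
    rewrite Cmod_mult, He, Rmult_1_l. now apply HB.
Qed.

(** The only way in which a mean is shown to vanish: it gives both the orthogonality of monomials
    and Cauchy's formula. *)
Lemma mean_periodic_derivative G g : rcont g -> (forall t, rder G t (g t)) -> G (2 * PI) = G 0 ->
  mean g = 0%C.
Proof.
  intros Hg HG HP. apply C_ext; rewrite ?Re_mean, ?Im_mean; unfold meanR.
  - replace (RInt _ _ _) with (Re (G (2 * PI)) - Re (G 0)).
    + rewrite HP. change (Re 0) with 0. unfold Rdiv; ring.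
    + symmetry. apply is_RInt_unique.
      apply (is_RInt_derive (fun t => Re (G t)) (fun t => Re (g t))).
      * intros t _. apply HG.
      * intros t _. now apply rcont_continuous_Re.
  - replace (RInt _ _ _) with (Im (G (2 * PI)) - Im (G 0)).
    + rewrite HP. change (Im 0) with 0. unfold Rdiv; ring.
    + symmetry. apply is_RInt_unique.
      apply (is_RInt_derive (fun t => Im (G t)) (fun t => Im (g t))).
      * intros t _. apply HG.
      * intros t _. now apply rcont_continuous_Im.
Qed.

Lemma ccont_continuity_2d_Re (g : R -> R -> C) x y :
  ccont (fun p => g (Re p) (Im p)) (x, y) -> continuity_2d_pt (fun u v => Re (g u v)) x y.
Proof.
  intros H [eps He]. destruct (H eps He) as [d [Hd K]].
  assert (Hd2 : 0 < d / 2) by lra. exists (mkposreal _ Hd2). simpl. intros u v Hu Hv.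
  specialize (K (u, v)). simpl in K.
  eapply Rle_lt_trans; [|apply K].
  - change (Re (g u v) - Re (g x y)) with (Re (g u v) + - Re (g x y)).
    replace (Re (g u v) + - Re (g x y)) with (Re (g u v - g x y)) by (unfold Re; simpl; ring).
    apply re_le_Cmod.
  - eapply Rle_lt_trans; [apply Cmod_le_Re_Im|]. unfold Re, Im; simpl.
    unfold Rminus in *. lra.
Qed.

Lemma rder_mean_param (g g' : R -> R -> C) a b t :
  a < t < b ->
  (forall u v, a < u < b -> rder (fun u => g u v) u (g' u v)) ->
  (forall u, a < u < b -> rcont (g u)) ->
  (forall u v, a < u < b -> ccont (fun p => g' (Re p) (Im p)) (u, v)) ->
  rder (fun u => mean (g u)) t (mean (g' t)).
Proof.
  intros Ht Hd Hc Hc'.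
  (* Differentiation under the integral is available for real integrands; [e = 1] and [e = - Ci]
     give the two components. *)
  assert (Key : forall e : C,
    is_derive (fun u => meanR (fun v => Re (e * g u v))) t (meanR (fun v => Re (e * g' t v)))).
  { intros e. unfold meanR.
    assert (Hloc : forall u, a < u < b -> locally u (fun x => a < x < b)).
    { intros u Hu. apply (open_and _ _ (open_gt a) (open_lt b)). exact Hu. }
    assert (HD : forall u v, a < u < b -> Derive (fun z => Re (e * g z v)) u = Re (e * g' u v)).
    { intros u v Hu. apply is_derive_unique. apply is_derive_Re_mult. now apply Hd. }
    apply is_derive_ext with (fun u => scal (/ (2 * PI)) (RInt (fun v => Re (e * g u v)) 0 (2 * PI))).
    { intros u. unfold scal; simpl; unfold mult; simpl. unfold Rdiv; ring. }
    replace (RInt (fun v => Re (e * g' t v)) 0 (2 * PI) / (2 * PI))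
      with (scal (/ (2 * PI)) (RInt (fun v => Derive (fun z => Re (e * g z v)) t) 0 (2 * PI))).
    2:{ unfold scal; simpl; unfold mult; simpl. unfold Rdiv. rewrite Rmult_comm. f_equal.
        apply RInt_ext. intros v _. now apply HD. }
    apply (is_derive_scal (fun u => RInt (fun v => Re (e * g u v)) 0 (2 * PI))).
    apply (is_derive_RInt_param (fun u v => Re (e * g u v))).
    - apply (filter_imp (fun x => a < x < b)); [|now apply Hloc].
      intros u Hu v _. eexists. apply is_derive_Re_mult. now apply Hd.
    - intros v _. apply continuity_2d_pt_ext_loc with (fun u v => Re (e * g' u v)).
      + destruct (Hloc t Ht) as [d K]. exists d. intros u w Hu _. symmetry. apply HD, K, Hu.
      + apply (ccont_continuity_2d_Re (fun u v => e * g' u v)%C).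
        apply (ccont_mult (fun _ => e) (fun p => g' (Re p) (Im p))); [apply ccont_const | auto].
    - apply (filter_imp (fun x => a < x < b)); [|now apply Hloc].
      intros u Hu. apply ex_RInt_cont. apply (rcont_continuous_Re (fun v => e * g u v)%C).
      apply rcont_mult; [apply rcont_const | auto]. }
  split.
  - apply is_derive_ext with (fun u => meanR (fun v => Re (1 * g u v))).
    + intros u; rewrite Re_mean; apply meanR_ext; intros v; now rewrite Cmult_1_l.
    + replace (Re (mean (g' t))) with (meanR (fun v => Re (1 * g' t v))); [apply Key|].
      rewrite Re_mean; apply meanR_ext; intros v; now rewrite Cmult_1_l.
  - apply is_derive_ext with (fun u => meanR (fun v => Re (- Ci * g u v))).
    + intros u; rewrite Im_mean; apply meanR_ext; intros v; apply Re_mult_Copp_Ci.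
    + replace (Im (mean (g' t))) with (meanR (fun v => Re (- Ci * g' t v))); [apply Key|].
      rewrite Im_mean; apply meanR_ext; intros v; apply Re_mult_Copp_Ci.
Qed.

(** * Cauchy's formula and the maximum principle *)

Definition circ (rho t : R) : C := (rho * cos t, rho * sin t).

Lemma rder_circ rho t : rder (circ rho) t (Ci * circ rho t).
Proof.
  split; unfold circ, Re, Im; simpl; auto_derive; trivial; ring.
Qed.

Lemma Cmod_circ rho t : 0 <= rho -> Cmod (circ rho t) = rho.
Proof.
  intros H. unfold circ, Cmod; simpl fst; simpl snd.
  replace ((rho * cos t) ^ 2 + (rho * sin t) ^ 2) with (Rsqr rho).
  - now apply sqrt_Rsqr.
  - pose proof (sin2_cos2 t) as T. unfold Rsqr in *. nra.
Qed.

Lemma circ_neq_0 rho t : 0 < rho -> circ rho t <> 0%C.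
Proof. intros H. apply Cmod_gt_0. rewrite Cmod_circ; lra. Qed.

Lemma circ_2PI rho : circ rho (2 * PI) = circ rho 0.
Proof. unfold circ. now rewrite cos_2PI, sin_2PI, cos_0, sin_0. Qed.

Lemma Cconj_circ rho t : 0 < rho -> Cconj (circ rho t) = (RtoC (rho ^ 2) / circ rho t)%C.
Proof.
  intros H. pose proof (circ_neq_0 rho t H) as Hn.
  replace (RtoC (rho ^ 2)) with (circ rho t * Cconj (circ rho t))%C.
  - field; exact Hn.
  - rewrite <- Cmod2_conj, Cmod_circ by lra. reflexivity.
Qed.

Lemma rcont_circ rho : rcont (circ rho).
Proof. intros t. eapply ccont_along, rder_circ. Qed.

Lemma rcont_circ_inv rho : 0 < rho -> rcont (fun t => / circ rho t)%C.
Proof.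
  intros H. apply (rcont_comp Cinv (circ rho)); [apply rcont_circ|].
  intros t. apply ccont_inv. now apply circ_neq_0.
Qed.

Lemma mean_circ_monomial rho j k : 0 < rho ->
  mean (fun t => circ rho t ^ j * (/ circ rho t) ^ k)%C = if Nat.eq_dec j k then 1%C else 0%C.
Proof.
  intros Hr. destruct (Nat.eq_dec j k) as [<-|Hjk].
  - transitivity (mean (fun _ => 1%C)); [|apply mean_const]. apply mean_ext. intros t.
    rewrite Cpow_inv by now apply circ_neq_0. apply Cinv_r, Cpow_nz. now apply circ_neq_0.
  (* Along the circle the monomial w^j w^(-k) has angular derivative [c] times itself, so dividing
     it by [c] yields a periodic primitive. *)
  - set (c := (Ci * (INR j - INR k))%C).
    assert (Hc : c <> 0%C).
    { apply Cmult_neq_0.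
      - apply Cmod_gt_0. rewrite Cmod_Ci; lra.
      - rewrite <- RtoC_minus. intros E; apply RtoC_inj in E. apply Hjk, INR_eq. lra. }
    assert (Hm : rcont (fun t => circ rho t ^ j * (/ circ rho t) ^ k)%C).
    { apply rcont_mult; apply rcont_pow; [apply rcont_circ | now apply rcont_circ_inv]. }
    apply (mean_periodic_derivative (fun t => / c * (circ rho t ^ j * (/ circ rho t) ^ k))%C); [exact Hm| |].
    + intros t. pose proof (circ_neq_0 rho t Hr) as Hn. set (z := circ rho t) in *.
      assert (D : cder (fun w => / c * (w ^ j * (/ w) ^ k))%C z
                  (/ c * (INR j * z ^ pred j * (/ z) ^ k + z ^ j * (INR k * (/ z) ^ pred k * (- / (z * z)))))).
      { apply cder_scal, cder_mult; [apply cder_pow|].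
        apply (cder_comp (fun w => w ^ k)%C Cinv); [apply cder_pow | now apply cder_inv]. }
      pose proof (rder_comp _ _ _ _ _ D (rder_circ rho t)) as R.
      replace (z ^ j * (/ z) ^ k)%C with
        (/ c * (INR j * z ^ pred j * (/ z) ^ k + z ^ j * (INR k * (/ z) ^ pred k * - / (z * z))) *
         (Ci * z))%C; [exact R|].
      assert (Ej : (INR j * z ^ pred j * z = INR j * z ^ j)%C) by (destruct j; simpl; ring).
      assert (Ek : (INR k * (/ z) ^ pred k * / z = INR k * (/ z) ^ k)%C) by (destruct k; simpl; ring).
      transitivity (/ c * (Ci * ((INR j * z ^ pred j * z) * (/ z) ^ k
                     - z ^ j * (INR k * (/ z) ^ pred k * / z))))%C; [field; auto|].
      rewrite Ej, Ek. unfold c. field.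
      split; [|apply Cmod_gt_0; rewrite Cmod_Ci; lra].
      rewrite <- RtoC_minus. intros E; apply RtoC_inj in E. apply Hjk, INR_eq. lra.
    + now rewrite circ_2PI.
Qed.

Lemma rcont_bounded h : rcont h -> exists B, forall t, 0 <= t <= 2 * PI -> Cmod (h t) <= B.
Proof.
  intros Hh. pose proof two_PI_pos as HP.
  destruct (continuity_ab_maj (fun t => Cmod (h t) ^ 2) 0 (2 * PI)) as [x [Hx _]]; [lra| |].
  - intros c _. apply continuity_pt_filterlim. now apply (rcont_continuous_Cmod2 h Hh c).
  - exists (Cmod (h x)). intros t Ht. specialize (Hx t Ht). simpl in Hx.
    pose proof (Cmod_ge_0 (h t)); pose proof (Cmod_ge_0 (h x)). nra.
Qed.

Lemma Cmod_pow_lim q K eps : 0 <= q < 1 -> 0 < eps ->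
  exists N, forall n, (N <= n)%nat -> K * q ^ n < eps.
Proof.
  intros Hq He. set (K' := Rabs K + 1). assert (HK : 0 < K') by (unfold K'; pose proof (Rabs_pos K); lra).
  destruct (pow_lt_1_zero q) with (y := eps / K') as [N HN].
  - rewrite Rabs_pos_eq; lra.
  - now apply Rdiv_lt_0_compat.
  - exists N; intros n Hn. specialize (HN n Hn).
    pose proof (pow_le q n (proj1 Hq)). rewrite Rabs_pos_eq in HN by assumption.
    apply Rlt_div_r in HN; [|lra].
    assert (K <= K') by (unfold K'; pose proof (Rle_abs K); lra). nra.
Qed.

(** No series is integrated termwise. If [R k] is the mean of h w^(-k) against the kernel, then w/(w
    - z) = 1 + z/(w - z) gives R k = c k + z R (k+1). Iterating leaves a remainder of order
    (|z|/rho)^n. Only continuity of [h] enters. *)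
Lemma Cauchy_kernel_series h rho z : rcont h -> Cmod z < rho ->
  is_cseries (fun k => mean (fun t => h t * (/ circ rho t) ^ k) * z ^ k)%C
    (mean (fun t => h t * (circ rho t * / (circ rho t - z)))%C).
Proof.
  intros Hh Hz. pose proof (Cmod_ge_0 z) as Hz0.
  assert (Hr : 0 < rho) by lra.
  assert (Hn : forall t, (circ rho t - z)%C <> 0%C).
  { intros t E. pose proof (Cmod_triangle_rev (circ rho t) z) as T. rewrite Cmod_circ in T by lra.
    rewrite E, Cmod_0 in T. lra. }
  assert (HK : rcont (fun t => / (circ rho t - z))%C).
  { apply (rcont_comp (fun w => / (w - z))%C); [apply rcont_circ|]. intros t.
    apply (ccont_comp Cinv (fun w => w - z)%C); [now apply ccont_inv|].
    apply ccont_plus; [apply ccont_id | apply ccont_const]. }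
  assert (Hi : forall k, rcont (fun t => (/ circ rho t) ^ k)%C).
  { intros k. now apply rcont_pow, rcont_circ_inv. }
  assert (Hm : forall k, rcont (fun t => h t * (/ circ rho t) ^ k * (circ rho t * / (circ rho t - z)))%C).
  { intros k. apply rcont_mult; [now apply rcont_mult | apply rcont_mult; [apply rcont_circ | exact HK]]. }
  set (c := fun k => mean (fun t => h t * (/ circ rho t) ^ k)%C).
  set (M := mean (fun t => h t * (circ rho t * / (circ rho t - z)))%C).
  set (R := fun k => mean (fun t => h t * (/ circ rho t) ^ k * (circ rho t * / (circ rho t - z)))%C).
  assert (Step : forall k, R k = (c k + z * R (S k))%C).
  { intros k. unfold R, c. rewrite <- mean_scal by apply Hm. rewrite <- mean_plus.
    - apply mean_ext. intros t. pose proof (circ_neq_0 rho t Hr). pose proof (Hn t). simpl. field; auto.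
    - now apply rcont_mult.
    - apply rcont_mult; [apply rcont_const | apply Hm]. }
  assert (S : forall n, (sum_n (fun k => c k * z ^ k)%C n = M - z ^ (S n) * R (S n))%C).
  { assert (R0 : R O = M) by (apply mean_ext; intros t; simpl; ring).
    induction n.
    - rewrite sum_O, <- R0, Step. simpl; ring.
    - rewrite sum_Sn, IHn. change ((M - z ^ S n * R (S n) + c (S n) * z ^ (S n))%C = (M - z ^ S (S n) * R (S (S n)))%C).
      rewrite (Step (S n)). simpl; ring. }
  destruct (rcont_bounded h Hh) as [B HB].
  apply is_cseries_eps. intros eps He.
  destruct (Cmod_pow_lim (Cmod z / rho) (B * (rho / (rho - Cmod z))) eps) as [N HN]; [|exact He|].
  { split; [apply Rdiv_le_0_compat; lra | apply Rlt_div_l; lra]. }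
  exists N; intros n Hn'. change (Cmod (sum_n (fun k => c k * z ^ k)%C n - M) < eps). rewrite S.
  replace (M - z ^ Datatypes.S n * R (Datatypes.S n) - M)%C
    with (- (z ^ Datatypes.S n * R (Datatypes.S n)))%C by ring.
  rewrite Cmod_opp, Cmod_mult, Cmod_pow. eapply Rle_lt_trans; [|apply (HN (Datatypes.S n)); lia].
  assert (HR : Cmod (R (Datatypes.S n)) <= B * (/ rho) ^ Datatypes.S n * (rho / (rho - Cmod z))).
  { apply mean_bound; [apply Hm|]. intros t Ht.
    rewrite !Cmod_mult, Cmod_pow, !Cmod_inv, Cmod_circ by (auto using circ_neq_0; lra).
    assert (T : rho - Cmod z <= Cmod (circ rho t - z)).
    { pose proof (Cmod_triangle_rev (circ rho t) z) as T. rewrite Cmod_circ in T by lra. exact T. }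
    assert (0 <= (/ rho) ^ Datatypes.S n) by (apply pow_le, Rlt_le, Rinv_0_lt_compat; lra).
    apply Rmult_le_compat.
    - apply Rmult_le_pos; [apply Cmod_ge_0 | assumption].
    - apply Rmult_le_pos; [lra | apply Rlt_le, Rinv_0_lt_compat; lra].
    - apply Rmult_le_compat_r; auto.
    - apply Rmult_le_compat_l; [lra|]. apply Rinv_le_contravar; lra. }
  eapply Rle_trans; [apply Rmult_le_compat_l; [apply pow_le; lra | exact HR]|].
  right. unfold Rdiv at 3. rewrite Rpow_mult_distr. ring.
Qed.

(** The derivative is required to be continuous because Cauchy's formula is proved by
    differentiating under the integral; this avoids Goursat's theorem. *)
Definition hol (r : R) (f f' : C -> C) : Prop :=
  forall z, Cmod z < r -> cder f z (f' z) /\ ccont f' z.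

Lemma mean_Cauchy_kernel rho z : Cmod z < rho ->
  mean (fun t => 1 * (circ rho t * / (circ rho t - z)))%C = 1%C.
Proof.
  intros Hz. pose proof (Cmod_ge_0 z) as Hz0.
  pose proof (Cauchy_kernel_series (fun _ => 1%C) rho z (rcont_const 1) Hz) as H.
  eapply is_cseries_unique; [exact H|].
  assert (E : forall k, mean (fun t => 1 * (/ circ rho t) ^ k)%C = if Nat.eq_dec 0 k then 1%C else 0%C).
  { intros k. rewrite <- mean_circ_monomial with (rho := rho) by lra.
    apply mean_ext; intros t; simpl; ring. }
  eapply is_cseries_ext; [|apply (pser_const (Cmod z + 1) 1%C z); lra].
  intros k. cbv beta. rewrite E. now destruct k.
Qed.

(* The mean over the circle of [f(z + u(w - z)) w/(w - z)] does not depend on [u]: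
   its [u]-derivative is the mean of a total derivative in the angle. *)
Lemma Cauchy_formula r f f' rho z : hol r f f' -> rho < r -> Cmod z < rho ->
  mean (fun t => f (circ rho t) * (circ rho t * / (circ rho t - z)))%C = f z.
Proof.
  intros Hf Hrr Hz. pose proof (Cmod_ge_0 z) as Hz0. assert (Hr : 0 < rho) by lra.
  assert (Hn : forall t, (circ rho t - z)%C <> 0%C).
  { intros t E. pose proof (Cmod_triangle_rev (circ rho t) z) as T. rewrite Cmod_circ in T by lra.
    rewrite E, Cmod_0 in T. lra. }
  set (w := circ rho) in *.
  (* The parameter runs slightly beyond [0, 1] so that derivatives at the ends are two-sided. This
     [eta] keeps the points in modulus below rho (1 + 2 eta) = (rho + r)/2 at most. *)
  set (eta := (r - rho) / (4 * rho)).
  assert (Heta : 0 < eta) by (apply Rdiv_lt_0_compat; lra).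
  assert (Hin : forall u t, - eta < u < 1 + eta -> Cmod (z + RtoC u * (w t - z)) < r).
  { intros u t Hu.
    replace (z + RtoC u * (w t - z))%C with (RtoC (1 - u) * z + RtoC u * w t)%C
      by (rewrite RtoC_minus; ring).
    eapply Rle_lt_trans; [apply Cmod_triangle|]. rewrite !Cmod_mult, !Cmod_R.
    unfold w; rewrite Cmod_circ by lra.
    assert (E : rho * (1 + 2 * eta) = rho + (r - rho) / 2) by (unfold eta; field; lra).
    assert (B : Rabs (1 - u) + Rabs u <= 1 + 2 * eta) by (unfold Rabs; repeat destruct Rcase_abs; lra).
    pose proof (Rabs_pos (1 - u)); pose proof (Rabs_pos u).
    assert (Rabs (1 - u) * Cmod z <= Rabs (1 - u) * rho) by (apply Rmult_le_compat_l; lra).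
    assert (rho * (Rabs (1 - u) + Rabs u) <= rho * (1 + 2 * eta)) by (apply Rmult_le_compat_l; lra).
    lra. }
  set (g := fun u t => (f (z + RtoC u * (w t - z)) * (w t * / (w t - z)))%C).
  set (g' := fun u t => (f' (z + RtoC u * (w t - z)) * w t)%C).
  assert (Hw : forall p, ccont (fun q => w (Im q)) p).
  { intros p. eapply ccont_rder_Im, rder_circ. }
  assert (Haff : forall p, ccont (fun q => z + RtoC (Re q) * (w (Im q) - z))%C p).
  { intros p. apply ccont_plus; [apply ccont_const|]. apply ccont_mult; [apply ccont_Re|].
    apply ccont_plus; [apply Hw | apply ccont_const]. }
  assert (Hwc : rcont w) by apply rcont_circ.
  assert (Haffr : forall u, rcont (fun t => z + RtoC u * (w t - z))%C).
  { intros u. apply rcont_plus; [apply rcont_const|]. apply rcont_mult; [apply rcont_const|].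
    apply rcont_plus; [exact Hwc | apply rcont_const]. }
  assert (HK : rcont (fun t => w t * / (w t - z))%C).
  { apply rcont_mult; [exact Hwc|].
    apply (rcont_comp (fun v => / (v - z))%C w); [exact Hwc|]. intros t.
    apply (ccont_comp Cinv (fun v => v - z)%C); [now apply ccont_inv|].
    apply ccont_plus; [apply ccont_id | apply ccont_const]. }
  assert (Hg : forall u, - eta < u < 1 + eta -> rcont (g u)).
  { intros u Hu. apply rcont_mult; [|exact HK].
    apply (rcont_comp f (fun t => z + RtoC u * (w t - z))%C); [apply Haffr|].
    intros t. eapply cder_ccont. apply Hf, Hin, Hu. }
  assert (Hg' : forall u, - eta < u < 1 + eta -> rcont (g' u)).
  { intros u Hu. apply rcont_mult; [|exact Hwc].
    apply (rcont_comp f' (fun t => z + RtoC u * (w t - z))%C); [apply Haffr|].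
    intros t. apply Hf, Hin, Hu. }
  assert (D : forall u, - eta < u < 1 + eta -> rder (fun u => mean (g u)) u (mean (g' u))).
  { intros u Hu. apply (rder_mean_param g g' (- eta) (1 + eta)); [exact Hu | | exact Hg |].
    - intros x v Hx. unfold g.
      replace (g' x v) with (w v * / (w v - z) * (f' (z + RtoC x * (w v - z)) * (w v - z)))%C.
      + pose proof (cder_along f z (w v - z) x _ (proj1 (Hf _ (Hin x v Hx)))) as D.
        pose proof (rder_comp (fun y => w v * / (w v - z) * y)%C _ x _ _
                     (cder_scal (w v * / (w v - z)) _ _ _ (cder_id _)) D) as D2.
        apply rder_eps; intros eps He. rewrite rder_eps in D2. destruct (D2 eps He) as [del [Hd K]].
        exists del; split; [exact Hd|]. intros y Hy. specialize (K y Hy).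
        match type of K with Cmod ?a <= _ => match goal with |- Cmod ?b <= _ => replace b with a end end;
          [exact K | ring].
      + unfold g'. pose proof (Hn v). field; auto.
    - intros x v Hx. apply (ccont_mult (fun q => f' (z + RtoC (Re q) * (w (Im q) - z))%C) (fun q => w (Im q)));
        [|apply Hw].
      apply (ccont_comp f' (fun q => z + RtoC (Re q) * (w (Im q) - z))%C); [|apply Haff].
      apply Hf. exact (Hin x v Hx). }
  (* Here [g' u] is the angular derivative of f(z + u(w - z))/(i u). The division by u excludes u =
     0, which the mean value inequality tolerates. *)
  assert (Z : forall u, 0 < u < 1 -> mean (g' u) = 0%C).
  { intros u Hu. assert (Hu' : - eta < u < 1 + eta) by lra.
    assert (Hu0 : RtoC u <> 0%C) by (intros E; apply RtoC_inj in E; lra).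
    assert (Hi : Ci <> 0%C) by (apply Cmod_gt_0; rewrite Cmod_Ci; lra).
    apply (mean_periodic_derivative (fun t => / (Ci * u) * f (z + RtoC u * (w t - z)))%C).
    - now apply Hg'.
    - intros t.
      assert (K : cder (fun v => / (Ci * u) * f (z + RtoC u * (v - z)))%C (w t)
                    (/ (Ci * u) * (f' (z + RtoC u * (w t - z))%C * u))%C).
      { apply cder_scal, (cder_comp f (fun v => z + RtoC u * (v - z))%C); [now apply Hf, Hin|].
        eapply cder_eq.
        - apply cder_plus; [apply cder_const|]. apply cder_scal, cder_minus; [apply cder_id | apply cder_const].
        - ring. }
      replace (g' u t) with (/ (Ci * u) * (f' (z + RtoC u * (w t - z)) * u) * (Ci * w t))%C.
      + apply (rder_comp _ w _ _ _ K). apply rder_circ.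
      + unfold g'. field; auto.
    - unfold w; now rewrite circ_2PI. }
  assert (E : Cmod (mean (g 1) - mean (g 0)) <= 0 - 0).
  { apply (Cmod_diff_le_rder (fun u => mean (g u)) (fun u => mean (g' u)) (fun _ => 0) (fun _ => 0)).
    - intros t Ht. apply D; lra.
    - intros; auto_derive; trivial.
    - intros t Ht. rewrite Z, Cmod_0 by exact Ht. lra. }
  pose proof (Cmod_ge_0 (mean (g 1) - mean (g 0))).
  assert (E0 : Cmod (mean (g 1) - mean (g 0)) = 0) by lra. apply Cmod_eq_0 in E0.
  assert (E1 : mean (g 1) = mean (g 0)).
  { replace (mean (g 1)) with (mean (g 1) - mean (g 0) + mean (g 0))%C by ring. rewrite E0; ring. }
  transitivity (mean (g 1)); [|rewrite E1; transitivity (f z * mean (fun t => 1 * (w t * / (w t - z)))%C)%C].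
  - apply mean_ext; intros t. unfold g. replace (z + 1 * (w t - z))%C with (w t) by ring. reflexivity.
  - rewrite <- mean_scal.
    + apply mean_ext; intros t. unfold g. replace (z + 0 * (w t - z))%C with z by ring. ring.
    + apply rcont_mult; [apply rcont_const | exact HK].
  - unfold w. rewrite mean_Cauchy_kernel by exact Hz. ring.
Qed.

Definition circ_coef (rho : R) (f : C -> C) (k : nat) : C :=
  mean (fun t => f (circ rho t) * (/ circ rho t) ^ k)%C.

Lemma hol_rcont_circ r f f' rho : hol r f f' -> 0 < rho < r -> rcont (fun t => f (circ rho t)).
Proof.
  intros Hf Hr. apply (rcont_comp f (circ rho)); [apply rcont_circ|].
  intros t. eapply cder_ccont, Hf. rewrite Cmod_circ; lra.
Qed.

Lemma hol_pser_circ r f f' rho : hol r f f' -> 0 < rho < r -> pser rho f (circ_coef rho f).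
Proof.
  intros Hf Hr z Hz.
  rewrite <- (Cauchy_formula r f f' rho z Hf) by lra.
  apply (Cauchy_kernel_series (fun t => f (circ rho t)) rho z); [|exact Hz].
  now apply (hol_rcont_circ r f f').
Qed.

(** The coefficients are read off on one fixed circle; a larger circle around a given z yields the
    same ones, by uniqueness on the smaller disc. *)
Lemma hol_pser r f f' : 0 < r -> hol r f f' -> exists a, pser r f a.
Proof.
  intros Hr Hf. exists (circ_coef (r / 2) f). intros z Hz.
  set (rho := (Rmax (Cmod z) (r / 2) + r) / 2).
  assert (Hrho : Cmod z < rho /\ r / 2 < rho < r).
  { unfold rho. pose proof (Rmax_l (Cmod z) (r / 2)). pose proof (Rmax_r (Cmod z) (r / 2)).
    assert (Rmax (Cmod z) (r / 2) < r) by (apply Rmax_lub_lt; lra). lra. }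
  eapply is_cseries_ext; [|apply (hol_pser_circ r f f' rho Hf); lra].
  intros n. simpl. f_equal.
  apply (pser_unique (r / 2) f); [lra | | ].
  - intros x Hx. apply (hol_pser_circ r f f' rho Hf); lra.
  - apply (hol_pser_circ r f f'); [exact Hf | lra].
Qed.

Lemma pser_hol r f a : pser r f a -> hol r f (PS (dseq a)).
Proof.
  intros H z Hz. assert (Hr : 0 < r) by (pose proof (Cmod_ge_0 z); lra).
  split; [now apply (pser_cder r)|].
  eapply cder_ccont, (pser_cder r); [apply (pser_dseq r f) | ]; eauto.
Qed.

Lemma pser_circ_coef r f a rho k : pser r f a -> 0 < rho < r -> a k = circ_coef rho f k.
Proof.
  intros H Hr. apply (pser_unique rho f); [lra | |].
  - intros z Hz. apply H; lra.
  - apply (hol_pser_circ r f _ rho (pser_hol r f a H) Hr).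
Qed.

Lemma hol_mult r f f' g g' : hol r f f' -> hol r g g' ->
  hol r (fun z => f z * g z)%C (fun z => f' z * g z + f z * g' z)%C.
Proof.
  intros Hf Hg z Hz. destruct (Hf z Hz) as [F1 F2]. destruct (Hg z Hz) as [G1 G2].
  split; [now apply cder_mult|].
  apply ccont_plus; apply ccont_mult; auto; eapply cder_ccont; eauto.
Qed.

Lemma hol_comp r s f f' g g' : hol s f f' -> hol r g g' -> (forall z, Cmod z < r -> Cmod (g z) < s) ->
  hol r (fun z => f (g z)) (fun z => f' (g z) * g' z)%C.
Proof.
  intros Hf Hg Hs z Hz. destruct (Hg z Hz) as [G1 G2]. destruct (Hf (g z) (Hs z Hz)) as [F1 F2].
  split; [now apply cder_comp|].
  apply ccont_mult; [apply (ccont_comp f' g)|]; auto. eapply cder_ccont; eauto.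
Qed.

Lemma pser_mult_ex r f g a b : 0 < r -> pser r f a -> pser r g b ->
  exists c, pser r (fun z => f z * g z)%C c.
Proof.
  intros Hr Hf Hg. eapply hol_pser; [exact Hr|]. apply hol_mult; eapply pser_hol; eauto.
Qed.

(** Landau's trick: Cauchy's formula bounds |f z| up to the factor rho/(rho - |z|). Applied to the
    powers f^n, the same factor appears for every n, and taking n large removes it. *)
Lemma max_principle r f a rho M : pser r f a -> rho < r ->
  (forall z, Cmod z = rho -> Cmod (f z) <= M) -> forall z, Cmod z <= rho -> Cmod (f z) <= M.
Proof.
  intros Hf Hr HM z Hz. destruct (Req_dec (Cmod z) rho) as [E|E]; [auto|].
  assert (Hz' : Cmod z < rho) by lra. clear Hz E. pose proof (Cmod_ge_0 z) as Hz0.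
  assert (HM0 : 0 <= M).
  { eapply Rle_trans; [apply Cmod_ge_0 | apply (HM rho)]. rewrite Cmod_R, Rabs_pos_eq; lra. }
  destruct (Rle_or_lt (Cmod (f z)) M) as [H|H]; [exact H|exfalso].
  assert (Hpow : forall n, exists c, pser r (fun z => f z ^ n)%C c).
  { induction n as [|n [c Hc]].
    - exists (fun n => match n with O => RtoC 1 | S _ => RtoC 0 end). intros x Hx. exact (pser_const r 1%C x Hx).
    - exact (pser_mult_ex r f (fun z => f z ^ n)%C a c ltac:(lra) Hf Hc). }
  (* Unlike [M], the midpoint is positive in every case, so one may divide by its powers. *)
  set (m := Cmod (f z)) in *. set (M1 := (M + m) / 2).
  assert (HM1 : M < M1 < m) by (unfold M1; lra).
  assert (B : forall n, m ^ n <= M1 ^ n * (rho / (rho - Cmod z))).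
  { intros n. destruct (Hpow n) as [c Hc].
    unfold m. rewrite <- Cmod_pow.
    pose proof (Cauchy_formula r (fun z => f z ^ n)%C _ rho z (pser_hol _ _ _ Hc) Hr Hz') as CF.
    cbv beta in CF. rewrite <- CF. apply mean_bound.
    - apply rcont_mult.
      + apply (hol_rcont_circ r (fun z => f z ^ n)%C _ rho (pser_hol _ _ _ Hc)); lra.
      + apply rcont_mult; [apply rcont_circ|].
        apply (rcont_comp (fun v => / (v - z))%C (circ rho)); [apply rcont_circ|]. intros t.
        apply (ccont_comp Cinv (fun v => v - z)%C).
        * apply ccont_inv. intros E. pose proof (Cmod_triangle_rev (circ rho t) z) as T.
          rewrite Cmod_circ in T by lra. rewrite E, Cmod_0 in T. lra.
        * apply ccont_plus; [apply ccont_id | apply ccont_const].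
    - intros t _. pose proof (Cmod_triangle_rev (circ rho t) z) as T.
      rewrite Cmod_circ in T by lra.
      rewrite !Cmod_mult, Cmod_pow, Cmod_circ, Cmod_inv; [| |lra].
      + apply Rmult_le_compat.
        * apply pow_le, Cmod_ge_0.
        * apply Rmult_le_pos; [lra | apply Rlt_le, Rinv_0_lt_compat; lra].
        * apply pow_incr; split; [apply Cmod_ge_0|].
          specialize (HM (circ rho t)). rewrite Cmod_circ in HM by lra. specialize (HM eq_refl). lra.
        * apply Rmult_le_compat_l; [lra|]. apply Rinv_le_contravar; lra.
      + intros E. rewrite E, Cmod_0 in T. lra. }
  destruct (Pow_x_infinity (m / M1)) with (b := rho / (rho - Cmod z) + 1) as [N HN].
  - rewrite Rabs_pos_eq by (apply Rdiv_le_0_compat; lra). apply Rlt_gt.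
    apply (Rmult_lt_reg_r M1); [lra|]. unfold Rdiv. rewrite Rmult_assoc, Rinv_l; lra.
  - specialize (HN N (le_n _)). rewrite Rabs_pos_eq in HN by (apply pow_le, Rdiv_le_0_compat; lra).
    specialize (B N).
    assert (P : 0 < M1 ^ N) by (apply pow_lt; lra).
    assert (E : (m / M1) ^ N = m ^ N / M1 ^ N) by (unfold Rdiv; rewrite Rpow_mult_distr, pow_inv; reflexivity).
    rewrite E in HN.
    assert (m ^ N / M1 ^ N <= rho / (rho - Cmod z)).
    { apply Rle_div_l; [exact P|]. lra. }
    lra.
Qed.

(** * Bessel's inequality and Rogosinski's theorem *)

Fixpoint psum (a : nat -> C) (n : nat) (z : C) : C :=
  match n with O => 0%C | S m => (psum a m z + a m * z ^ m)%C end.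

(** The mean square of the polynomial [psum a n] over the circle of radius [rho]; the index [n]
    counts terms, so degrees stay below [n]. *)
Fixpoint nsum (a : nat -> C) (n : nat) (rho : R) : R :=
  match n with O => 0 | S m => nsum a m rho + Cmod (a m) ^ 2 * rho ^ (2 * m) end.

Lemma rcont_psum a n rho : rcont (fun t => psum a n (circ rho t)).
Proof.
  induction n; [exact (rcont_const 0)|]. simpl. apply rcont_plus; [exact IHn|].
  apply rcont_mult; [apply rcont_const | apply rcont_pow, rcont_circ].
Qed.

Lemma Cmod2_minus z w : Cmod (z - w) ^ 2 = Cmod z ^ 2 + -2 * Re (z * Cconj w) + Cmod w ^ 2.
Proof.
  rewrite !Cmod2_alt. destruct z as [a b], w as [c d]; unfold Re, Im, Cconj; simpl. ring.
Qed.

(** One monomial is subtracted at a time. Each subtraction lowers the mean square by exactly |c n|^2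
    rho^(2n), because the remaining function still has n-th coefficient c n. *)
Lemma Bessel_identity h rho n : rcont h -> 0 < rho ->
  let c := fun k => mean (fun t => h t * (/ circ rho t) ^ k)%C in
  meanR (fun t => Cmod (h t - psum c n (circ rho t)) ^ 2)
    = meanR (fun t => Cmod (h t) ^ 2) - nsum c n rho.
Proof.
  intros Hh Hr c.
  set (W := circ rho).
  assert (HWi : forall k, rcont (fun t => (/ W t) ^ k)%C) by (intros; now apply rcont_pow, rcont_circ_inv).
  assert (Hd : forall m, rcont (fun t => h t - psum c m (W t))%C).
  { intros m. apply rcont_plus; [exact Hh|].
    intros t; apply (ccont_ext_loc (fun p => (-1) * psum c m (W (Re p)))%C _ _ 1); [lra | intros; cbv beta; ring |].
    apply (rcont_mult (fun _ => RtoC (-1)) (fun t => psum c m (W t)) (rcont_const _) (rcont_psum c m rho)). }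
  (* Subtracting the terms of degree below [m] leaves the later coefficients unchanged. *)
  assert (Orth : forall j m, (m <= j)%nat ->
            mean (fun t => (h t - psum c m (W t)) * (/ W t) ^ j)%C = c j).
  { intros j m; induction m as [|m IH]; intros Hm.
    - apply mean_ext; intros t. simpl. fold (W t). ring.
    - transitivity (mean (fun t => (h t - psum c m (W t)) * (/ W t) ^ j
                           + (- c m) * (W t ^ m * (/ W t) ^ j))%C).
      { apply mean_ext; intros t. cbn [psum]. ring. }
      pose proof (mean_circ_monomial rho m j Hr) as MM. fold W in MM.
      rewrite mean_plus, mean_scal, MM, IH by
        (try lia; repeat first [apply rcont_mult | apply rcont_const | apply HWi | apply Hd
                               | apply rcont_pow, rcont_circ]).
      destruct (Nat.eq_dec m j) as [E|E]; [lia | ring]. }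
  induction n as [|n IH].
  - cbn [psum nsum]. rewrite Rminus_0_r. apply meanR_ext; intros t.
    now replace (h t - 0)%C with (h t) by ring.
  - set (H := fun t => (h t - psum c n (W t))%C) in *.
    set (k := RtoC (rho ^ (2 * n))).
    transitivity (meanR (fun t => Cmod (H t) ^ 2 + (Re ((-2 * (Cconj (c n) * k)) * (H t * (/ W t) ^ n))
                     + Cmod (c n) ^ 2 * rho ^ (2 * n)))).
    { apply meanR_ext; intros t. simpl psum.
      replace (h t - (psum c n (W t) + c n * W t ^ n))%C with (H t - c n * W t ^ n)%C
        by (unfold H; ring).
      rewrite Cmod2_minus, Rplus_assoc. f_equal. f_equal.
      (* On the circle the conjugate of w is rho^2/w, so the cross term is again a mean against
         w^(-n). *)
      - rewrite Cmult_conj, Cpow_conj. unfold W. rewrite Cconj_circ by exact Hr.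
        replace ((RtoC (rho ^ 2) / circ rho t) ^ n)%C with (k * (/ circ rho t) ^ n)%C.
        + replace (-2 * (Cconj (c n) * k) * (H t * (/ circ rho t) ^ n))%C
            with (RtoC (-2) * (H t * (Cconj (c n) * (k * (/ circ rho t) ^ n))))%C by ring.
          rewrite (Re_Cmult (RtoC (-2))). unfold RtoC at 1 2, Re at 2, Im at 1; simpl fst; simpl snd. ring.
        + unfold k, Cdiv. rewrite Cpow_mult_l, pow_mult, <- RtoC_pow. reflexivity.
      - rewrite Cmod_mult, Cmod_pow. unfold W. rewrite Cmod_circ by lra.
        rewrite Rpow_mult_distr. f_equal. rewrite <- pow_mult. f_equal. lia. }
    assert (HH : rcont H) by apply Hd.
    assert (HHW : rcont (fun t => H t * (/ W t) ^ n)%C) by (apply rcont_mult; auto).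
    assert (C1 : forall t, continuous (fun t => Re ((-2 * (Cconj (c n) * k)) * (H t * (/ W t) ^ n))) t).
    { apply (rcont_continuous_Re (fun t => (-2 * (Cconj (c n) * k)) * (H t * (/ W t) ^ n))%C).
      apply rcont_mult; [apply rcont_const | exact HHW]. }
    rewrite (meanR_plus (fun t => Cmod (H t) ^ 2)
       (fun t => Re ((-2 * (Cconj (c n) * k)) * (H t * (/ W t) ^ n)) + Cmod (c n) ^ 2 * rho ^ (2 * n))).
    2: now apply rcont_continuous_Cmod2.
    2:{ intros t. apply (continuous_plus (fun t => Re ((-2 * (Cconj (c n) * k)) * (H t * (/ W t) ^ n)))
          (fun _ => Cmod (c n) ^ 2 * rho ^ (2 * n))); [apply C1 | apply continuous_const]. }
    rewrite (meanR_plus (fun t => Re ((-2 * (Cconj (c n) * k)) * (H t * (/ W t) ^ n)))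
       (fun _ => Cmod (c n) ^ 2 * rho ^ (2 * n))) by (try exact C1; intros; apply continuous_const).
    rewrite meanR_const.
    rewrite <- (Re_mean (fun t => (-2 * (Cconj (c n) * k)) * (H t * (/ W t) ^ n))%C).
    rewrite mean_scal by exact HHW.
    assert (EO : mean (fun t => H t * (/ W t) ^ n)%C = c n) by exact (Orth n n (le_n n)).
    change (meanR (fun t => Cmod (H t) ^ 2) = meanR (fun t => Cmod (h t) ^ 2) - nsum c n rho) in IH.
    rewrite EO, IH.
    replace (-2 * (Cconj (c n) * k) * c n)%C with (RtoC (-2 * (Cmod (c n) ^ 2 * rho ^ (2 * n)))).
    + change (Re (RtoC (-2 * (Cmod (c n) ^ 2 * rho ^ (2 * n))))) with (-2 * (Cmod (c n) ^ 2 * rho ^ (2 * n))).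
      cbn [nsum]. ring.
    + unfold k. rewrite (RtoC_mult (-2)), (RtoC_mult (Cmod (c n) ^ 2)), Cmod2_conj. ring.
Qed.

Lemma Bessel h rho n : rcont h -> 0 < rho ->
  nsum (fun k => mean (fun t => h t * (/ circ rho t) ^ k)%C) n rho <= meanR (fun t => Cmod (h t) ^ 2).
Proof.
  intros Hh Hr. pose proof (Bessel_identity h rho n Hh Hr) as E. cbv zeta beta in E.
  set (c := fun k => mean (fun t => h t * (/ circ rho t) ^ k)%C) in *.
  assert (0 <= meanR (fun t => Cmod (h t - psum c n (circ rho t)) ^ 2)); [|lra].
  rewrite <- (meanR_const 0). apply meanR_le.
  - intros; apply continuous_const.
  - apply (rcont_continuous_Cmod2 (fun t => h t - psum c n (circ rho t))%C).
    apply rcont_plus; [exact Hh|]. intros t.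
    apply (ccont_ext_loc (fun p => (-1) * psum c n (circ rho (Re p)))%C _ _ 1); [lra | intros; cbv beta; ring |].
    apply (rcont_mult (fun _ => RtoC (-1)) (fun t => psum c n (circ rho t)) (rcont_const _) (rcont_psum c n rho)).
  - intros; apply pow2_ge_0.
Qed.

Lemma nsum_ext a b n rho : (forall k, (k < n)%nat -> a k = b k) -> nsum a n rho = nsum b n rho.
Proof.
  induction n; intros H; [reflexivity|]. simpl. rewrite IHn by (intros; apply H; lia).
  now rewrite H by lia.
Qed.

Lemma psum_ext a b n z : (forall k, (k < n)%nat -> a k = b k) -> psum a n z = psum b n z.
Proof.
  induction n; intros H; [reflexivity|]. simpl. rewrite IHn by (intros; apply H; lia).
  now rewrite H by lia.
Qed.

Lemma psum_pser r a n : pser r (psum a n) (fun k => if lt_dec k n then a k else 0%C).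
Proof.
  induction n as [|n IH].
  - eapply pser_ext; [|intros z Hz; eapply is_cseries_ext; [|apply (pser_const r 0%C z Hz)]].
    + reflexivity.
    + intros k. simpl. now destruct k.
  - assert (M : pser r (fun z => a n * z ^ n)%C (fun k => if Nat.eq_dec k n then a n else 0%C)).
    { clear IH. generalize (a n); intros c. induction n as [|n IH].
      - intros z Hz. replace (c * z ^ 0)%C with c by (simpl; ring).
        eapply is_cseries_ext; [|apply (pser_const r c z Hz)]. intros k; now destruct k.
      - intros z Hz. replace (c * z ^ S n)%C with (z * (c * z ^ n))%C by (simpl; ring).
        eapply is_cseries_ext; [|apply (pser_mult_z _ _ _ IH z Hz)].
        intros k. simpl. destruct k; [reflexivity|].
        destruct (Nat.eq_dec k n), (Nat.eq_dec (S k) (S n)); try reflexivity; lia. }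
    intros z Hz. eapply is_cseries_ext; [|apply (pser_plus _ _ _ _ _ IH M z Hz)].
    intros k. simpl. f_equal.
    destruct (lt_dec k n), (lt_dec k (S n)), (Nat.eq_dec k n); try lia; subst; ring.
Qed.

Lemma pser_psum_tail r f a n z : pser r f a -> Cmod z < r ->
  f z = (psum a n z + z ^ n * PS (fun k => a (n + k)%nat) z)%C.
Proof.
  intros Hf Hz. assert (Hr : 0 < r) by (pose proof (Cmod_ge_0 z); lra).
  assert (B : forall m, cbd r (fun k => a (m + k)%nat)).
  { induction m as [|m IH].
    - intros rho Hrho. exact (pser_cbd r f a Hf rho Hrho).
    - intros rho Hrho. destruct (cbd_shift r _ Hr IH rho Hrho) as [K HK]. exists K; intros k.
      specialize (HK k). now rewrite Nat.add_succ_r in HK. }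
  induction n as [|n IH].
  - simpl. rewrite <- (pser_PS r f a z Hf Hz). unfold PS; simpl. ring.
  - rewrite IH. simpl psum.
    rewrite (pser_factor r _ _ z (cbd_pser r _ (B n)) Hz).
    replace (PS (fun k => a (n + S k)%nat) z) with (PS (fun k => a (S n + k)%nat) z).
    + rewrite Nat.add_0_r. simpl. ring.
    + eapply is_cseries_unique; [apply (cbd_pser r _ (B (S n)) z Hz)|].
      eapply is_cseries_ext; [|apply (pser_shift r _ _ Hr (cbd_pser r _ (B n)) z Hz)].
      intros k. simpl. now rewrite Nat.add_succ_r.
Qed.

Lemma pser_tail r f a n : 0 < r -> pser r f a -> exists b, pser r (PS (fun k => a (n + k)%nat)) b.
Proof.
  intros Hr Hf. exists (fun k => a (n + k)%nat). apply cbd_pser.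
  induction n as [|m IH].
  - intros rho Hrho. exact (pser_cbd r f a Hf rho Hrho).
  - intros rho Hrho. destruct (cbd_shift r _ Hr IH rho Hrho) as [K HK]. exists K; intros k.
    specialize (HK k). now rewrite Nat.add_succ_r in HK.
Qed.

Lemma pser_zpow_coef r f a n : pser r f a ->
  exists b, pser r (fun z => z ^ n * f z)%C b /\ forall k, (k < n)%nat -> b k = 0%C.
Proof.
  intros Hf. induction n as [|n [b [Hb H0]]].
  - exists a; split; [|intros; lia]. eapply pser_ext; [|exact Hf]. intros; simpl; ring.
  - eexists; split.
    + eapply pser_ext; [|apply (pser_mult_z _ _ _ Hb)]. intros; simpl; ring.
    + intros k Hk. destruct k; [reflexivity|]. apply H0; lia.
Qed.

Lemma nsum_Parseval r a n rho : 0 < rho < r ->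
  meanR (fun t => Cmod (psum a n (circ rho t)) ^ 2) = nsum a n rho.
Proof.
  intros Hr.
  pose proof (Bessel_identity _ rho n (rcont_psum a n rho) (proj1 Hr)) as E. cbv zeta beta in E.
  assert (Hc : forall k, (k < n)%nat -> mean (fun t => psum a n (circ rho t) * (/ circ rho t) ^ k)%C = a k).
  { intros k Hk. pose proof (pser_circ_coef r _ _ rho k (psum_pser r a n) Hr) as P.
    cbv beta in P. destruct (lt_dec k n) in P; [|lia]. rewrite P. reflexivity. }
  rewrite (nsum_ext _ a n rho Hc) in E.
  rewrite (meanR_ext _ (fun _ => 0)), meanR_const in E; [lra|].
  intros t. rewrite (psum_ext _ a n (circ rho t) Hc).
  replace (psum a n (circ rho t) - psum a n (circ rho t))%C with (RtoC 0) by ring.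
  rewrite Cmod_0. simpl; ring.
Qed.

(** Every weight rho^(2m) with m < n is at least rho^(2n), so the passage to radius 1 only uses
    continuity of a single power. *)
Lemma nsum_le_1 a n B : (forall rho, 0 < rho < 1 -> nsum a n rho <= B) -> nsum a n 1 <= B.
Proof.
  intros H.
  assert (D : forall rho, 0 < rho < 1 -> rho ^ (2 * n) * nsum a n 1 <= nsum a n rho).
  { intros rho Hr. assert (P : forall m, (m <= n)%nat -> rho ^ (2 * n) * nsum a m 1 <= nsum a m rho).
    { induction m as [|m IH]; intros Hm; [simpl nsum; lra|]. cbn [nsum]. specialize (IH ltac:(lia)).
      rewrite pow1, Rmult_1_r.
      assert (rho ^ (2 * n) <= rho ^ (2 * m)).
      { replace (2 * n)%nat with (2 * m + (2 * n - 2 * m))%nat by lia. rewrite pow_add.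
        pose proof (pow_le rho (2 * m) ltac:(lra)).
        assert (rho ^ (2 * n - 2 * m) <= 1) by (rewrite <- (pow1 (2 * n - 2 * m)); apply pow_incr; lra).
        nra. }
      pose proof (pow2_ge_0 (Cmod (a m))). nra. }
    now apply P. }
  assert (L : is_lim (fun rho => rho ^ (2 * n) * nsum a n 1) 1 (nsum a n 1)).
  { assert (Hc : continuity_pt (fun rho => rho ^ (2 * n) * nsum a n 1) 1) by reg.
    apply is_lim_continuity in Hc. now rewrite pow1, Rmult_1_l in Hc. }
  apply Rnot_lt_le; intros Hlt.
  assert (He : 0 < nsum a n 1 - B) by lra.
  apply is_lim_spec in L. specialize (L (mkposreal _ He)). destruct L as [[d Hd] K]. simpl in K.
  set (x := 1 - Rmin (d / 2) (1 / 2)).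
  assert (Hx : 0 < x < 1 /\ Rabs (x - 1) < d).
  { unfold x. assert (0 < Rmin (d / 2) (1 / 2)) by (apply Rmin_pos; lra).
    pose proof (Rmin_l (d / 2) (1 / 2)). pose proof (Rmin_r (d / 2) (1 / 2)).
    split; [lra|]. rewrite Rabs_left; lra. }
  specialize (K x (proj2 Hx) ltac:(lra)). apply Rabs_def2 in K.
  specialize (D x (proj1 Hx)). specialize (H x (proj1 Hx)). simpl in D. lra.
Qed.

(** The first n coefficients of g F depend only on the first n of F, so F may be replaced by a
    polynomial. Its mean square is exactly [nsum], multiplication by g does not increase it, and
    Bessel bounds the coefficients of the product. *)
Lemma multiplier_contraction g F b a c n :
  pser 1 g b -> pser 1 F a -> pser 1 (fun z => g z * F z)%C c ->
  (forall z, Cmod z < 1 -> Cmod (g z) <= 1) -> nsum c n 1 <= nsum a n 1.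
Proof.
  intros Hg HF Hc Hb.
  destruct (pser_mult_ex 1 g _ _ _ ltac:(lra) Hg (psum_pser 1 a n)) as [d Hd].
  destruct (pser_tail 1 F a n ltac:(lra) HF) as [u Hu].
  destruct (pser_mult_ex 1 g _ _ _ ltac:(lra) Hg Hu) as [v Hv].
  destruct (pser_zpow_coef 1 _ _ n Hv) as [e [He He0]].
  assert (E : forall k, (k < n)%nat -> c k = d k).
  { intros k Hk. rewrite (pser_unique 1 _ c (fun k => d k + e k)%C ltac:(lra) Hc).
    - rewrite He0 by exact Hk. ring.
    - eapply pser_ext; [|apply (pser_plus _ _ _ _ _ Hd He)].
      intros z Hz. cbv beta. rewrite (pser_psum_tail 1 F a n z HF Hz). ring. }
  apply nsum_le_1. intros rho Hr. rewrite (nsum_ext c d n rho E).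
  assert (Hgc : rcont (fun t => g (circ rho t))) by (apply (hol_rcont_circ 1 g _ rho (pser_hol _ _ _ Hg)); lra).
  rewrite (nsum_ext d (fun k => mean (fun t => (g (circ rho t) * psum a n (circ rho t)) * (/ circ rho t) ^ k)%C)).
  - eapply Rle_trans; [apply Bessel; [|lra]|].
    + apply rcont_mult; [exact Hgc | apply rcont_psum].
    + apply Rle_trans with (nsum a n rho).
      * rewrite <- (nsum_Parseval 1 a n rho) by lra. apply meanR_le.
        -- apply (rcont_continuous_Cmod2 (fun t => g (circ rho t) * psum a n (circ rho t))%C).
           apply rcont_mult; [exact Hgc | apply rcont_psum].
        -- apply (rcont_continuous_Cmod2 (fun t => psum a n (circ rho t))), rcont_psum.
        -- intros t _. rewrite Cmod_mult. specialize (Hb (circ rho t)).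
           rewrite Cmod_circ in Hb by lra. specialize (Hb ltac:(lra)).
           apply pow_incr. pose proof (Cmod_ge_0 (g (circ rho t))).
           pose proof (Cmod_ge_0 (psum a n (circ rho t))). split; nra.
      * clear -Hr. induction n; cbn [nsum]; [lra|]. apply Rplus_le_compat; [exact IHn|].
        apply Rmult_le_compat_l; [apply pow2_ge_0|]. apply pow_incr; lra.
  - intros k _. apply (pser_circ_coef 1 _ d rho k Hd). lra.
Qed.

Lemma nsum_S_shift a n : nsum a (S n) 1 = Cmod (a O) ^ 2 + nsum (fun k => a (S k)) n 1.
Proof.
  induction n as [|n IH]; [cbn [nsum]; rewrite pow1; ring|].
  change (nsum a (S (S n)) 1) with (nsum a (S n) 1 + Cmod (a (S n)) ^ 2 * 1 ^ (2 * S n)).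
  rewrite IH. cbn [nsum]. rewrite !pow1. ring.
Qed.

(* Horner's scheme: each step prepends a coefficient orthogonal to the rest and
   multiplies by [z g], a shift followed by a contraction. *)
Lemma Rogosinski (d : nat -> C) g b U p a n :
  pser 1 U d -> pser 1 g b -> (forall z, Cmod z < 1 -> Cmod (g z) <= 1) ->
  pser 1 p a -> (forall z, Cmod z < 1 -> p z = U (z * g z)%C) ->
  nsum a n 1 <= nsum d n 1.
Proof.
  intros HU Hg Hg1 Hp HpU.
  assert (Hw : forall z, Cmod z < 1 -> Cmod (z * g z) < 1).
  { intros z Hz. rewrite Cmod_mult. specialize (Hg1 z Hz). pose proof (Cmod_ge_0 z).
    pose proof (Cmod_ge_0 (g z)). nra. }
  revert d U p a HU Hp HpU. induction n as [|n IH]; intros d U p a HU Hp HpU; [simpl; lra|].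
  rewrite !nsum_S_shift.
  assert (H0 : a O = d O).
  { rewrite <- (pser_0 1 p a), <- (pser_0 1 U d) by (assumption || lra).
    rewrite HpU by (rewrite Cmod_0; lra). f_equal. ring. }
  rewrite H0. apply Rplus_le_compat_l.
  set (U1 := PS (fun k => d (S k))).
  assert (HU1 : pser 1 U1 (fun k => d (S k))) by (apply (pser_shift 1 U d); [lra | exact HU]).
  assert (Hh : exists c, pser 1 (fun z => U1 (z * g z)%C) c).
  { eapply hol_pser; [lra|].
    exact (hol_comp 1 1 _ _ _ _ (pser_hol _ _ _ HU1) (pser_hol _ _ _ (pser_mult_z 1 g b Hg)) Hw). }
  destruct Hh as [c Hc].
  apply Rle_trans with (nsum c n 1).
  - apply (multiplier_contraction g (fun z => U1 (z * g z)%C) b c (fun k => a (S k)) n Hg Hc); [|exact Hg1].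
    destruct (pser_mult_ex 1 g _ _ _ ltac:(lra) Hg Hc) as [e He].
    assert (Ee : forall k, a (S k) = e k).
    { intros k. rewrite (pser_unique 1 p a (fun k => (match k with O => d O | S _ => 0%C end)
                 + (match k with O => 0%C | S m => e m end))%C ltac:(lra) Hp); [ring|].
      eapply pser_ext; [|apply pser_plus; [apply (pser_const 1 (d O)) | apply (pser_mult_z _ _ _ He)]].
      intros z Hz. cbv beta. rewrite HpU by exact Hz.
      rewrite (pser_factor 1 U d (z * g z) HU (Hw z Hz)). fold U1. ring. }
    intros z Hz. eapply is_cseries_ext; [|exact (He z Hz)]. intros k; cbv beta; now rewrite Ee.
  - apply (IH (fun k => d (S k)) U1 (fun z => U1 (z * g z)%C) c HU1 Hc). reflexivity.
Qed.

(** * Compactness, Jack's lemma and subordination *)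

(** The compactness of the closed disc, as a positive lower bound on the radii of a cover. *)
Lemma disc_covering (Rel : C -> R -> Prop) rho :
  (forall z, Cmod z <= rho -> exists d, 0 < d /\ Rel z d) ->
  exists d0, 0 < d0 /\ forall x, Cmod x <= rho ->
    exists z d, Cmod z <= rho /\ Rel z d /\ Cmod (x - z) < d /\ d0 <= d.
Proof.
  intros H.
  (* The compactness theorem wants a gauge on the whole square. Outside the disc it is half the gap
     to the disc, so that those cells meet no point of it. The factor 2 passes from square cells to
     the modulus. *)
  assert (Hd : forall u v : R, exists d : posreal,
     (Cmod (u, v) <= rho -> exists d', Rel (u, v) d' /\ d' = 2 * d) /\
     (rho < Cmod (u, v) -> forall x, Cmod x <= rho -> 2 * d <= Cmod (x - (u, v)))).
  { intros u v. destruct (Rle_or_lt (Cmod (u, v)) rho) as [Hle|Hlt].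
    - destruct (H _ Hle) as [d [Hd HR]]. assert (Hd2 : 0 < d / 2) by lra.
      exists (mkposreal _ Hd2). split; [|lra]. intros _. exists d; split; [exact HR|]. simpl; lra.
    - assert (Hd2 : 0 < (Cmod (u, v) - rho) / 2) by lra. exists (mkposreal _ Hd2).
      split; [lra|]. intros _ x Hx. simpl. pose proof (Cmod_triangle_rev (u, v) x) as T.
      rewrite Cmod_minus_sym in T. lra. }
  set (delta := fun u v => proj1_sig (constructive_indefinite_description _ (Hd u v))).
  assert (Hdelta : forall u v,
     (Cmod (u, v) <= rho -> exists d', Rel (u, v) d' /\ d' = 2 * delta u v) /\
     (rho < Cmod (u, v) -> forall x, Cmod x <= rho -> 2 * delta u v <= Cmod (x - (u, v)))).
  { intros u v. unfold delta. apply (proj2_sig (constructive_indefinite_description _ (Hd u v))). }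
  destruct (compactness_value_2d (- rho) rho (- rho) rho delta) as [d Hc].
  exists d; split; [apply cond_pos|]. intros x Hx.
  assert (Hre : - rho <= Re x <= rho) by (pose proof (re_le_Cmod x); apply Rabs_le_between; lra).
  assert (Him : - rho <= Im x <= rho) by (pose proof (Im_le_Cmod x); apply Rabs_le_between; lra).
  specialize (Hc (Re x) (Im x) Hre Him). apply NNPP in Hc.
  destruct Hc as [u [v [_ [_ [Hu [Hv Hle]]]]]].
  assert (Hxz : Cmod (x - (u, v)) < 2 * delta u v).
  { eapply Rle_lt_trans; [apply Cmod_le_Re_Im|].
    change (Rabs (Re x - u) + Rabs (Im x - v) < 2 * delta u v). lra. }
  destruct (Rle_or_lt (Cmod (u, v)) rho) as [Hin|Hout].
  - destruct (proj1 (Hdelta u v) Hin) as [d' [HR ->]].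
    exists (u, v), (2 * delta u v). pose proof (cond_pos d). repeat split; auto. lra.
  - exfalso. pose proof (proj2 (Hdelta u v) Hout x Hx). lra.
Qed.

Definition ccontR (k : C -> R) (z : C) : Prop :=
  forall eps, 0 < eps -> exists del, 0 < del /\
    forall w, Cmod (w - z) < del -> Rabs (k w - k z) < eps.

Lemma ccontR_Re F z : ccont F z -> ccontR (fun w => Re (F w)) z.
Proof.
  intros H eps He. destruct (H eps He) as [d [Hd K]]; exists d; split; [exact Hd|].
  intros w Hw. eapply Rle_lt_trans; [|apply (K w Hw)].
  replace (Re (F w) - Re (F z)) with (Re (F w - F z)) by (unfold Re; simpl; ring). apply re_le_Cmod.
Qed.

Lemma ccontR_Cmod F z : ccont F z -> ccontR (fun w => Cmod (F w)) z.
Proof.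
  intros H eps He. destruct (H eps He) as [d [Hd K]]; exists d; split; [exact Hd|].
  intros w Hw. eapply Rle_lt_trans; [|apply (K w Hw)].
  apply Rabs_le. pose proof (Cmod_triangle_rev (F w) (F z)). pose proof (Cmod_triangle_rev (F z) (F w)) as T.
  rewrite Cmod_minus_sym in T. lra.
Qed.

Lemma disc_bounded (k : C -> R) rho :
  (forall z, Cmod z <= rho -> exists d B, 0 < d /\ forall w, Cmod w <= rho -> Cmod (w - z) < d -> k w <= B) ->
  exists B, forall z, Cmod z <= rho -> k z <= B.
Proof.
  intros H.
  (* The local bound is encoded in the radius, as its inverse; a lower bound on the radii is then a
     global upper bound. *)
  destruct (disc_covering (fun z d => 0 < d /\ forall w, Cmod w <= rho -> Cmod (w - z) < d -> k w <= / d) rho)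
    as [d0 [Hd0 Hc]].
  - intros z Hz. destruct (H z Hz) as [d [B [Hd HB]]].
    assert (HB1 : 0 < Rabs B + 1) by (pose proof (Rabs_pos B); lra).
    assert (Hm : 0 < Rmin d (/ (Rabs B + 1))) by (apply Rmin_pos; [lra | now apply Rinv_0_lt_compat]).
    exists (Rmin d (/ (Rabs B + 1))); repeat split; auto. intros w Hw Hwz.
    apply Rle_trans with (Rabs B + 1).
    + pose proof (Rle_abs B). specialize (HB w Hw (Rlt_le_trans _ _ _ Hwz (Rmin_l _ _))). lra.
    + rewrite <- (Rinv_inv (Rabs B + 1)) at 1. apply Rinv_le_contravar; [exact Hm | apply Rmin_r].
  - exists (/ d0). intros x Hx. destruct (Hc x Hx) as [z [d [Hz [[Hd HR] [Hxz Hle]]]]].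
    eapply Rle_trans; [apply (HR x Hx Hxz)|]. now apply Rinv_le_contravar.
Qed.

(** With [m] the supremum of -k: if it were not attained, 1/(m + k) would be locally bounded, hence
    bounded, and [m] could be lowered. *)
Lemma disc_min (k : C -> R) rho : 0 <= rho -> (forall z, Cmod z <= rho -> ccontR k z) ->
  exists z0, Cmod z0 <= rho /\ forall z, Cmod z <= rho -> k z0 <= k z.
Proof.
  intros Hrho Hk.
  destruct (disc_bounded (fun z => - k z) rho) as [B HB].
  { intros z Hz. destruct (Hk z Hz 1) as [d [Hd K]]; [lra|]. exists d, (1 - k z); split; [exact Hd|].
    intros w _ Hw. specialize (K w Hw). apply Rabs_def2 in K. lra. }
  destruct (completeness (fun y => exists z, Cmod z <= rho /\ y = - k z)) as [m [Hm1 Hm2]].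
  { exists B. intros y [z [Hz ->]]. auto. }
  { exists (- k 0), 0%C. rewrite Cmod_0. split; [lra | reflexivity]. }
  apply NNPP; intros Hn.
  assert (Hpos : forall z, Cmod z <= rho -> 0 < m + k z).
  { intros z Hz. assert (- k z <= m) by (apply Hm1; exists z; auto).
    destruct (Req_dec (- k z) m) as [E|E]; [|lra]. exfalso. apply Hn. exists z; split; [exact Hz|].
    intros w Hw. assert (- k w <= m) by (apply Hm1; exists w; auto). lra. }
  destruct (disc_bounded (fun z => / (m + k z)) rho) as [B' HB'].
  { intros z Hz. pose proof (Hpos z Hz). destruct (Hk z Hz ((m + k z) / 2)) as [d [Hd K]]; [lra|].
    exists d, (/ ((m + k z) / 2)); split; [exact Hd|]. intros w Hw Hwz. specialize (K w Hwz).
    apply Rabs_def2 in K. apply Rinv_le_contravar; lra. }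
  assert (HB0 : 0 < B').
  { assert (H0 : Cmod 0 <= rho) by (rewrite Cmod_0; lra).
    eapply Rlt_le_trans; [|apply (HB' 0%C H0)]. apply Rinv_0_lt_compat; auto. }
  assert (m <= m - / B').
  { apply Hm2. intros y [z [Hz ->]]. pose proof (Hpos z Hz). specialize (HB' z Hz).
    assert (/ B' <= m + k z); [|lra].
    rewrite <- (Rinv_inv (m + k z)). apply Rinv_le_contravar; [now apply Rinv_0_lt_compat | exact HB']. }
  pose proof (Rinv_0_lt_compat _ HB0). lra.
Qed.

Lemma disc_max (k : C -> R) rho : 0 <= rho -> (forall z, Cmod z <= rho -> ccontR k z) ->
  exists z0, Cmod z0 <= rho /\ forall z, Cmod z <= rho -> k z <= k z0.
Proof.
  intros Hr Hk. destruct (disc_min (fun z => - k z) rho Hr) as [z0 [Hz0 K]].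
  - intros z Hz eps He. destruct (Hk z Hz eps He) as [d [Hd K]]; exists d; split; [exact Hd|].
    intros w Hw. specialize (K w Hw). rewrite <- Rabs_Ropp.
    now replace (- (- k w - - k z)) with (k w - k z) by ring.
  - exists z0; split; [exact Hz0|]. intros z Hz; specialize (K z Hz); lra.
Qed.

(** A point just outside the disc is close to its radial projection; the doubled radius in the
    covering relation makes room for this displacement. *)
Lemma disc_neighborhood (P : C -> Prop) rho : 0 <= rho ->
  (forall z, Cmod z <= rho -> exists d, 0 < d /\ forall w, Cmod (w - z) < d -> P w) ->
  exists d, 0 < d /\ forall w, Cmod w < rho + d -> P w.
Proof.
  intros Hrho H.
  destruct (disc_covering (fun z d => forall w, Cmod (w - z) < 2 * d -> P w) rho) as [d0 [Hd0 Hc]].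
  { intros z Hz. destruct (H z Hz) as [d [Hd K]]. exists (d / 2); split; [lra|].
    intros w Hw; apply K; lra. }
  exists d0; split; [exact Hd0|]. intros w Hw.
  assert (Hx : exists x, Cmod x <= rho /\ Cmod (w - x) < d0).
  { destruct (Rle_or_lt (Cmod w) rho) as [Hle|Hlt].
    - exists w; split; [exact Hle|]. replace (w - w)%C with (RtoC 0) by ring. now rewrite Cmod_0.
    - assert (Hm : RtoC (Cmod w) <> 0%C) by (intros E; apply RtoC_inj in E; lra).
      exists (RtoC (rho / Cmod w) * w)%C; split.
      + rewrite Cmod_mult, Cmod_R, Rabs_pos_eq by (apply Rdiv_le_0_compat; lra). right; field; lra.
      + replace (w - RtoC (rho / Cmod w) * w)%C with (RtoC ((Cmod w - rho) / Cmod w) * w)%C.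
        * rewrite Cmod_mult, Cmod_R, Rabs_pos_eq by (apply Rdiv_le_0_compat; lra).
          replace ((Cmod w - rho) / Cmod w * Cmod w) with (Cmod w - rho) by (field; lra). lra.
        * rewrite !RtoC_div, RtoC_minus by lra. field. exact Hm. }
  destruct Hx as [x [Hx1 Hx2]]. destruct (Hc x Hx1) as [z [d [Hz [HR [Hxz Hle]]]]].
  apply HR. replace (w - z)%C with ((w - x) + (x - z))%C by ring.
  eapply Rle_lt_trans; [apply Cmod_triangle|]. lra.
Qed.

Lemma derive_nonneg_left_max (k : R -> R) t l d : is_derive k t l -> 0 < d ->
  (forall u, t - d < u < t -> k u <= k t) -> 0 <= l.
Proof.
  intros Hk Hd H. apply Rnot_lt_le; intros Hl.
  assert (R : rder (fun u => RtoC (k u)) t (RtoC l)).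
  { split; [exact Hk|]. apply (is_derive_const 0). }
  rewrite rder_eps in R. destruct (R (- l / 2)) as [del [Hdel K]]; [lra|].
  set (x := Rmin (d / 2) (del / 2)).
  assert (Hx : 0 < x /\ x < d /\ x < del).
  { unfold x; pose proof (Rmin_l (d / 2) (del / 2)); pose proof (Rmin_r (d / 2) (del / 2)).
    split; [apply Rmin_pos; lra | lra]. }
  specialize (K (t - x)). specialize (H (t - x) ltac:(lra)).
  replace (t - x - t) with (- x) in K by ring. rewrite Rabs_Ropp, (Rabs_pos_eq x) in K by lra.
  specialize (K ltac:(lra)). rewrite <- RtoC_mult, <- !RtoC_minus, Cmod_R in K.
  assert (- (- l / 2 * x) <= k (t - x) - k t - l * - x <= - l / 2 * x) by now apply Rabs_le_between.
  nra.
Qed.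

Lemma is_derive_Cmod2 g t v : rder g t v ->
  is_derive (fun u => Cmod (g u) ^ 2) t (2 * Re (Cconj (g t) * v)).
Proof.
  intros [H1 H2].
  apply is_derive_ext with (fun u => Re (g u) ^ 2 + Im (g u) ^ 2).
  - intros u. now rewrite Cmod2_alt.
  - replace (2 * Re (Cconj (g t) * v))
      with (INR 2 * Re v * Re (g t) ^ 1 + INR 2 * Im v * Im (g t) ^ 1)
      by (unfold Re, Im; simpl; ring).
    apply (is_derive_plus (fun u => Re (g u) ^ 2) (fun u => Im (g u) ^ 2)).
    + exact (is_derive_pow (fun u => Re (g u)) 2 t _ H1).
    + exact (is_derive_pow (fun u => Im (g u)) 2 t _ H2).
Qed.

(** Jack's lemma for w = z g(z). Put mu = z0 g'(z0)/g(z0). Maximality of |g| along the circle makes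
    mu real; the maximum principle gives maximality along the radius and hence mu >= 0. Then m = 1 +
    mu. *)
Lemma Jack r g a z0 : pser r g a -> Cmod z0 < r -> z0 <> 0%C -> g z0 <> 0%C ->
  (forall z, Cmod z = Cmod z0 -> Cmod (g z) <= Cmod (g z0)) ->
  exists m, 1 <= m /\ (z0 * (g z0 + z0 * PS (dseq a) z0) = RtoC m * (z0 * g z0))%C.
Proof.
  intros Hg Hz0 Hz Hgz Hmax. set (g' := PS (dseq a)).
  assert (Hr0 : 0 < Cmod z0) by now apply Cmod_gt_0.
  assert (Hd := pser_cder r g a z0 Hg Hz0). fold g' in Hd.
  set (mu := (z0 * g' z0 / g z0)%C).
  set (N := Cmod (g z0) ^ 2).
  assert (HN : 0 < N) by (apply pow_lt; now apply Cmod_gt_0).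
  assert (Emu : (Cconj (g z0) * (g' z0 * z0) = RtoC N * mu)%C).
  { unfold N, mu. rewrite Cmod2_conj. field. exact Hgz. }
  assert (HRe : 0 <= Re mu).
  { assert (L : 0 <= 2 * Re (Cconj (g z0) * (g' z0 * z0))).
    { apply (derive_nonneg_left_max (fun u => Cmod (g (0 + RtoC u * z0)%C) ^ 2) 1 _ 1).
      - pose proof (is_derive_Cmod2 (fun u => g (0 + RtoC u * z0)%C) 1 (g' z0 * z0)) as D.
        cbv beta in D. replace (0 + 1 * z0)%C with z0 in D by ring. apply D.
        apply (cder_along g 0 z0 1). now replace (0 + 1 * z0)%C with z0 by ring.
      - lra.
      - intros u Hu. replace (0 + 1 * z0)%C with z0 by ring.
        apply pow_incr; split; [apply Cmod_ge_0|].
        apply (max_principle r g a (Cmod z0) _ Hg Hz0 Hmax).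
        replace (0 + u * z0)%C with (u * z0)%C by ring.
        rewrite Cmod_mult, Cmod_R, Rabs_pos_eq by lra. nra. }
    rewrite Emu in L. rewrite (Re_Cmult (RtoC N)) in L. change (Re (RtoC N)) with N in L.
    change (Im (RtoC N)) with 0 in L. nra. }
  (* A one-sided maximum yields only a sign, so [z0] is rotated in both directions. *)
  assert (HIm : forall s : R, s = 1 \/ s = -1 -> 0 <= s * - Im mu).
  { intros s Hs.
    set (rot := fun u : R => (circ 1 (s * u) * z0)%C).
    assert (Hrot0 : rot 0 = z0).
    { unfold rot, circ. rewrite Rmult_0_r, cos_0, sin_0, Rmult_1_l, Rmult_0_r. change (1, 0) with (RtoC 1). ring. }
    assert (Hrd : rder rot 0 (RtoC s * Ci * z0)).
    { unfold rot. split; unfold circ, Re, Im; simpl; auto_derive; trivial;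
        rewrite Rmult_0_r, cos_0, sin_0; ring. }
    assert (L : 0 <= 2 * Re (Cconj (g z0) * (g' z0 * (RtoC s * Ci * z0)))).
    { apply (derive_nonneg_left_max (fun u => Cmod (g (rot u)) ^ 2) 0 _ 1).
      - pose proof (is_derive_Cmod2 (fun u => g (rot u)) 0 (g' z0 * (RtoC s * Ci * z0))) as D.
        cbv beta in D. rewrite Hrot0 in D. apply D. apply (rder_comp g rot); [now rewrite Hrot0 | exact Hrd].
      - lra.
      - intros u Hu. rewrite Hrot0. apply pow_incr; split; [apply Cmod_ge_0|]. apply Hmax.
        unfold rot. rewrite Cmod_mult, Cmod_circ by lra. ring. }
    replace (Cconj (g z0) * (g' z0 * (RtoC s * Ci * z0)))%C
      with (RtoC s * Ci * (Cconj (g z0) * (g' z0 * z0)))%C in L by ring.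
    rewrite Emu in L. replace (Re (RtoC s * Ci * (RtoC N * mu))) with (N * (s * - Im mu)) in L
      by (unfold Re, Im; simpl; ring).
    nra. }
  assert (HIm0 : Im mu = 0) by (pose proof (HIm 1 ltac:(lra)); pose proof (HIm (-1) ltac:(lra)); lra).
  exists (1 + Re mu); split; [lra|].
  assert (Er : mu = RtoC (Re mu)) by (apply C_ext; [reflexivity | rewrite HIm0; reflexivity]).
  rewrite RtoC_plus, <- Er. unfold mu. fold g'. field. exact Hgz.
Qed.

(** * Lifting through a conformal map *)

Definition conformal (Q : C -> C) (c : nat -> C) : Prop :=
  pser 1 Q c /\
  (forall z w, Cmod z < 1 -> Cmod w < 1 -> Q z = Q w -> z = w) /\
  (forall z, Cmod z < 1 -> PS (dseq c) z <> 0%C).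

Lemma pser_ccont r f a z : pser r f a -> Cmod z < r -> ccont f z.
Proof. intros H Hz. eapply cder_ccont, (pser_cder r); eauto. Qed.

(** Open mapping by minimisation: the distance from Q to y is minimised over a closed disc. For y
    near Q z0 the minimum is interior, and a nonzero interior minimum contradicts Q' <> 0. *)
Lemma local_surjectivity Q c z0 eta : conformal Q c -> 0 < eta -> Cmod z0 + eta < 1 ->
  exists eps, 0 < eps /\ forall y, Cmod (y - Q z0) < eps ->
    exists z, Cmod (z - z0) < eta /\ Q z = y.
Proof.
  intros [HQ [Qinj HQ']] He Hz0. pose proof (Cmod_ge_0 z0) as Hz00.
  assert (Hin : forall x, Cmod x <= eta -> Cmod (z0 + x) < 1).
  { intros x Hx. eapply Rle_lt_trans; [apply Cmod_triangle|]. lra. }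
  assert (Hcont : forall y x, Cmod x <= eta -> ccont (fun x => Q (z0 + x) - y)%C x).
  { intros y x Hx. apply ccont_plus; [|apply ccont_const].
    apply (ccont_comp Q (fun x => z0 + x)%C).
    - apply (pser_ccont 1 Q c); auto.
    - apply ccont_plus; [apply ccont_const | apply ccont_id]. }
  (* What is wanted is a positive lower bound on the circle |x| = eta. The added term vanishes there
     and is positive inside, so minimising over the disc provides it. *)
  destruct (disc_min (fun x => Cmod (Q (z0 + x)%C - Q z0) + (eta - Cmod x)) eta ltac:(lra)) as [x0 [Hx0 Hx0m]].
  { intros x Hx eps Heps.
    destruct (ccontR_Cmod _ _ (Hcont (Q z0) x Hx) (eps / 2)) as [d1 [Hd1 K1]]; [lra|].
    destruct (ccontR_Cmod _ _ (ccont_id x) (eps / 2)) as [d2 [Hd2 K2]]; [lra|].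
    exists (Rmin d1 d2); split; [apply Rmin_pos; lra|]. intros w Hw.
    specialize (K1 w (Rlt_le_trans _ _ _ Hw (Rmin_l _ _))).
    specialize (K2 w (Rlt_le_trans _ _ _ Hw (Rmin_r _ _))).
    apply Rabs_def2 in K1, K2. apply Rabs_def1; lra. }
  set (m := Cmod (Q (z0 + x0)%C - Q z0) + (eta - Cmod x0)) in *.
  assert (Hm : 0 < m).
  { pose proof (Cmod_ge_0 (Q (z0 + x0)%C - Q z0)) as P.
    destruct (Req_dec (Cmod x0) eta) as [E|E]; [|unfold m; lra].
    assert (0 < Cmod (Q (z0 + x0)%C - Q z0)); [|unfold m; lra].
    apply Cmod_gt_0. intros E'.
    assert (E2 : (z0 + x0 = z0)%C).
    { apply Qinj; [apply Hin; lra | lra |].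
      replace (Q (z0 + x0)%C) with (Q (z0 + x0)%C - Q z0 + Q z0)%C by ring.
      rewrite E'; ring. }
    assert (E3 : x0 = 0%C) by (replace x0 with (z0 + x0 - z0)%C by ring; rewrite E2; ring).
    rewrite E3, Cmod_0 in E. lra. }
  exists (m / 2); split; [lra|]. intros y Hy.
  destruct (disc_min (fun x => Cmod (Q (z0 + x)%C - y)) eta ltac:(lra)) as [x [Hx Hmin]].
  { intros x Hx. apply (ccontR_Cmod (fun x => Q (z0 + x) - y)%C). now apply Hcont. }
  assert (H0 : Cmod (Q (z0 + x)%C - y) < m / 2).
  { eapply Rle_lt_trans; [apply (Hmin 0%C); rewrite Cmod_0; lra|].
    replace (z0 + 0)%C with z0 by ring. now rewrite Cmod_minus_sym. }
  assert (Hx' : Cmod x < eta).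
  { destruct (Req_dec (Cmod x) eta) as [E|E]; [exfalso|lra].
    specialize (Hx0m x Hx).
    pose proof (Cmod_triangle_rev (Q (z0 + x)%C - Q z0) (y - Q z0)) as T.
    replace (Q (z0 + x)%C - Q z0 - (y - Q z0))%C with (Q (z0 + x)%C - y)%C in T by ring.
    lra. }
  exists (z0 + x)%C; split; [now replace (z0 + x - z0)%C with x by ring|].
  apply NNPP; intros Hne.
  set (v := (Q (z0 + x)%C - y)%C) in *.
  assert (Hv : v <> 0%C).
  { intros E. apply Hne. replace (Q (z0 + x)%C) with (v + y)%C by (unfold v; ring). rewrite E; ring. }
  set (d := PS (dseq c) (z0 + x)%C).
  assert (Hd : d <> 0%C) by (apply HQ', Hin; lra).
  set (h := (v * Cconj d)%C).
  (* moving from the minimum in the direction [-h] decreases the distance to [y] *)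
  assert (L : 0 <= - (2 * Re (Cconj v * (d * h)))).
  { set (del := (eta - Cmod x) / (Cmod h + 1)).
    assert (Hh : 0 <= Cmod h) by apply Cmod_ge_0.
    apply (derive_nonneg_left_max (fun u => - Cmod (Q (z0 + x + RtoC u * h)%C - y) ^ 2) 0 _ del).
    - apply (is_derive_opp (fun u => Cmod (Q (z0 + x + RtoC u * h)%C - y) ^ 2)).
      pose proof (is_derive_Cmod2 (fun u => Q (z0 + x + RtoC u * h)%C - y)%C 0 (d * h)) as D.
      cbv beta in D. replace (z0 + x + 0 * h)%C with (z0 + x)%C in D by ring. fold v in D. apply D.
      apply (cder_along (fun z => Q z - y)%C (z0 + x) h 0).
      replace (z0 + x + 0 * h)%C with (z0 + x)%C by ring.
      eapply cder_eq; [apply cder_minus; [apply (pser_cder 1 Q c _ HQ), Hin; lra | apply cder_const]|].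
      fold d. ring.
    - apply Rdiv_lt_0_compat; lra.
    - intros u Hu. apply Ropp_le_contravar.
      replace (z0 + x + 0 * h)%C with (z0 + (x + 0))%C by ring.
      replace (z0 + x + u * h)%C with (z0 + (x + u * h))%C by ring.
      apply pow_incr; split; [apply Cmod_ge_0|]. replace (x + 0)%C with x by ring. apply Hmin.
      eapply Rle_trans; [apply Cmod_triangle|]. rewrite Cmod_mult, Cmod_R, Rabs_left by lra.
      assert (- u * (Cmod h + 1) < eta - Cmod x) by (apply Rlt_div_r; [lra | unfold del in Hu; lra]).
      nra. }
  replace (Cconj v * (d * h))%C with (RtoC (Cmod v ^ 2 * Cmod d ^ 2)) in L.
  - change (Re (RtoC (Cmod v ^ 2 * Cmod d ^ 2))) with (Cmod v ^ 2 * Cmod d ^ 2) in L.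
    apply Cmod_gt_0 in Hv, Hd. assert (0 < Cmod v ^ 2 * Cmod d ^ 2) by (apply Rmult_lt_0_compat; apply pow_lt; assumption). lra.
  - rewrite RtoC_mult, !Cmod2_conj. unfold h. ring.
Qed.

(** The lift [w] is given pointwise. It is continuous because local surjectivity finds a preimage
    near w z and injectivity identifies it; the derivative is then that of a local inverse. *)
Lemma hol_lift Q c q a w R : conformal Q c -> pser 1 q a -> R <= 1 ->
  (forall z, Cmod z < R -> Cmod (w z) < 1 /\ Q (w z) = q z) ->
  hol R w (fun z => PS (dseq a) z / PS (dseq c) (w z))%C.
Proof.
  intros HC Hq HR Hw. pose proof HC as [HQ [Qinj HQ']].
  assert (Cw : forall z, Cmod z < R -> ccont w z).
  { intros z Hz eps He. destruct (Hw z Hz) as [Hw1 Hw2].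
    set (eta := Rmin eps ((1 - Cmod (w z)) / 2)).
    assert (Heta : 0 < eta /\ eta <= eps /\ Cmod (w z) + eta < 1).
    { unfold eta. pose proof (Rmin_l eps ((1 - Cmod (w z)) / 2)).
      pose proof (Rmin_r eps ((1 - Cmod (w z)) / 2)). split; [apply Rmin_pos; lra | lra]. }
    destruct (local_surjectivity Q c (w z) eta HC ltac:(lra) ltac:(lra)) as [e [He0 Hs]].
    destruct (pser_ccont 1 q a z Hq ltac:(lra) e He0) as [d [Hd Hc]].
    exists (Rmin d (R - Cmod z)); split; [apply Rmin_pos; lra|]. intros x Hx.
    assert (Hx1 := Rlt_le_trans _ _ _ Hx (Rmin_l _ _)).
    assert (Hx2 := Rlt_le_trans _ _ _ Hx (Rmin_r _ _)).
    assert (HxR : Cmod x < R) by (pose proof (Cmod_triangle_rev x z); lra).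
    destruct (Hw x HxR) as [Hwx1 Hwx2].
    destruct (Hs (q x)) as [y [Hy1 Hy2]]; [rewrite Hw2; now apply Hc|].
    assert (E : w x = y).
    { apply Qinj; [exact Hwx1 | | congruence].
      pose proof (Cmod_triangle_rev y (w z)). lra. }
    rewrite E. lra. }
  intros z Hz. destruct (Hw z Hz) as [Hw1 Hw2].
  assert (Hz1 : Cmod z < 1) by lra.
  split.
  - apply (cder_local_inverse Q w); [now apply (pser_cder 1) | now apply HQ' | now apply Cw |].
    apply (cder_ext_loc q _ _ _ (R - Cmod z)); [lra | | now apply (pser_cder 1)].
    intros x Hx. symmetry. apply Hw. pose proof (Cmod_triangle_rev x z). lra.
  - apply ccont_mult.
    + apply (pser_hol 1 q a Hq z Hz1).
    + apply (ccont_comp Cinv (fun x => PS (dseq c) (w x))); [apply ccont_inv; now apply HQ'|].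
      apply (ccont_comp (PS (dseq c)) w); [|now apply Cw].
      apply (pser_hol 1 Q c HQ (w z) Hw1).
Qed.

(* Miller-Mocanu: by Jack's lemma, [q] can leave [Q(D)] only if [z q'(z) = m w Q'(w)]
   with [q z = Q w], [m >= 1] and [|w|] close to one. *)
Lemma lift_on_disc Q c q a r1 rho1 : conformal Q c -> pser 1 q a -> q 0%C = Q 0%C ->
  0 <= r1 < 1 -> 0 <= rho1 < 1 ->
  (forall z w m, Cmod z <= r1 -> rho1 < Cmod w < 1 -> q z = Q w -> 1 <= m ->
     (z * PS (dseq a) z)%C <> (RtoC m * (w * PS (dseq c) w))%C) ->
  forall z, Cmod z <= r1 -> exists w, Cmod w <= rho1 /\ q z = Q w.
Proof.
  intros HC Hq H0 Hr1 Hrho Hobs. pose proof HC as [HQ [Qinj HQ']].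
  set (Good := fun r => forall z, Cmod z <= r -> exists w, Cmod w <= rho1 /\ q z = Q w).
  assert (G0 : Good 0).
  { intros z Hz. assert (E : z = 0%C) by (apply Cmod_eq_0; pose proof (Cmod_ge_0 z); lra).
    subst z. exists 0%C. rewrite Cmod_0. split; [lra | exact H0]. }
  destruct (completeness (fun r => 0 <= r <= r1 /\ Good r)) as [rs [Hs1 Hs2]].
  { exists r1. intros r [Hr _]; lra. }
  { exists 0. split; [lra | exact G0]. }
  assert (Hrs0 : 0 <= rs) by (apply Hs1; split; [lra | exact G0]).
  assert (Hrs1 : rs <= r1) by (apply Hs2; intros r [Hr _]; lra).
  assert (Gin : forall z, Cmod z < rs -> exists w, Cmod w <= rho1 /\ q z = Q w).
  { intros z Hz. apply NNPP; intros Hn. assert (rs <= Cmod z); [|lra].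
    apply Hs2. intros r [Hr HG]. apply Rnot_lt_le; intros Hlt. apply Hn, HG. lra. }
  (* Closedness: z is the limit of t z with t < 1, and the image of |w| <= rho1 has a nearest point
     to q z, necessarily at distance 0. *)
  assert (Gs : Good rs).
  { intros z Hz. destruct (Ceq_dec z 0) as [->|Hz0].
    { apply G0. rewrite Cmod_0; lra. }
    assert (Hzp : 0 < Cmod z) by now apply Cmod_gt_0.
    destruct (disc_min (fun w => Cmod (Q w - q z)) rho1 ltac:(lra)) as [w0 [Hw0 Hmin]].
    { intros w Hw. apply (ccontR_Cmod (fun w => Q w - q z)%C).
      apply ccont_plus; [apply (pser_ccont 1 Q c); auto; lra | apply ccont_const]. }
    exists w0; split; [exact Hw0|].
    destruct (Ceq_dec (Q w0 - q z) 0) as [E|E].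
    { replace (q z) with (Q w0 - (Q w0 - q z))%C by ring. rewrite E; ring. }
    exfalso. apply Cmod_gt_0 in E. destruct (pser_ccont 1 q a z Hq ltac:(lra) _ E) as [d [Hd Hc]].
    set (t := 1 - Rmin (1 / 2) (d / 2 / Cmod z)).
    assert (Ht : 1 / 2 <= t < 1 /\ (1 - t) * Cmod z < d).
    { assert (0 < d / 2 / Cmod z) by (repeat apply Rdiv_lt_0_compat; lra).
      unfold t. pose proof (Rmin_l (1 / 2) (d / 2 / Cmod z)) as A1.
      pose proof (Rmin_r (1 / 2) (d / 2 / Cmod z)) as A2.
      assert (0 < Rmin (1 / 2) (d / 2 / Cmod z)) by (apply Rmin_pos; lra).
      split; [lra|].
      replace (1 - (1 - Rmin (1 / 2) (d / 2 / Cmod z))) with (Rmin (1 / 2) (d / 2 / Cmod z)) by ring.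
      apply Rle_lt_trans with (d / 2 / Cmod z * Cmod z); [apply Rmult_le_compat_r; lra|].
      unfold Rdiv. rewrite Rmult_assoc, Rinv_l; lra. }
    assert (Hdist : Cmod (t * z - z) < d).
    { replace (t * z - z)%C with (RtoC (t - 1) * z)%C by (rewrite RtoC_minus; ring).
      rewrite Cmod_mult, Cmod_R, Rabs_left by lra. lra. }
    specialize (Hc _ Hdist).
    destruct (Gin (t * z)%C) as [w [Hw1 Hw2]].
    { rewrite Cmod_mult, Cmod_R, Rabs_pos_eq by lra. nra. }
    specialize (Hmin w Hw1). rewrite Hw2 in Hc. lra. }
  destruct (Req_dec rs r1) as [->|Hne]; [exact Gs|exfalso].
  (* Openness is first obtained with |w| < 1 only; the bound [rho1] on the larger disc comes back
     from the obstruction. *)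
  set (P := fun z => exists w, Cmod w < 1 /\ q z = Q w).
  destruct (disc_neighborhood P rs Hrs0) as [d [Hd HP]].
  { intros z Hz. destruct (Gs z Hz) as [w [Hw1 Hw2]].
    destruct (local_surjectivity Q c w ((1 - Cmod w) / 2) HC ltac:(lra) ltac:(lra)) as [e [He Hs]].
    destruct (pser_ccont 1 q a z Hq ltac:(lra) e He) as [d [Hd Hc]].
    exists d; split; [exact Hd|]. intros x Hx. destruct (Hs (q x)) as [y [Hy1 Hy2]].
    - rewrite <- Hw2. now apply Hc.
    - exists y; split; [|now symmetry]. pose proof (Cmod_triangle_rev y w). lra. }
  set (r := Rmin (rs + d / 2) r1).
  assert (Hr : rs < r /\ r <= r1 /\ r < rs + d).
  { unfold r. pose proof (Rmin_l (rs + d / 2) r1). pose proof (Rmin_r (rs + d / 2) r1).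
    split; [apply Rmin_glb_lt; lra | lra]. }
  set (R := Rmin (rs + d) 1).
  assert (HR : r < R /\ R <= 1 /\ R <= rs + d).
  { unfold R. pose proof (Rmin_l (rs + d) 1). pose proof (Rmin_r (rs + d) 1).
    split; [apply Rmin_glb_lt; lra | lra]. }
  assert (Hex : forall z, exists w, Cmod z < R -> Cmod w < 1 /\ Q w = q z).
  { intros z. destruct (Rlt_or_le (Cmod z) R) as [Hz|Hz].
    - destruct (HP z ltac:(lra)) as [w [H1 H2]]. exists w; auto.
    - exists 0%C. intros; lra. }
  set (w := fun z => proj1_sig (constructive_indefinite_description _ (Hex z))).
  assert (Hw : forall z, Cmod z < R -> Cmod (w z) < 1 /\ Q (w z) = q z).
  { intros z. exact (proj2_sig (constructive_indefinite_description _ (Hex z))). }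
  clearbody w.
  pose proof (hol_lift Q c q a w R HC Hq ltac:(lra) Hw) as Hol.
  destruct (hol_pser R w _ ltac:(lra) Hol) as [b Hb].
  assert (Hb0 : b O = 0%C).
  { rewrite <- (pser_0 R w b ltac:(lra) Hb). destruct (Hw 0%C) as [H1 H2]; [rewrite Cmod_0; lra|].
    apply Qinj; [exact H1 | rewrite Cmod_0; lra | congruence]. }
  set (g := PS (fun n => b (S n))).
  assert (Hg : pser R g (fun n => b (S n))) by (apply (pser_shift R w b); [lra | exact Hb]).
  assert (Hwg : forall z, Cmod z < R -> w z = (z * g z)%C).
  { intros z Hz. rewrite (pser_factor R w b z Hb Hz), Hb0. fold g. ring. }
  destruct (disc_max (fun z => Cmod (w z)) r ltac:(lra)) as [z0 [Hz0 Hmax]].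
  { intros z Hz. apply ccontR_Cmod, (pser_ccont R w b); [exact Hb | lra]. }
  (* If the maximum of |w| is at most rho1, the radius [rs] was not maximal; otherwise Jack's lemma
     at the maximum produces the forbidden relation. *)
  destruct (Rle_or_lt (Cmod (w z0)) rho1) as [Hle|Hlt].
  - assert (r <= rs); [|lra]. apply Hs1. split; [lra|]. intros z Hz. exists (w z).
    destruct (Hw z ltac:(lra)) as [_ E]. specialize (Hmax z Hz). split; [lra | now symmetry].
  - assert (Hwz0 := Hwg z0 ltac:(lra)).
    assert (Hz00 : z0 <> 0%C).
    { intros E. rewrite Hwz0, E in Hlt. replace (0 * g 0%C)%C with (RtoC 0) in Hlt by ring.
      rewrite Cmod_0 in Hlt. lra. }
    assert (Hzp : 0 < Cmod z0) by now apply Cmod_gt_0.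
    assert (Hg0 : g z0 <> 0%C).
    { intros E. rewrite Hwz0, E in Hlt. replace (z0 * 0)%C with (RtoC 0) in Hlt by ring.
      rewrite Cmod_0 in Hlt. lra. }
    destruct (Jack R g _ z0 Hg ltac:(lra) Hz00 Hg0) as [m [Hm Em]].
    { intros z Hz. apply Rmult_le_reg_l with (Cmod z0); [exact Hzp|].
      rewrite <- Hz at 1. rewrite <- !Cmod_mult, <- !Hwg by lra. apply Hmax. lra. }
    destruct (Hw z0 ltac:(lra)) as [Hw1 Hw2].
    apply (Hobs z0 (w z0) m ltac:(lra) (conj Hlt Hw1) (eq_sym Hw2) Hm).
    assert (Ew' : (PS (dseq a) z0 / PS (dseq c) (w z0))%C
                  = (g z0 + z0 * PS (dseq (fun n => b (S n))) z0)%C).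
    { eapply cder_unique; [apply (Hol z0); lra|].
      apply (cder_ext_loc (fun z => z * g z)%C _ _ _ (R - Cmod z0)); [lra | |].
      - intros x Hx. symmetry; apply Hwg. pose proof (Cmod_triangle_rev x z0). lra.
      - eapply cder_eq; [apply cder_mult; [apply cder_id | apply (pser_cder R g _ z0 Hg); lra]|]. cbv beta. ring. }
    rewrite <- Ew', <- Hwz0 in Em.
    transitivity (z0 * (PS (dseq a) z0 / PS (dseq c) (w z0)) * PS (dseq c) (w z0))%C.
    + field. now apply HQ'.
    + rewrite Em. ring.
Qed.

(** The radius [rho1] may depend on [r1], as no margin is uniform up to |z| = 1. Preimages are
    chosen point by point, and injectivity of Q makes them one holomorphic function. *)
Theorem Miller_Mocanu Q c q a : conformal Q c -> pser 1 q a -> q 0%C = Q 0%C ->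
  (forall r1, 0 <= r1 < 1 -> exists rho1, 0 <= rho1 < 1 /\
    forall z w m, Cmod z <= r1 -> rho1 < Cmod w < 1 -> q z = Q w -> 1 <= m ->
     (z * PS (dseq a) z)%C <> (RtoC m * (w * PS (dseq c) w))%C) ->
  exists g b, pser 1 g b /\ (forall z, Cmod z < 1 -> Cmod (g z) <= 1) /\
    forall z, Cmod z < 1 -> q z = Q (z * g z)%C.
Proof.
  intros HC Hq H0 Hobs. pose proof HC as [HQ [Qinj HQ']].
  assert (Hex : forall z, exists w, Cmod z < 1 -> Cmod w < 1 /\ Q w = q z).
  { intros z. destruct (Rlt_or_le (Cmod z) 1) as [Hz|Hz].
    - pose proof (Cmod_ge_0 z). destruct (Hobs (Cmod z)) as [rho1 [Hrho Ho]]; [lra|].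
      destruct (lift_on_disc Q c q a (Cmod z) rho1 HC Hq H0 ltac:(lra) Hrho Ho z (Rle_refl _)) as [w [H1 H2]].
      exists w. intros _. split; [lra | now symmetry].
    - exists 0%C. intros; lra. }
  set (w := fun z => proj1_sig (constructive_indefinite_description _ (Hex z))).
  assert (Hw : forall z, Cmod z < 1 -> Cmod (w z) < 1 /\ Q (w z) = q z).
  { intros z. exact (proj2_sig (constructive_indefinite_description _ (Hex z))). }
  clearbody w.
  destruct (hol_pser 1 w _ ltac:(lra) (hol_lift Q c q a w 1 HC Hq ltac:(lra) Hw)) as [b Hb].
  assert (Hb0 : b O = 0%C).
  { rewrite <- (pser_0 1 w b ltac:(lra) Hb). destruct (Hw 0%C) as [H1 H2]; [rewrite Cmod_0; lra|].
    apply Qinj; [exact H1 | rewrite Cmod_0; lra | congruence]. }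
  set (g := PS (fun n => b (S n))).
  assert (Hg : pser 1 g (fun n => b (S n))) by (apply (pser_shift 1 w b); [lra | exact Hb]).
  assert (Hwg : forall z, Cmod z < 1 -> w z = (z * g z)%C).
  { intros z Hz. rewrite (pser_factor 1 w b z Hb Hz), Hb0. fold g. ring. }
  exists g, (fun n => b (S n)). split; [exact Hg|]. split.
  (* Schwarz's lemma: if |g z| = G > 1, then on a circle of radius rho >= 2/(1 + G) the bound |w| <
     1 gives |g| <= (1 + G)/2, which is less than G. *)
  - intros z Hz. apply Rnot_lt_le; intros Hlt.
    set (G := Cmod (g z)) in *.
    set (rho := Rmax (Cmod z) (2 / (1 + G))).
    assert (H2 : 2 / (1 + G) < 1) by (apply Rlt_div_l; lra).
    assert (H2p : 0 < 2 / (1 + G)) by (apply Rdiv_lt_0_compat; lra).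
    assert (Hrho : Cmod z <= rho < 1 /\ 2 / (1 + G) <= rho).
    { unfold rho. pose proof (Rmax_l (Cmod z) (2 / (1 + G))). pose proof (Rmax_r (Cmod z) (2 / (1 + G))).
      assert (Rmax (Cmod z) (2 / (1 + G)) < 1) by (apply Rmax_lub_lt; lra). lra. }
    assert (B : Cmod (g z) <= (1 + G) / 2).
    { apply (max_principle 1 g _ rho _ Hg ltac:(lra)); [|lra].
      intros x Hx. destruct (Hw x ltac:(lra)) as [Hx1 _]. rewrite Hwg, Cmod_mult, Hx in Hx1 by lra.
      assert (E : 2 / (1 + G) * ((1 + G) / 2) = 1) by (field; lra).
      apply Rmult_le_reg_l with rho; [lra|].
      assert (2 / (1 + G) * ((1 + G) / 2) <= rho * ((1 + G) / 2)) by (apply Rmult_le_compat_r; lra). lra. }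
    fold G in B. lra.
  - intros z Hz. rewrite <- Hwg by exact Hz. symmetry. now apply Hw.
Qed.

(** * Exponential, logarithm and powers *)

Lemma Cmod_Cexp z : Cmod (Cexp z) = exp (Re z).
Proof.
  unfold Cexp, Cmod; simpl fst; simpl snd. pose proof (exp_pos (Re z)).
  replace ((exp (Re z) * cos (Im z)) ^ 2 + (exp (Re z) * sin (Im z)) ^ 2) with (Rsqr (exp (Re z))).
  - apply sqrt_Rsqr; lra.
  - pose proof (sin2_cos2 (Im z)) as T. unfold Rsqr in *. nra.
Qed.

Lemma Cexp_neq_0 z : Cexp z <> 0%C.
Proof. apply Cmod_gt_0. rewrite Cmod_Cexp. apply exp_pos. Qed.

Lemma Cexp_plus z w : Cexp (z + w) = (Cexp z * Cexp w)%C.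
Proof.
  unfold Cexp. change (Re (z + w)) with (Re z + Re w). change (Im (z + w)) with (Im z + Im w).
  rewrite exp_plus, cos_plus, sin_plus. unfold Cmult; simpl. f_equal; ring.
Qed.

Lemma Cexp_0 : Cexp 0 = 1%C.
Proof. unfold Cexp; simpl. rewrite exp_0, cos_0, sin_0. unfold RtoC. f_equal; ring. Qed.

Lemma Cexp_opp z : Cexp (- z) = (/ Cexp z)%C.
Proof.
  assert (E : (Cexp z * Cexp (- z) = 1)%C).
  { rewrite <- Cexp_plus. replace (z + - z)%C with (RtoC 0) by ring. apply Cexp_0. }
  pose proof (Cexp_neq_0 z). transitivity (Cexp z * Cexp (- z) / Cexp z)%C; [field; auto|].
  rewrite E. field; auto.
Qed.

Lemma rder_Cexp_line h t : rder (fun u => Cexp (RtoC u * h)) t (h * Cexp (RtoC t * h)).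
Proof.
  destruct h as [a b].
  split; unfold Cexp, Re, Im; simpl; auto_derive; trivial;
    unfold Rminus; ring.
Qed.

(** The mean value inequality along the ray from 0 to h is used twice: for e^h - 1, and then for e^h
    - 1 - h. *)
Lemma cder_Cexp z : cder Cexp z (Cexp z).
Proof.
  assert (B : forall h, Cmod h <= 1 -> Cmod (Cexp h - 1) <= Cmod h * exp 1).
  { intros h Hh.
    pose proof (Cmod_diff_le_rder (fun u => Cexp (RtoC u * h)) (fun u => h * Cexp (RtoC u * h))%C
                  (fun u => u * (Cmod h * exp 1)) (fun _ => Cmod h * exp 1)) as D.
    cbv beta in D. replace (1 * h)%C with h in D by ring. replace (0 * h)%C with (RtoC 0) in D by ring.
    rewrite Cexp_0 in D. replace (Cmod h * exp 1) with (1 * (Cmod h * exp 1) - 0 * (Cmod h * exp 1)) by ring.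
    apply D.
    - intros t _. apply rder_Cexp_line.
    - intros t _. auto_derive; trivial; ring.
    - intros t Ht. rewrite Cmod_mult, Cmod_Cexp. apply Rmult_le_compat_l; [apply Cmod_ge_0|].
      assert (Hle : Re (t * h) <= 1).
      { eapply Rle_trans; [apply Re_le_Cmod'|]. rewrite Cmod_mult, Cmod_R, Rabs_pos_eq by lra.
        pose proof (Cmod_ge_0 h); nra. }
      destruct Hle as [L|E]; [apply Rlt_le, exp_increasing, L | rewrite E; apply Rle_refl]. }
  assert (B2 : forall h, Cmod h <= 1 -> Cmod (Cexp h - 1 - h) <= Cmod h * (Cmod h * exp 1)).
  { intros h Hh.
    pose proof (Cmod_diff_le_rder (fun u => Cexp (RtoC u * h) + - RtoC u * h)%C
                  (fun u => h * Cexp (RtoC u * h) + - h)%C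
                  (fun u => u * (Cmod h * (Cmod h * exp 1))) (fun _ => Cmod h * (Cmod h * exp 1))) as D.
    cbv beta in D. replace (Cexp h - 1 - h)%C with (Cexp (1 * h) + - RtoC 1 * h - (Cexp (0 * h) + - RtoC 0 * h))%C.
    2:{ replace (1 * h)%C with h by ring. replace (0 * h)%C with (RtoC 0) by ring. rewrite Cexp_0. ring. }
    replace (Cmod h * (Cmod h * exp 1))
      with (1 * (Cmod h * (Cmod h * exp 1)) - 0 * (Cmod h * (Cmod h * exp 1))) by ring.
    apply D.
    - intros t _. destruct (rder_Cexp_line h t) as [R1 R2].
      split.
      + apply (is_derive_plus (fun u => Re (Cexp (RtoC u * h))) (fun u => Re (- RtoC u * h))); [exact R1|].
        unfold Re; simpl; auto_derive; trivial; ring.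
      + apply (is_derive_plus (fun u => Im (Cexp (RtoC u * h))) (fun u => Im (- RtoC u * h))); [exact R2|].
        unfold Im; simpl; auto_derive; trivial; ring.
    - intros t _. auto_derive; trivial; ring.
    - intros t Ht. replace (h * Cexp (t * h) + - h)%C with (h * (Cexp (t * h) - 1))%C by ring.
      rewrite Cmod_mult. apply Rmult_le_compat_l; [apply Cmod_ge_0|].
      assert (Cmod (t * h) <= Cmod h).
      { rewrite Cmod_mult, Cmod_R, Rabs_pos_eq by lra. pose proof (Cmod_ge_0 h); nra. }
      eapply Rle_trans; [apply B; lra|]. apply Rmult_le_compat_r; [apply Rlt_le, exp_pos | assumption]. }
  intros eps He. pose proof (exp_pos (Re z)). pose proof (exp_pos 1).
  exists (Rmin 1 (eps / (exp (Re z) * exp 1))); split.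
  { apply Rmin_pos; [lra|]. apply Rdiv_lt_0_compat; [lra|]. apply Rmult_lt_0_compat; lra. }
  intros w Hw. assert (H1 := Rlt_le_trans _ _ _ Hw (Rmin_l _ _)).
  assert (H2 := Rlt_le_trans _ _ _ Hw (Rmin_r _ _)).
  apply Rlt_div_r in H2; [|apply Rmult_lt_0_compat; lra].
  replace w with (z + (w - z))%C at 1 by ring. rewrite Cexp_plus.
  replace (Cexp z * Cexp (w - z) - Cexp z - Cexp z * (w - z))%C
    with (Cexp z * (Cexp (w - z) - 1 - (w - z)))%C by ring.
  rewrite Cmod_mult, Cmod_Cexp. specialize (B2 (w - z)%C ltac:(lra)).
  pose proof (Cmod_ge_0 (w - z)).
  apply Rle_trans with (exp (Re z) * (Cmod (w - z) * (Cmod (w - z) * exp 1))).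
  - apply Rmult_le_compat_l; lra.
  - replace (exp (Re z) * (Cmod (w - z) * (Cmod (w - z) * exp 1)))
      with (Cmod (w - z) * (exp (Re z) * exp 1) * Cmod (w - z)) by ring.
    apply Rmult_le_compat_r; lra.
Qed.

(** All logarithms below are taken in the right half-plane, which contains 1 - z for |z| < 1; there
    the principal argument is an arctangent. *)
Lemma Clog_right z : 0 < Re z -> Clog z = (ln (Cmod z), atan (Im z / Re z)).
Proof. intros H. unfold Clog, Arg. destruct (Rlt_dec 0 (Re z)); [reflexivity | lra]. Qed.

Lemma Re_pos_Cmod z : 0 < Re z -> 0 < Cmod z.
Proof. intros H. pose proof (Re_le_Cmod' z). lra. Qed.

Lemma Re_pos_neq_0 z : 0 < Re z -> z <> 0%C.
Proof. intros H. apply Cmod_gt_0. now apply Re_pos_Cmod. Qed.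

Lemma Cexp_Clog z : 0 < Re z -> Cexp (Clog z) = z.
Proof.
  intros H. rewrite Clog_right by exact H. unfold Cexp; simpl.
  rewrite exp_ln by now apply Re_pos_Cmod.
  set (th := atan (Im z / Re z)).
  assert (Hc : 0 < cos th) by (pose proof (atan_bound (Im z / Re z)); apply cos_gt_0; unfold th; lra).
  assert (Hs : sin th * Re z = cos th * Im z).
  { assert (E : tan th = Im z / Re z) by apply tan_atan. unfold tan in E.
    apply (f_equal (fun x => x * (cos th * Re z))) in E.
    replace (sin th / cos th * (cos th * Re z)) with (sin th * Re z) in E by (field; lra).
    replace (Im z / Re z * (cos th * Re z)) with (cos th * Im z) in E by (field; lra). exact E. }
  assert (HM : Cmod z * cos th = Re z).
  { apply Rsqr_inj; [apply Rmult_le_pos; [apply Cmod_ge_0 | lra] | lra |].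
    unfold Rsqr. pose proof (sin2_cos2 th) as T. unfold Rsqr in T.
    pose proof (Cmod2_alt z) as M. simpl in M.
    replace (Cmod z * cos th * (Cmod z * cos th)) with ((Cmod z * (Cmod z * 1)) * (cos th * cos th)) by ring.
    rewrite M.
    replace ((Re z * (Re z * 1) + Im z * (Im z * 1)) * (cos th * cos th))
      with (Re z * Re z * (cos th * cos th) + (cos th * Im z) * (cos th * Im z)) by ring.
    rewrite <- Hs.
    replace (Re z * Re z * (cos th * cos th) + sin th * Re z * (sin th * Re z))
      with (Re z * Re z * (sin th * sin th + cos th * cos th)) by ring.
    rewrite T; ring. }
  assert (HN : Cmod z * sin th = Im z).
  { apply Rmult_eq_reg_r with (Re z); [|lra].
    rewrite Rmult_assoc, Hs, <- Rmult_assoc, HM. ring. }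
  rewrite HM, HN. now destruct z.
Qed.

Lemma Im_Clog_bound z : 0 < Re z -> - PI / 2 < Im (Clog z) < PI / 2.
Proof. intros H. rewrite Clog_right by exact H. apply atan_bound. Qed.

Lemma Clog_1 : Clog 1 = 0%C.
Proof.
  rewrite Clog_right by (simpl; lra). rewrite Cmod_1, ln_1. unfold Re, Im; simpl.
  unfold Rdiv. now rewrite Rmult_0_l, atan_0.
Qed.

Lemma ccontR_comp (phi : R -> R) k z : continuity_pt phi (k z) -> ccontR k z -> ccontR (fun w => phi (k w)) z.
Proof.
  intros Hp Hk eps He.
  apply continuity_pt_filterlim in Hp.
  destruct (proj1 (filterlim_locally phi (phi (k z))) Hp (mkposreal _ He)) as [[d Hd] K].
  destruct (Hk d Hd) as [d' [Hd' K']]. exists d'; split; [exact Hd'|].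
  intros w Hw. apply K. exact (K' w Hw).
Qed.

Lemma ccont_Clog z : 0 < Re z -> ccont Clog z.
Proof.
  intros H.
  apply (ccont_ext_loc (fun w => (ln (Cmod w), atan (Im w / Re w))) _ _ (Re z)); [exact H| |].
  - intros w Hw. rewrite Clog_right; [reflexivity|].
    pose proof (re_le_Cmod (w - z)) as T. change (Re (w - z)) with (Re w - Re z) in T.
    assert (Rabs (Re w - Re z) < Re z) by lra. apply Rabs_def2 in H0. lra.
  - assert (C1 : ccontR (fun w => ln (Cmod w)) z).
    { apply (ccontR_comp ln Cmod); [|apply (ccontR_Cmod (fun w => w)), ccont_id].
      apply derivable_continuous_pt. exists (/ Cmod z). apply derivable_pt_lim_ln. now apply Re_pos_Cmod. }
    assert (C2 : ccontR (fun w => atan (Im w / Re w)) z).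
    { apply (ccontR_comp atan (fun w => Im w / Re w)).
      - apply derivable_continuous_pt, derivable_pt_atan.
      - assert (C3 : ccontR (fun w => Re (RtoC (Im w) * / RtoC (Re w))) z).
        { apply (ccontR_Re (fun w => RtoC (Im w) * / RtoC (Re w))%C).
          apply ccont_mult; [apply ccont_Im|]. apply (ccont_comp Cinv (fun w => RtoC (Re w))); [|apply ccont_Re].
          apply ccont_inv. intros E; apply RtoC_inj in E; lra. }
        intros eps He. destruct (C3 eps He) as [d [Hd K]]. exists (Rmin d (Re z)); split; [apply Rmin_pos; lra|].
        intros w Hw. specialize (K w (Rlt_le_trans _ _ _ Hw (Rmin_l _ _))).
        assert (Hwr : 0 < Re w).
        { pose proof (re_le_Cmod (w - z)) as T. change (Re (w - z)) with (Re w - Re z) in T.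
          pose proof (Rmin_r d (Re z)). assert (T2 : Rabs (Re w - Re z) < Re z) by lra.
          apply Rabs_def2 in T2. lra. }
        rewrite <- !RtoC_inv, <- !RtoC_mult in K by lra. exact K. }
    intros eps He. destruct (C1 (eps / 2)) as [d1 [Hd1 K1]]; [lra|].
    destruct (C2 (eps / 2)) as [d2 [Hd2 K2]]; [lra|].
    exists (Rmin d1 d2); split; [apply Rmin_pos; lra|]. intros w Hw.
    specialize (K1 w (Rlt_le_trans _ _ _ Hw (Rmin_l _ _))).
    specialize (K2 w (Rlt_le_trans _ _ _ Hw (Rmin_r _ _))).
    eapply Rle_lt_trans; [apply Cmod_le_Re_Im|]. unfold Re at 1, Im at 1; simpl.
    unfold Rminus in *. lra.
Qed.

Lemma cder_Clog z : 0 < Re z -> cder Clog z (/ z).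
Proof.
  intros H. replace (/ z)%C with (1 / Cexp (Clog z))%C.
  - apply (cder_local_inverse Cexp Clog); [apply cder_Cexp | apply Cexp_neq_0 | now apply ccont_Clog |].
    apply (cder_ext_loc (fun w => w) _ _ _ (Re z)); [exact H | | apply cder_id].
    intros w Hw. symmetry; apply Cexp_Clog.
    pose proof (re_le_Cmod (w - z)) as T. change (Re (w - z)) with (Re w - Re z) in T.
    assert (T2 : Rabs (Re w - Re z) < Re z) by lra. apply Rabs_def2 in T2. lra.
  - rewrite Cexp_Clog by exact H. field. now apply Re_pos_neq_0.
Qed.

Lemma Cpower_plus z a b : Cpower z (a + b) = (Cpower z a * Cpower z b)%C.
Proof. unfold Cpower. rewrite <- Cexp_plus. f_equal. ring. Qed.

Lemma Cpower_1 z : 0 < Re z -> Cpower z 1 = z.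
Proof. intros H. unfold Cpower. rewrite <- (Cexp_Clog z H) at 2. f_equal. ring. Qed.

Lemma Cpower_succ z a b : 0 < Re z -> b = (a + 1)%C -> (z * Cpower z a)%C = Cpower z b.
Proof. intros H ->. rewrite Cpower_plus, Cpower_1 by exact H. ring. Qed.

Lemma Cpower_0 z : Cpower z 0 = 1%C.
Proof. unfold Cpower. rewrite <- Cexp_0. f_equal. ring. Qed.

Lemma Cpower_neq_0 z a : Cpower z a <> 0%C.
Proof. apply Cexp_neq_0. Qed.

Lemma Cpower_one a : Cpower 1 a = 1%C.
Proof. unfold Cpower. rewrite Clog_1, <- Cexp_0. f_equal. ring. Qed.

Lemma cder_Cpower z a : 0 < Re z -> cder (fun w => Cpower w a) z (a * Cpower z (a - 1)).
Proof.
  intros H.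
  replace (a * Cpower z (a - 1))%C with (Cpower z a * (a * / z))%C.
  - apply (cder_comp Cexp (fun w => a * Clog w)%C); [apply cder_Cexp|].
    now apply cder_scal, cder_Clog.
  - replace a with (a - 1 + 1)%C at 1 by ring. rewrite Cpower_plus, Cpower_1 by exact H.
    field. now apply Re_pos_neq_0.
Qed.

Lemma Re_one_minus_pos z : Cmod z < 1 -> 0 < Re (1 - z).
Proof. intros H. pose proof (Re_le_Cmod' z). change (Re (1 - z)) with (1 - Re z). lra. Qed.

Lemma cder_one_minus z : cder (fun w => 1 - w)%C z (-1).
Proof. eapply cder_eq; [apply cder_minus; [apply cder_const | apply cder_id] | ring]. Qed.

Lemma cder_Cpower_one_minus z a : Cmod z < 1 ->
  cder (fun w => Cpower (1 - w) a) z (- a * Cpower (1 - z) (a - 1)).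
Proof.
  intros H. eapply cder_eq.
  - apply (cder_comp (fun w => Cpower w a) (fun w => 1 - w)%C); [|apply cder_one_minus].
    apply cder_Cpower. now apply Re_one_minus_pos.
  - ring.
Qed.

Lemma Cexp_inj_strip u v : - PI / 2 < Im u < PI / 2 -> - PI / 2 < Im v < PI / 2 ->
  Cexp u = Cexp v -> u = v.
Proof.
  intros Hu Hv E.
  assert (HR : Re u = Re v).
  { apply exp_inv. rewrite <- !Cmod_Cexp. now rewrite E. }
  apply C_ext; [exact HR|].
  assert (E' : exp (Re u) * sin (Im u) = exp (Re v) * sin (Im v)) by exact (f_equal Im E).
  rewrite HR in E'. apply Rmult_eq_reg_l in E'; [|pose proof (exp_pos (Re v)); lra].
  rewrite <- (asin_sin (Im u)), <- (asin_sin (Im v)) by lra. now rewrite E'.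
Qed.

(** * The reciprocal of the extremal function *)

(* Taylor coefficients of [(1 - (1 - z)^a) / (a z)], with [a = 1 - 2 alpha]. *)
Fixpoint Tcoef (a : R) (n : nat) : R :=
  match n with O => 1 | S m => Tcoef a m * ((INR m + 1 - a) / (INR m + 2)) end.

(** These are the differences T_n - T_(n+1), so their sums telescope. *)
Definition bcoef (a : R) (n : nat) : R := Tcoef a n * ((1 + a) / (INR n + 2)).

(* [Qfun a] is [K / (z K')], the reciprocal of [G]. *)
Definition Qcoef (a : R) (n : nat) : C :=
  match n with O => 1%C | S m => RtoC (- bcoef a m) end.

Definition Qfun (a : R) : C -> C := PS (Qcoef a).

Definition Vcoef (a : R) (n : nat) : C := match n with O => 0%C | S m => RtoC (Tcoef a m) end.

(** The function (1 - (1 - z)^a)/a, or -log(1 - z) when a = 0; the series avoids the division by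
    a. *)
Definition Vfun (a : R) : C -> C := PS (Vcoef a).

Lemma Tcoef_S a n : Tcoef a (S n) = Tcoef a n - bcoef a n.
Proof. unfold bcoef. simpl. pose proof (pos_INR n). field. lra. Qed.

Lemma Tcoef_nonneg a n : a <= 1 -> 0 <= Tcoef a n.
Proof.
  intros Ha. induction n; simpl; [lra|]. pose proof (pos_INR n).
  apply Rmult_le_pos; [exact IHn|]. apply Rdiv_le_0_compat; lra.
Qed.

Lemma bcoef_nonneg a n : -1 < a <= 1 -> 0 <= bcoef a n.
Proof.
  intros Ha. pose proof (pos_INR n). apply Rmult_le_pos; [apply Tcoef_nonneg; lra|].
  apply Rdiv_le_0_compat; lra.
Qed.

Lemma Tcoef_le_1 a n : -1 < a <= 1 -> Tcoef a n <= 1.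
Proof.
  intros Ha. induction n; [simpl; lra|]. rewrite Tcoef_S. pose proof (bcoef_nonneg a n Ha). lra.
Qed.

Lemma bcoef_le a n : -1 < a <= 1 -> bcoef a n <= (1 + a) / 2 * Tcoef a n.
Proof.
  intros Ha. pose proof (pos_INR n). unfold bcoef. rewrite Rmult_comm.
  apply Rmult_le_compat_r; [apply Tcoef_nonneg; lra|].
  apply Rmult_le_compat_l; [lra|]. apply Rinv_le_contravar; lra.
Qed.

Lemma cbd_of_bound (c : nat -> C) B : (forall n, Cmod (c n) <= B) -> cbd 1 c.
Proof.
  intros H rho Hr. exists B. intros n.
  pose proof (pow_le rho n (proj1 Hr)).
  assert (rho ^ n <= 1) by (rewrite <- (pow1 n); apply pow_incr; lra).
  pose proof (Cmod_ge_0 (c n)). specialize (H n). nra.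
Qed.

Lemma pser_Q a : -1 < a <= 1 -> pser 1 (Qfun a) (Qcoef a).
Proof.
  intros Ha. apply cbd_pser, (cbd_of_bound _ 1). intros [|n]; simpl.
  - rewrite Cmod_1; lra.
  - rewrite Cmod_R, Rabs_Ropp, Rabs_pos_eq by now apply bcoef_nonneg.
    pose proof (bcoef_le a n Ha). pose proof (Tcoef_le_1 a n Ha).
    pose proof (Tcoef_nonneg a n ltac:(lra)). nra.
Qed.

Lemma pser_V a : -1 < a <= 1 -> pser 1 (Vfun a) (Vcoef a).
Proof.
  intros Ha. apply cbd_pser, (cbd_of_bound _ 1). intros [|n]; simpl.
  - rewrite Cmod_0; lra.
  - rewrite Cmod_R, Rabs_pos_eq by (apply Tcoef_nonneg; lra). now apply Tcoef_le_1.
Qed.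

Lemma Qfun_0 a : -1 < a <= 1 -> Qfun a 0 = 1%C.
Proof. intros Ha. now rewrite (pser_0 1 _ _ ltac:(lra) (pser_Q a Ha)). Qed.

Lemma pser_eq r f g a b z : pser r f a -> pser r g b -> (forall n, a n = b n) -> Cmod z < r -> f z = g z.
Proof.
  intros Ha Hb E Hz. eapply is_cseries_unique; [apply Ha, Hz|].
  eapply is_cseries_ext; [|apply Hb, Hz]. intros n; cbv beta; now rewrite E.
Qed.

Lemma zQ_V a z : -1 < a <= 1 -> Cmod z < 1 -> (z * Qfun a z = (1 - z) * Vfun a z)%C.
Proof.
  intros Ha Hz.
  replace ((1 - z) * Vfun a z)%C with (Vfun a z + (-1) * (z * Vfun a z))%C by ring.
  refine (pser_eq 1 (fun z => z * Qfun a z)%C (fun z => Vfun a z + (-1) * (z * Vfun a z))%C _ _ z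
    (pser_mult_z _ _ _ (pser_Q a Ha))
    (pser_plus _ _ _ _ _ (pser_V a Ha) (pser_scal _ (-1) _ _ (pser_mult_z _ _ _ (pser_V a Ha)))) _ Hz).
  intros [|[|n]]; simpl; try ring.
  replace (- bcoef a n) with (Tcoef a (S n) - Tcoef a n) by (rewrite Tcoef_S; ring).
  simpl Tcoef. rewrite RtoC_minus. ring.
Qed.

Lemma INR_plus_2_neq_0 n : (RtoC (INR n) + 2)%C <> 0%C.
Proof. rewrite <- RtoC_plus. intros E; apply RtoC_inj in E. pose proof (pos_INR n). lra. Qed.

(** On coefficients this is the recurrence (n + 2) T_(n+1) = (n + 1 - a) T_n. *)
Lemma V_ode a z : -1 < a <= 1 -> Cmod z < 1 ->
  ((1 - z) * PS (dseq (Vcoef a)) z = 1 - a * Vfun a z)%C.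
Proof.
  intros Ha Hz. pose proof (pser_V a Ha) as HV. pose proof (pser_dseq 1 _ _ ltac:(lra) HV) as HV'.
  replace ((1 - z) * PS (dseq (Vcoef a)) z)%C
    with (PS (dseq (Vcoef a)) z + (-1) * (z * PS (dseq (Vcoef a)) z))%C by ring.
  replace (1 - a * Vfun a z)%C with (1 + (- a) * Vfun a z)%C by ring.
  refine (pser_eq 1 (fun z => PS (dseq (Vcoef a)) z + (-1) * (z * PS (dseq (Vcoef a)) z))%C
    (fun z => 1 + (- a) * Vfun a z)%C _ _ z
    (pser_plus _ _ _ _ _ HV' (pser_scal _ (-1) _ _ (pser_mult_z _ _ _ HV')))
    (pser_plus _ _ _ _ _ (pser_const 1 1) (pser_scal _ (- a) _ _ HV)) _ Hz).
  intros [|n].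
  - unfold dseq, Vcoef. simpl. ring.
  - unfold dseq, Vcoef. cbn [Tcoef].
    replace (RtoC (Tcoef a n * ((INR n + 1 - a) / (INR n + 2))))
      with (RtoC (Tcoef a n) * (RtoC (INR n) + 1 - RtoC a) / (RtoC (INR n) + 2))%C.
    + rewrite !S_INR, !RtoC_plus. field.
      exact (INR_plus_2_neq_0 n).
    + pose proof (pos_INR n). rewrite RtoC_mult, RtoC_div, RtoC_minus, !RtoC_plus by lra.
      field. exact (INR_plus_2_neq_0 n).
Qed.

(** This is 1 + z K''/K' for K' = (1 - z)^(-(1+a)); for a > -1 it maps the disc onto the half-plane
    of real part above (1 - a)/2 = alpha. *)
Definition hfun (a : R) (z : C) : C := ((1 + a * z) / (1 - z))%C.

Lemma one_minus_neq_0 z : Cmod z < 1 -> (1 - z)%C <> 0%C.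
Proof. intros H. apply Re_pos_neq_0. now apply Re_one_minus_pos. Qed.

(** The equation G + z G'/G = h rewritten for Q = 1/G; it comes from differentiating z Q = (1 - z)
    V. *)
Lemma zQ'_eq a z : -1 < a <= 1 -> Cmod z < 1 ->
  (z * PS (dseq (Qcoef a)) z = 1 - hfun a z * Qfun a z)%C.
Proof.
  intros Ha Hz. pose proof (one_minus_neq_0 z Hz) as Hn.
  assert (E : (Qfun a z + z * PS (dseq (Qcoef a)) z
             = - Vfun a z + (1 - z) * PS (dseq (Vcoef a)) z)%C).
  { apply (cder_unique (fun z => z * Qfun a z)%C z).
    - eapply cder_eq; [apply cder_mult; [apply cder_id | apply (pser_cder 1 _ _ z (pser_Q a Ha) Hz)]|].
      cbv beta. ring.
    - apply (cder_ext_loc (fun z => (1 - z) * Vfun a z)%C _ _ _ (1 - Cmod z)); [lra | |].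
      + intros w Hw. symmetry. apply zQ_V; [exact Ha|]. pose proof (Cmod_triangle_rev w z). lra.
      + eapply cder_eq; [apply cder_mult; [apply cder_one_minus | apply (pser_cder 1 _ _ z (pser_V a Ha) Hz)]|].
        cbv beta. ring. }
  rewrite V_ode in E by assumption.
  replace (z * PS (dseq (Qcoef a)) z)%C with (Qfun a z + z * PS (dseq (Qcoef a)) z - Qfun a z)%C by ring.
  rewrite E. unfold hfun.
  assert (EV : Vfun a z = (z * Qfun a z / (1 - z))%C).
  { rewrite zQ_V by assumption. field. exact Hn. }
  rewrite EV. field. exact Hn.
Qed.

(** Equivalently (z^2 Q')' = -(1 + a) z V'. Integrated along a ray from 0, it controls the argument
    of Q'. *)
Lemma Q_second_order a z : -1 < a <= 1 -> Cmod z < 1 ->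
  (2 * PS (dseq (Qcoef a)) z + z * PS (dseq (dseq (Qcoef a))) z
    = - (1 + a) * PS (dseq (Vcoef a)) z)%C.
Proof.
  intros Ha Hz. pose proof (pser_Q a Ha) as HQ. pose proof (pser_dseq 1 _ _ ltac:(lra) HQ) as HQ'.
  pose proof (pser_dseq 1 _ _ ltac:(lra) HQ') as HQ''.
  pose proof (pser_dseq 1 _ _ ltac:(lra) (pser_V a Ha)) as HV'.
  refine (pser_eq 1 (fun z => 2 * PS (dseq (Qcoef a)) z + z * PS (dseq (dseq (Qcoef a))) z)%C
    (fun z => - (1 + a) * PS (dseq (Vcoef a)) z)%C _ _ z
    (pser_plus _ _ _ _ _ (pser_scal _ 2 _ _ HQ') (pser_mult_z _ _ _ HQ''))
    (pser_scal _ (- (1 + a)) _ _ HV') _ Hz).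
  pose proof INR_plus_2_neq_0 as Hne.
  assert (Eb : forall n, (RtoC (- bcoef a n) = - (RtoC (Tcoef a n) * (1 + RtoC a) / (RtoC (INR n) + 2)))%C).
  { intros n. pose proof (pos_INR n). pose proof (Hne n). unfold bcoef.
    rewrite RtoC_opp, RtoC_mult, RtoC_div, !RtoC_plus by lra. field. exact H0. }
  intros [|n].
  - unfold dseq, Qcoef, Vcoef. rewrite Eb. simpl. field.
  - unfold dseq, Qcoef, Vcoef. rewrite Eb. rewrite !S_INR, !RtoC_plus.
    field. specialize (Hne (S n)). rewrite S_INR, RtoC_plus in Hne. exact Hne.
Qed.

(** Differentiating the equation for V shows that V' (1 - z)^(1-a) has zero derivative. *)
Lemma V'_power a z : -1 < a <= 1 -> Cmod z < 1 ->
  PS (dseq (Vcoef a)) z = Cpower (1 - z) (a - 1).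
Proof.
  intros Ha Hz. pose proof (pser_V a Ha) as HV.
  pose proof (pser_dseq 1 _ _ ltac:(lra) HV) as HV'. set (U := PS (dseq (Vcoef a))) in *.
  set (U' := PS (dseq (dseq (Vcoef a)))).
  assert (E : forall x, Cmod x < 1 -> ((1 - x) * U' x = (1 - a) * U x)%C).
  { intros x Hx.
    assert (D : (- U x + (1 - x) * U' x = - (a * U x))%C).
    { apply (cder_unique (fun z => (1 - z) * U z)%C x).
      - eapply cder_eq; [apply cder_mult; [apply cder_one_minus | apply (pser_cder 1 _ _ x HV' Hx)]|].
        cbv beta. fold U'. ring.
      - apply (cder_ext_loc (fun z => 1 - a * Vfun a z)%C _ _ _ (1 - Cmod x)); [lra | |].
        + intros w Hw. symmetry. apply V_ode; [exact Ha|]. pose proof (Cmod_triangle_rev w x). lra.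
        + eapply cder_eq; [apply cder_minus; [apply cder_const | apply cder_scal, (pser_cder 1 _ _ x HV Hx)]|].
          fold U. ring. }
    replace ((1 - x) * U' x)%C with (- U x + (1 - x) * U' x + U x)%C by ring. rewrite D. ring. }
  assert (C : (U z * Cpower (1 - z) (1 - a) = U 0 * Cpower (1 - 0) (1 - a))%C).
  { apply (cder_zero_const (fun z => U z * Cpower (1 - z) (1 - a))%C 1); [|exact Hz].
    intros x Hx. eexists. split; [apply cder_mult; [apply (pser_cder 1 _ _ x HV' Hx) | now apply cder_Cpower_one_minus]|].
    intros _. cbv beta. fold U'.
    replace (Cpower (1 - x) (1 - a)) with ((1 - x) * Cpower (1 - x) (1 - a - 1))%C.
    - transitivity (Cpower (1 - x) (1 - a - 1) * ((1 - x) * U' x - (1 - a) * U x))%C; [ring|].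
      rewrite E by exact Hx. ring.
    - apply Cpower_succ; [now apply Re_one_minus_pos | ring]. }
  replace (1 - 0)%C with (RtoC 1) in C by ring. rewrite Cpower_one in C.
  assert (U0 : U 0 = 1%C).
  { rewrite (pser_0 1 _ _ ltac:(lra) HV'). unfold dseq. simpl. ring. }
  rewrite U0 in C.
  assert (P : (Cpower (1 - z) (1 - a) * Cpower (1 - z) (a - 1) = 1)%C).
  { rewrite <- Cpower_plus. transitivity (Cpower (1 - z) 0); [f_equal; ring | apply Cpower_0]. }
  transitivity (U z * (Cpower (1 - z) (1 - a) * Cpower (1 - z) (a - 1)))%C; [rewrite P; ring|].
  rewrite Cmult_assoc, C. ring.
Qed.

Lemma aV_power a z : -1 < a <= 1 -> Cmod z < 1 -> (a * Vfun a z = 1 - Cpower (1 - z) a)%C.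
Proof.
  intros Ha Hz. pose proof (V_ode a z Ha Hz) as E. rewrite V'_power in E by assumption.
  assert (P : ((1 - z) * Cpower (1 - z) (a - 1) = Cpower (1 - z) a)%C).
  { apply Cpower_succ; [now apply Re_one_minus_pos | ring]. }
  rewrite P in E. rewrite E. ring.
Qed.

Lemma V_log z : Cmod z < 1 -> Vfun 0 z = (- Clog (1 - z))%C.
Proof.
  intros Hz. assert (Ha : -1 < 0 <= 1) by lra. pose proof (pser_V 0 Ha) as HV.
  assert (C : (Vfun 0 z + Clog (1 - z) = Vfun 0 0 + Clog (1 - 0))%C).
  { apply (cder_zero_const (fun z => Vfun 0 z + Clog (1 - z))%C 1); [|exact Hz].
    intros x Hx. pose proof (Re_one_minus_pos x Hx) as Hp. eexists. split.
    - apply cder_plus; [apply (pser_cder 1 _ _ x HV Hx)|].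
      apply (cder_comp Clog (fun z => 1 - z)%C); [now apply cder_Clog | apply cder_one_minus].
    - intros _. pose proof (V_ode 0 x Ha Hx) as E. pose proof (one_minus_neq_0 x Hx) as Hn.
      replace (PS (dseq (Vcoef 0)) x) with ((1 - x) * PS (dseq (Vcoef 0)) x / (1 - x))%C by (field; exact Hn).
      rewrite E. field. exact Hn. }
  replace (1 - 0)%C with (RtoC 1) in C by ring. rewrite Clog_1 in C.
  rewrite (pser_0 1 _ _ ltac:(lra) HV) in C. simpl in C.
  replace (Vfun 0 z) with (Vfun 0 z + Clog (1 - z) - Clog (1 - z))%C by ring. rewrite C. ring.
Qed.

Lemma sum_bcoef a n : sum_n (bcoef a) n = 1 - Tcoef a (S n).
Proof.
  induction n.
  - rewrite sum_O, Tcoef_S. simpl. ring.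
  - rewrite sum_Sn, IHn, (Tcoef_S a (S n)). unfold plus; simpl. ring.
Qed.

(* Were the limit of [T] positive, [sum b] would dominate a harmonic series. *)
Lemma Tcoef_small a eps : -1 < a <= 1 -> 0 < eps -> exists N, forall n, (N <= n)%nat -> Tcoef a n < eps.
Proof.
  intros Ha He. apply NNPP; intros Hn.
  assert (Dec : forall n k, Tcoef a (n + k) <= Tcoef a n).
  { intros n k; induction k; [rewrite Nat.add_0_r; lra|]. rewrite Nat.add_succ_r, Tcoef_S.
    pose proof (bcoef_nonneg a (n + k) Ha). lra. }
  assert (Low : forall n, eps <= Tcoef a n).
  { intros n. apply Rnot_lt_le; intros Hlt. apply Hn. exists n. intros m Hm.
    replace m with (n + (m - n))%nat by lia. pose proof (Dec n (m - n)%nat). lra. }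
  assert (B : forall n, eps * (1 + a) * sum_n (fun k => / (INR k + 2)) n <= 1).
  { intros n. apply Rle_trans with (sum_n (bcoef a) n).
    - rewrite <- (sum_n_mult_l (K := R_Ring)). apply sum_n_m_le. intros k. unfold mult; simpl.
      unfold bcoef, Rdiv. rewrite Rmult_assoc. apply Rmult_le_compat_r; [|apply Low].
      pose proof (pos_INR k). apply Rmult_le_pos; [lra|]. apply Rlt_le, Rinv_0_lt_compat. lra.
    - rewrite sum_bcoef. pose proof (Low (S n)). lra. }
  assert (L : forall n, ln (INR n + 3) - ln 2 <= sum_n (fun k => / (INR k + 2)) n).
  { assert (Step : forall x, 0 < x -> ln (x + 1) - ln x <= / x).
    { intros x Hx. replace (x + 1) with (x * (1 + / x)) by (field; lra).
      assert (0 < / x) by now apply Rinv_0_lt_compat.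
      rewrite ln_mult by lra. pose proof (exp_ineq1_le (/ x)).
      assert (ln (1 + / x) <= / x); [|lra].
      rewrite <- (ln_exp (/ x)) at 2. apply ln_le; lra. }
    induction n.
    - rewrite sum_O. simpl. replace (0 + 3) with (2 + 1) by ring. replace (0 + 2) with 2 by ring.
      pose proof (Step 2). lra.
    - rewrite sum_Sn.
      change (ln (INR (S n) + 3) - ln 2 <= sum_n (fun k => / (INR k + 2)) n + / (INR (S n) + 2)).
      rewrite S_INR. pose proof (pos_INR n). pose proof (Step (INR n + 3) ltac:(lra)).
      replace (INR n + 1 + 3) with (INR n + 3 + 1) by ring. replace (INR n + 1 + 2) with (INR n + 3) by ring. lra. }
  set (M := / (eps * (1 + a)) + ln 2).
  destruct (INR_unbounded (exp M)) as [n Hnn].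
  assert (M < ln (INR n + 3)).
  { rewrite <- (ln_exp M). apply ln_increasing; [apply exp_pos | lra]. }
  specialize (L n). specialize (B n).
  assert (0 < eps * (1 + a)) by (apply Rmult_lt_0_compat; lra).
  assert (E : eps * (1 + a) * / (eps * (1 + a)) = 1) by (field; lra).
  assert (/ (eps * (1 + a)) < sum_n (fun k => / (INR k + 2)) n) by (unfold M in *; lra).
  nra.
Qed.

Lemma is_series_bcoef a : -1 < a <= 1 -> is_series (bcoef a) 1.
Proof.
  intros Ha. apply is_series_R_eps. intros eps He.
  destruct (Tcoef_small a eps Ha He) as [N HN]. exists N. intros n Hn.
  rewrite sum_bcoef. pose proof (Tcoef_nonneg a (S n) ltac:(lra)).
  specialize (HN (S n) ltac:(lia)). rewrite Rabs_left1; lra.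
Qed.

Lemma Q_tail_series a z : -1 < a <= 1 -> Cmod z < 1 ->
  is_cseries (fun n => RtoC (bcoef a n) * z ^ S n)%C (1 - Qfun a z)%C.
Proof.
  intros Ha Hz. pose proof (is_cseries_S _ _ (pser_Q a Ha z Hz)) as H.
  replace (1 - Qfun a z)%C with ((-1) * (Qfun a z - Qcoef a 0 * z ^ 0))%C by (simpl; ring).
  eapply is_cseries_ext; [|apply is_cseries_scal, H]. intros n. simpl. rewrite RtoC_opp. ring.
Qed.

(** The coefficients b_n are nonnegative with sum 1. Hence Q has no zero in the disc, and Re (1/Q)
    >= 1/2 follows by inversion. *)
Lemma Cmod_one_minus_Q a z : -1 < a <= 1 -> Cmod z < 1 -> Cmod (1 - Qfun a z) <= Cmod z.
Proof.
  intros Ha Hz. pose proof (Cmod_ge_0 z).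
  replace (Cmod z) with (1 * Cmod z) by ring.
  apply (is_cseries_Cmod_le _ (fun n => bcoef a n * Cmod z) _ (1 * Cmod z) (Q_tail_series a z Ha Hz)).
  - apply (is_series_scal_r (Cmod z) (bcoef a) 1). now apply is_series_bcoef.
  - intros n. rewrite Cmod_mult, Cmod_R, Cmod_pow, Rabs_pos_eq by now apply bcoef_nonneg.
    apply Rmult_le_compat_l; [now apply bcoef_nonneg|].
    simpl. rewrite <- (Rmult_1_r (Cmod z)) at 3. apply Rmult_le_compat_l; [lra|].
    rewrite <- (pow1 n). apply pow_incr; lra.
Qed.

Lemma Q_neq_0 a z : -1 < a <= 1 -> Cmod z < 1 -> Qfun a z <> 0%C.
Proof.
  intros Ha Hz E. pose proof (Cmod_one_minus_Q a z Ha Hz) as B. rewrite E in B.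
  replace (1 - 0)%C with (RtoC 1) in B by ring. rewrite Cmod_1 in B. lra.
Qed.

(** Converts a lower bound on |Q| into a distance from the boundary point 1, the only one at which h
    is singular. *)
Lemma Q_to_0 a c : -1 < a <= 1 -> 0 < c -> exists eta, 0 < eta /\
  forall z, Cmod z < 1 -> c <= Cmod (Qfun a z) -> eta <= Cmod (1 - z).
Proof.
  intros Ha Hc. destruct (Tcoef_small a (c / 4) Ha ltac:(lra)) as [N HN].
  pose proof (HN N (le_n _)) as HNN. pose proof (pos_INR N) as HNp.
  exists (c / (4 * (INR N + 2))). split; [apply Rdiv_lt_0_compat; lra|].
  intros z Hz Hcz. pose proof (Cmod_ge_0 (1 - z)) as Hm.
  assert (Hpow : forall n, Cmod (1 - z ^ n) <= INR n * Cmod (1 - z)).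
  { induction n as [|n IH].
    - simpl. replace (1 - 1)%C with (RtoC 0) by ring. rewrite Cmod_0. lra.
    - replace (1 - z ^ S n)%C with ((1 - z ^ n) + z ^ n * (1 - z))%C by (simpl; ring).
      eapply Rle_trans; [apply Cmod_triangle|]. rewrite Cmod_mult, Cmod_pow, S_INR.
      assert (Cmod z ^ n <= 1) by (rewrite <- (pow1 n); apply pow_incr; split; [apply Cmod_ge_0 | lra]).
      nra. }
  assert (Hpow2 : forall n, Cmod (1 - z ^ n) <= 2).
  { intros n. eapply Rle_trans; [apply Cmod_triangle|]. rewrite Cmod_opp, Cmod_1, Cmod_pow.
    assert (Cmod z ^ n <= 1) by (rewrite <- (pow1 n); apply pow_incr; split; [apply Cmod_ge_0 | lra]). lra. }
  (* Q z = sum b_n (1 - z^(n+1)), split after [N] terms *)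
  assert (S1 : is_cseries (fun n => RtoC (bcoef a n) * (1 - z ^ S n))%C (Qfun a z)).
  { replace (Qfun a z) with (RtoC 1 + (-1) * (1 - Qfun a z))%C by ring.
    assert (SB : is_cseries (fun n => RtoC (bcoef a n)) (RtoC 1)).
    { apply is_cseries_Re_Im; split; [now apply is_series_bcoef|].
      apply is_series_R_eps. intros eps He; exists O; intros n _.
      replace (sum_n (fun n => Im (RtoC (bcoef a n))) n) with 0; [simpl; rewrite Rminus_0_r, Rabs_R0; exact He|].
      symmetry. induction n; [now rewrite sum_O|]. rewrite sum_Sn, IHn. unfold plus; simpl; ring. }
    eapply is_cseries_ext; [|apply (is_cseries_plus _ _ _ _ SB (is_cseries_scal (-1) _ _ (Q_tail_series a z Ha Hz)))].
    intros n. cbv beta. ring. }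
  set (K := (INR N + 1) * Cmod (1 - z)).
  assert (B : Cmod (Qfun a z) <= K * 1 + 2 * Tcoef a (S N)).
  { assert (SS : is_series (fun n => K * bcoef a n + 2 * (if le_dec n N then 0 else bcoef a n)) (K * 1 + 2 * Tcoef a (S N))).
    { apply (is_series_plus (fun n => K * bcoef a n)).
      - apply (is_series_scal K (bcoef a) 1). now apply is_series_bcoef.
      - apply (is_series_scal (2 : R_AbsRing) (fun n => if le_dec n N then 0 else bcoef a n) (Tcoef a (S N))).
        apply is_series_R_eps. intros eps He.
        destruct (Tcoef_small a eps Ha He) as [M HM]. exists (max M N). intros n Hn.
        assert (E : forall k, sum_n (fun n => if le_dec n N then 0 else bcoef a n) (N + k) = Tcoef a (S N) - Tcoef a (S (N + k))).
        { induction k.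
          - rewrite Nat.add_0_r, Rminus_diag.
            assert (Z : forall j, (j <= N)%nat -> sum_n (fun n => if le_dec n N then 0 else bcoef a n) j = 0).
            { induction j; intros Hj; [rewrite sum_O|rewrite sum_Sn, IHj by lia];
                destruct le_dec; try lia; unfold plus; simpl; ring. }
            now apply Z.
          - rewrite Nat.add_succ_r, sum_Sn, IHk. destruct le_dec; [lia|].
            rewrite (Tcoef_S a (S (N + k))).
            change (Tcoef a (S N) - Tcoef a (S (N + k)) + bcoef a (S (N + k))
              = Tcoef a (S N) - (Tcoef a (S (N + k)) - bcoef a (S (N + k)))). ring. }
        replace n with (N + (n - N))%nat by lia. rewrite E.
        replace (N + (n - N))%nat with n by lia.
        pose proof (Tcoef_nonneg a (S n) ltac:(lra)). specialize (HM (S n) ltac:(lia)). rewrite Rabs_left1; lra. }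
    apply (is_cseries_Cmod_le _ _ _ _ S1 SS). intros n.
    rewrite Cmod_mult, Cmod_R, Rabs_pos_eq by now apply bcoef_nonneg.
    pose proof (bcoef_nonneg a n Ha) as Hb.
    assert (HK : 0 <= K) by (apply Rmult_le_pos; lra).
    destruct le_dec as [Hle|Hgt].
    - specialize (Hpow (S n)). rewrite S_INR in Hpow. apply le_INR in Hle.
      assert (Cmod (1 - z ^ S n) <= K) by (unfold K; nra). nra.
    - specialize (Hpow2 (S n)). nra. }
  pose proof (HN (S N) ltac:(lia)) as HSN.
  assert (HK : c / 2 <= K) by lra. unfold K in HK.
  apply Rle_div_l; [lra|]. nra.
Qed.

(** * Univalence and real part *)

Lemma concave_tangent (phi phi' : R -> R) lo hi x m :
  (forall y, lo <= y <= hi -> is_derive phi y (phi' y)) ->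
  (forall y w, lo <= y -> y < w -> w <= hi -> phi' w <= phi' y) ->
  lo <= x <= hi -> lo <= m <= hi -> phi x <= phi m + phi' m * (x - m).
Proof.
  intros Hd Hdec Hx Hm. destruct (Rtotal_order x m) as [H|[->|H]]; [|lra|].
  - destruct (MVT_cor2 phi phi' x m H) as [c [E Hc]].
    + intros c Hc; apply is_derive_Reals, Hd; lra.
    + pose proof (Hdec c m ltac:(lra) ltac:(lra) ltac:(lra)). nra.
  - destruct (MVT_cor2 phi phi' m x H) as [c [E Hc]].
    + intros c Hc; apply is_derive_Reals, Hd; lra.
    + pose proof (Hdec m c ltac:(lra) ltac:(lra) ltac:(lra)). nra.
Qed.

Lemma concave_chord (phi phi' : R -> R) lo hi x y l :
  (forall y, lo <= y <= hi -> is_derive phi y (phi' y)) ->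
  (forall y w, lo <= y -> y < w -> w <= hi -> phi' w <= phi' y) ->
  lo <= x <= hi -> lo <= y <= hi -> 0 <= l <= 1 ->
  (1 - l) * phi x + l * phi y <= phi ((1 - l) * x + l * y).
Proof.
  intros Hd Hdec Hx Hy Hl. set (m := (1 - l) * x + l * y).
  assert (Hm : lo <= m <= hi) by (unfold m; split; nra).
  pose proof (concave_tangent phi phi' lo hi x m Hd Hdec Hx Hm) as T1.
  pose proof (concave_tangent phi phi' lo hi y m Hd Hdec Hy Hm) as T2.
  assert (E : (1 - l) * (x - m) + l * (y - m) = 0) by (unfold m; ring).
  assert ((1 - l) * phi x <= (1 - l) * (phi m + phi' m * (x - m))) by (apply Rmult_le_compat_l; lra).
  assert (l * phi y <= l * (phi m + phi' m * (y - m))) by (apply Rmult_le_compat_l; lra).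
  replace (phi m) with ((1 - l) * (phi m + phi' m * (x - m)) + l * (phi m + phi' m * (y - m))
     - phi' m * ((1 - l) * (x - m) + l * (y - m))) by ring.
  rewrite E. lra.
Qed.

Lemma convex_comb_between lo hi p q t :
  lo < p < hi -> lo < q < hi -> 0 <= t <= 1 -> lo < (1 - t) * p + t * q < hi.
Proof.
  intros Hp Hq Ht. destruct (Req_dec t 0) as [->|Ht0]; [lra|].
  assert (0 < t * (q - lo)) by (apply Rmult_lt_0_compat; lra).
  assert (0 < t * (hi - q)) by (apply Rmult_lt_0_compat; lra).
  assert (0 <= (1 - t) * (p - lo)) by (apply Rmult_le_pos; lra).
  assert (0 <= (1 - t) * (hi - p)) by (apply Rmult_le_pos; lra).
  lra.
Qed.

(** In the coordinate u = log(1 - z) the disc is Re u < ln 2 + ln cos(Im u), so this concavity is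
    its convexity. It also bounds real parts of powers. *)
Lemma ln_cos_concave x y l : - PI / 2 < x < PI / 2 -> - PI / 2 < y < PI / 2 -> 0 <= l <= 1 ->
  (1 - l) * ln (cos x) + l * ln (cos y) <= ln (cos ((1 - l) * x + l * y)).
Proof.
  intros Hx Hy Hl.
  set (lo := Rmin x y). set (hi := Rmax x y).
  assert (B : lo <= x <= hi /\ lo <= y <= hi /\ - PI / 2 < lo /\ hi < PI / 2).
  { unfold lo, hi. pose proof (Rmin_l x y). pose proof (Rmin_r x y).
    pose proof (Rmax_l x y). pose proof (Rmax_r x y).
    repeat split; try lra; [apply Rmin_glb_lt; lra | apply Rmax_lub_lt; lra]. }
  apply (concave_chord (fun t => ln (cos t)) (fun t => - tan t) lo hi x y l); try lra.
  - intros t Ht. assert (0 < cos t) by (apply cos_gt_0; lra).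
    auto_derive; [exact H|]. unfold tan. field. lra.
  - intros t w H1 H2 H3. apply Ropp_le_contravar, Rlt_le, tan_increasing; lra.
Qed.

Lemma ln_concave x y l : 0 < x -> 0 < y -> 0 <= l <= 1 ->
  (1 - l) * ln x + l * ln y <= ln ((1 - l) * x + l * y).
Proof.
  intros Hx Hy Hl.
  set (lo := Rmin x y). set (hi := Rmax x y).
  assert (B : lo <= x <= hi /\ lo <= y <= hi /\ 0 < lo).
  { unfold lo, hi. pose proof (Rmin_l x y). pose proof (Rmin_r x y).
    pose proof (Rmax_l x y). pose proof (Rmax_r x y).
    repeat split; try lra. apply Rmin_glb_lt; lra. }
  apply (concave_chord ln (fun t => / t) lo hi x y l); try lra.
  - intros t Ht. apply is_derive_ln. lra.
  - intros t w H1 H2 H3. apply Rinv_le_contravar; lra.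
Qed.

(** For z = x + iy the argument of 1 - t z is the arctangent of -y t/(1 - t x), and t/(1 - t x)
    grows from 0 to 1/(1 - x). *)
Lemma arg_one_minus_between z t : Cmod z < 1 -> 0 <= t <= 1 ->
  let A := Im (Clog (1 - z)) in let B := Im (Clog (1 - RtoC t * z)) in
  (0 <= B <= A \/ A <= B <= 0).
Proof.
  intros Hz Ht A B. pose proof (Re_one_minus_pos z Hz) as H1.
  assert (Htz : Cmod (RtoC t * z) < 1).
  { rewrite Cmod_mult, Cmod_R, Rabs_pos_eq by lra. pose proof (Cmod_ge_0 z). nra. }
  pose proof (Re_one_minus_pos _ Htz) as H2.
  unfold A, B. rewrite !Clog_right by assumption. unfold Im at 1 3 5 7; simpl snd.
  destruct z as [x y]. unfold Re, Im in *; simpl in *.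
  replace (0 + - (t * y + 0 * x)) with (- (t * y)) by ring.
  replace (1 + - (t * x - 0 * y)) with (1 - t * x) in * by ring.
  replace (0 + - y) with (- y) by ring. replace (1 + - x) with (1 - x) in * by ring.
  assert (E : t / (1 - t * x) <= 1 / (1 - x)).
  { apply Rle_div_l; [lra|]. replace (1 / (1 - x) * (1 - t * x)) with ((1 - t * x) / (1 - x)) by (field; lra).
    apply Rle_div_r; nra. }
  assert (E0 : 0 <= t / (1 - t * x)) by (apply Rdiv_le_0_compat; lra).
  replace (- (t * y) / (1 - t * x)) with (- y * (t / (1 - t * x))) by (field; lra).
  replace (- y / (1 - x)) with (- y * (1 / (1 - x))) by (field; lra).
  assert (M : forall u v, u <= v -> atan u <= atan v).
  { intros u v [H| ->]; [apply Rlt_le, atan_increasing, H | lra]. }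
  rewrite <- atan_0.
  destruct (Rle_or_lt 0 (- y)) as [Hy|Hy]; [left|right]; split; apply M; nra.
Qed.

Lemma Re_Cexp z : Re (Cexp z) = exp (Re z) * cos (Im z).
Proof. reflexivity. Qed.

(** With u = log(1 - z) the quantity (1 - z) Q' is -dQ/du. The t-derivative of t^2 Q'(t z) is -(1 +
    a) t V'(t z), so it suffices that (1 - z) V'(t z) has positive real part for every t. *)
Lemma Re_one_minus_Q'_neg a z : -1 < a <= 1 -> Cmod z < 1 ->
  Re ((1 - z) * PS (dseq (Qcoef a)) z) < 0.
Proof.
  intros Ha Hz. pose proof (pser_dseq 1 _ _ ltac:(lra) (pser_Q a Ha)) as HQ'.
  set (X := PS (dseq (Qcoef a))) in *. set (X' := PS (dseq (dseq (Qcoef a)))).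
  assert (Hin : forall t, 0 <= t <= 1 -> Cmod (0 + RtoC t * z) < 1).
  { intros t Ht. replace (0 + RtoC t * z)%C with (RtoC t * z)%C by ring.
    rewrite Cmod_mult, Cmod_R, Rabs_pos_eq by lra. pose proof (Cmod_ge_0 z). nra. }
  set (W := fun t => PS (dseq (Vcoef a)) (0 + RtoC t * z)%C).
  assert (D : forall t, 0 <= t <= 1 ->
     rder (fun u => RtoC (u * u) * X (0 + RtoC u * z)%C)%C t (RtoC (- (1 + a) * t) * W t)).
  { intros t Ht. eapply rder_eq.
    - apply rder_mult.
      + apply (rder_RtoC (fun u => u * u) t (2 * t)). auto_derive; trivial; ring.
      + apply cder_along, (pser_cder 1 _ _ _ HQ'), Hin, Ht.
    - cbv beta. fold X'.
      assert (E := Q_second_order a _ Ha (Hin t Ht)). fold X X' in E.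
      unfold W. rewrite !RtoC_mult, RtoC_opp, RtoC_plus.
      transitivity (RtoC t * (2 * X (0 + RtoC t * z)%C + (0 + RtoC t * z) * X' (0 + RtoC t * z)%C))%C; [ring|].
      rewrite E. ring. }
  assert (HW : forall t, 0 <= t <= 1 -> 0 < Re ((1 - z) * W t)).
  { intros t Ht. unfold W. rewrite V'_power by auto.
    replace (0 + RtoC t * z)%C with (RtoC t * z)%C by ring.
    pose proof (arg_one_minus_between z t Hz Ht) as Hb. cbv zeta in Hb.
    pose proof (Re_one_minus_pos z Hz) as Hp. pose proof (Im_Clog_bound _ Hp) as HA.
    rewrite <- (Cexp_Clog (1 - z)) at 1 by exact Hp. unfold Cpower. rewrite <- Cexp_plus, Re_Cexp.
    apply Rmult_lt_0_compat; [apply exp_pos|].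
    set (A := Im (Clog (1 - z))) in *. set (B := Im (Clog (1 - RtoC t * z))) in *.
    replace (Im (Clog (1 - z) + (a - 1) * Clog (1 - RtoC t * z))) with (A + (a - 1) * B)
      by (unfold A, B, Im, Re; simpl; ring).
    apply cos_gt_0; nra. }
  assert (K : Re (- (1 - z) * (RtoC (0 * 0) * X (0 + 0 * z)%C)) < Re (- (1 - z) * (RtoC (1 * 1) * X (0 + 1 * z)%C))).
  { apply (strict_incr_01 (fun t => Re (- (1 - z) * (RtoC (t * t) * X (0 + RtoC t * z)%C)))
             (fun t => Re (- (1 - z) * (RtoC (- (1 + a) * t) * W t)))).
    - intros t Ht. apply is_derive_Re_mult. now apply D.
    - intros t Ht. replace (Re (- (1 - z) * (RtoC (- (1 + a) * t) * W t)))
        with ((1 + a) * t * Re ((1 - z) * W t)) by (unfold Re, Im; simpl; ring).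
      apply Rmult_lt_0_compat; [apply Rmult_lt_0_compat; lra | apply HW; lra]. }
  rewrite Rmult_0_l, Rmult_1_l in K.
  replace (0 + 1 * z)%C with z in K by ring.
  replace (- (1 - z) * (0 * X (0 + 0 * z)%C))%C with (RtoC 0) in K by ring.
  replace (- (1 - z) * (1 * X z))%C with (- ((1 - z) * X z))%C in K by ring.
  change (Re (- ((1 - z) * X z))) with (- Re ((1 - z) * X z)) in K.
  change (Re 0) with 0 in K. lra.
Qed.

(** For r = e^(Re u) one has |1 - e^u|^2 = 1 - r (2 cos(Im u) - r), which is below 1 exactly when r
    < 2 cos(Im u). *)
Lemma Cmod_one_minus_Cexp u : - PI / 2 < Im u < PI / 2 ->
  Cmod (1 - Cexp u) < 1 <-> Re u < ln 2 + ln (cos (Im u)).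
Proof.
  intros Hu. assert (Hc : 0 < cos (Im u)) by (apply cos_gt_0; lra).
  rewrite <- ln_mult by lra.
  assert (E : Cmod (1 - Cexp u) ^ 2 = 1 - exp (Re u) * (2 * cos (Im u) - exp (Re u))).
  { rewrite Cmod2_alt. unfold Cexp, Re, Im; simpl.
    pose proof (sin2_cos2 (snd u)) as T. unfold Rsqr in T.
    replace ((1 + - (exp (fst u) * cos (snd u))) * ((1 + - (exp (fst u) * cos (snd u))) * 1) +
       (0 + - (exp (fst u) * sin (snd u))) * ((0 + - (exp (fst u) * sin (snd u))) * 1))
      with (1 - 2 * exp (fst u) * cos (snd u)
        + exp (fst u) * exp (fst u) * (sin (snd u) * sin (snd u) + cos (snd u) * cos (snd u))) by ring.
    rewrite T. ring. }
  pose proof (exp_pos (Re u)) as He. pose proof (Cmod_ge_0 (1 - Cexp u)) as Hm.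
  split; intros H.
  - apply exp_lt_inv. rewrite exp_ln by lra. rewrite <- Rsqr_pow2 in E; unfold Rsqr in E. nra.
  - apply exp_increasing in H. rewrite exp_ln in H by lra. rewrite <- Rsqr_pow2 in E; unfold Rsqr in E. nra.
Qed.

(* In the coordinate [u = log (1 - z)] the disk is convex and [dQ/du] has positive real part. *)
Lemma Q_injective a z w : -1 < a <= 1 -> Cmod z < 1 -> Cmod w < 1 -> Qfun a z = Qfun a w -> z = w.
Proof.
  intros Ha Hz Hw HQ.
  pose proof (Re_one_minus_pos z Hz) as Hpz. pose proof (Re_one_minus_pos w Hw) as Hpw.
  set (u := Clog (1 - z)). set (v := Clog (1 - w)).
  assert (Eu : Cexp u = (1 - z)%C) by now apply Cexp_Clog.
  assert (Ev : Cexp v = (1 - w)%C) by now apply Cexp_Clog.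
  pose proof (Im_Clog_bound _ Hpz) as Bu. fold u in Bu.
  pose proof (Im_Clog_bound _ Hpw) as Bv. fold v in Bv.
  destruct (Ceq_dec (v - u) 0) as [E|E].
  { assert (u = v) by (replace v with (v - u + u)%C by ring; rewrite E; ring).
    replace z with (1 - (1 - z))%C by ring. rewrite <- Eu, H, Ev. ring. }
  exfalso. set (d := (v - u)%C) in *.
  assert (Hin : forall t, 0 <= t <= 1 -> Cmod (1 - Cexp (u + RtoC t * d)) < 1).
  { intros t Ht.
    assert (EI : Im (u + RtoC t * d) = (1 - t) * Im u + t * Im v) by (unfold d, Im, Re; simpl; ring).
    assert (ER : Re (u + RtoC t * d) = (1 - t) * Re u + t * Re v) by (unfold d, Im, Re; simpl; ring).
    apply Cmod_one_minus_Cexp.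
    - rewrite EI. now apply convex_comb_between.
    - rewrite EI, ER. pose proof (ln_cos_concave (Im u) (Im v) t Bu Bv Ht).
      assert (Hu : Re u < ln 2 + ln (cos (Im u))).
      { apply Cmod_one_minus_Cexp; [exact Bu|]. rewrite Eu. now replace (1 - (1 - z))%C with z by ring. }
      assert (Hv : Re v < ln 2 + ln (cos (Im v))).
      { apply Cmod_one_minus_Cexp; [exact Bv|]. rewrite Ev. now replace (1 - (1 - w))%C with w by ring. }
      destruct (Req_dec t 0) as [->|Ht0]; [lra|].
      assert (t * Re v < t * (ln 2 + ln (cos (Im v)))) by (apply Rmult_lt_compat_l; lra).
      assert ((1 - t) * Re u <= (1 - t) * (ln 2 + ln (cos (Im u)))) by (apply Rmult_le_compat_l; lra).
      lra. }
  set (zt := fun t => (1 - Cexp (u + RtoC t * d))%C).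
  assert (D : forall t, 0 <= t <= 1 ->
    rder (fun t => Qfun a (zt t)) t (PS (dseq (Qcoef a)) (zt t) * (- Cexp (u + RtoC t * d) * d))).
  { intros t Ht. apply (rder_comp (Qfun a) zt).
    - apply (pser_cder 1 _ _ _ (pser_Q a Ha)), Hin, Ht.
    - unfold zt. apply (cder_along (fun y => 1 - Cexp y)%C u d t).
      eapply cder_eq; [apply cder_minus; [apply cder_const | apply cder_Cexp]|]. ring. }
  (* The Noshiro-Warschawski argument: paired with the conjugate of the direction [d], Q strictly
     increases along the segment, so its end values differ. *)
  assert (K : Re (Cconj d * Qfun a (zt 0)) < Re (Cconj d * Qfun a (zt 1))).
  { apply (strict_incr_01 (fun t => Re (Cconj d * Qfun a (zt t)))
      (fun t => Re (Cconj d * (PS (dseq (Qcoef a)) (zt t) * (- Cexp (u + RtoC t * d) * d))))).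
    - intros t Ht. apply is_derive_Re_mult. now apply D.
    - intros t Ht.
      replace (Cconj d * (PS (dseq (Qcoef a)) (zt t) * (- Cexp (u + RtoC t * d) * d)))%C
        with (RtoC (Cmod d ^ 2) * - ((1 - zt t) * PS (dseq (Qcoef a)) (zt t)))%C.
      + rewrite Re_Cmult. change (Im (RtoC (Cmod d ^ 2))) with 0. change (Re (RtoC (Cmod d ^ 2))) with (Cmod d ^ 2).
        pose proof (Re_one_minus_Q'_neg a (zt t) Ha (Hin t ltac:(lra))) as N.
        change (Re (- ((1 - zt t) * PS (dseq (Qcoef a)) (zt t)))) with (- Re ((1 - zt t) * PS (dseq (Qcoef a)) (zt t))).
        apply Cmod_gt_0 in E. assert (0 < Cmod d ^ 2) by (apply pow_lt; exact E). nra.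
      + rewrite Cmod2_conj. unfold zt. ring. }
  assert (E0 : zt 0 = z).
  { unfold zt. replace (u + 0 * d)%C with u by ring. rewrite Eu. ring. }
  assert (E1 : zt 1 = w).
  { unfold zt, d. replace (u + 1 * (v - u))%C with v by ring. rewrite Ev. ring. }
  rewrite E0, E1, HQ in K. lra.
Qed.

Lemma Q_conformal a : -1 < a <= 1 -> conformal (Qfun a) (Qcoef a).
Proof.
  intros Ha. split; [now apply pser_Q|]. split.
  - intros z w. now apply Q_injective.
  - intros z Hz E. pose proof (Re_one_minus_Q'_neg a z Ha Hz) as N. rewrite E in N.
    replace ((1 - z) * 0)%C with (RtoC 0) in N by ring. change (Re 0) with 0 in N. lra.
Qed.

(** Inversion maps a disc whose boundary passes through 0 onto a half-plane. The disc form is the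
    one that survives integration. *)
Lemma Re_Cinv_ge (w : C) (k : R) : 0 < k -> w <> 0%C -> Cmod (w - k) <= k <-> / (2 * k) <= Re (/ w).
Proof.
  intros Hk Hw. assert (HM : 0 < Cmod w ^ 2) by (apply pow_lt; now apply Cmod_gt_0).
  assert (E : Re (/ w) = Re w / Cmod w ^ 2).
  { rewrite Cmod2_alt. reflexivity. }
  assert (E2 : Cmod (w - k) ^ 2 = Cmod w ^ 2 - 2 * k * Re w + k ^ 2).
  { rewrite !Cmod2_alt. unfold Re, Im; simpl; ring. }
  pose proof (Cmod_ge_0 (w - k)) as H0. rewrite E.
  assert (I : / (2 * k) <= Re w / Cmod w ^ 2 <-> Cmod w ^ 2 <= 2 * k * Re w).
  { split; intros H.
    - apply Rle_div_r in H; [|exact HM].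
      apply Rmult_le_compat_l with (r := 2 * k) in H; [|lra].
      replace (2 * k * (/ (2 * k) * Cmod w ^ 2)) with (Cmod w ^ 2) in H by (field; lra). exact H.
    - apply Rle_div_r; [exact HM|]. apply Rmult_le_reg_l with (2 * k); [lra|].
      replace (2 * k * (/ (2 * k) * Cmod w ^ 2)) with (Cmod w ^ 2) by (field; lra). exact H. }
  rewrite I. split; intros H.
  - assert (Cmod (w - k) ^ 2 <= k ^ 2) by (apply pow_incr; lra). lra.
  - apply Rsqr_incr_0_var; [|lra]. unfold Rsqr. simpl in *. lra.
Qed.

(** The extremal function ((1 - z)^(-a) - 1)/a, written through V so that a = 0 is included. *)
Definition Kfun (a : R) (z : C) : C := (Cpower (1 - z) (- a) * Vfun a z)%C.

Lemma cder_K a z : -1 < a <= 1 -> Cmod z < 1 -> cder (Kfun a) z (Cpower (1 - z) (- (1 + a))).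
Proof.
  intros Ha Hz. pose proof (pser_V a Ha) as HV. pose proof (Re_one_minus_pos z Hz) as Hp.
  eapply cder_eq; [apply cder_mult; [now apply cder_Cpower_one_minus | apply (pser_cder 1 _ _ z HV Hz)]|].
  rewrite V'_power by assumption.
  replace (- - RtoC a * Cpower (1 - z) (- RtoC a - 1) * Vfun a z)%C
    with (Cpower (1 - z) (- RtoC a - 1) * (a * Vfun a z))%C by ring.
  rewrite aV_power by assumption.
  rewrite <- Cpower_plus.
  replace (- RtoC a + (RtoC a - 1))%C with (- RtoC a - 1 + RtoC a)%C by ring. rewrite Cpower_plus.
  replace (- (1 + RtoC a))%C with (- RtoC a - 1)%C by ring. ring.
Qed.

Lemma K_Q a z : -1 < a <= 1 -> Cmod z < 1 ->
  (Cpower (1 - z) (1 + a) * Kfun a z = z * Qfun a z)%C.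
Proof.
  intros Ha Hz. pose proof (Re_one_minus_pos z Hz) as Hp.
  unfold Kfun. rewrite Cmult_assoc, <- Cpower_plus, zQ_V by assumption.
  replace (1 + RtoC a + - RtoC a)%C with (RtoC 1) by ring. now rewrite Cpower_1.
Qed.

(** Concavity of ln cos, which vanishes at 0, gives Re (x^s) >= (Re x)^s >= c^s. The weighted mean
    inequality c^(-s) <= 1 - s + s/c replaces the power by something that integrates in closed
    form. *)
Lemma Re_power_ge x s c : 0 < c <= Re x -> 0 <= s <= 1 ->
  / (1 - s + s * / c) <= Re (Cexp (RtoC s * Clog x)).
Proof.
  intros Hc Hs. assert (Hx : 0 < Re x) by lra.
  pose proof (Im_Clog_bound x Hx) as B. set (L := Clog x) in *.
  assert (HE : Re x = exp (Re L) * cos (Im L)) by (rewrite <- Re_Cexp; unfold L; now rewrite Cexp_Clog).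
  assert (Hcos : 0 < cos (Im L)) by (apply cos_gt_0; lra).
  assert (Hip : 0 < / c) by (apply Rinv_0_lt_compat; lra).
  rewrite Re_Cexp.
  replace (Re (RtoC s * L)) with (s * Re L) by (unfold Re, Im; simpl; ring).
  replace (Im (RtoC s * L)) with ((1 - s) * 0 + s * Im L) by (unfold Re, Im; simpl; ring).
  pose proof PI_RGT_0.
  assert (C : s * ln (cos (Im L)) <= ln (cos ((1 - s) * 0 + s * Im L))).
  { pose proof (ln_cos_concave 0 (Im L) s ltac:(lra) B Hs) as T. rewrite cos_0, ln_1 in T. lra. }
  assert (Hcos2 : 0 < cos ((1 - s) * 0 + s * Im L)) by (apply cos_gt_0; nra).
  assert (LnX : ln (Re x) = Re L + ln (cos (Im L))).
  { rewrite HE, ln_mult, ln_exp by (auto using exp_pos). reflexivity. }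
  assert (Lc : ln c <= ln (Re x)) by (apply ln_le; lra).
  assert (LB : s * - ln c <= ln (1 - s + s * / c)).
  { pose proof (ln_concave 1 (/ c) s ltac:(lra) Hip Hs) as T. rewrite ln_1, ln_Rinv in T by lra.
    replace ((1 - s) * 1 + s * / c) with (1 - s + s * / c) in T by ring. lra. }
  assert (Hpos : 0 < 1 - s + s * / c).
  { destruct (Req_dec s 0) as [->|]; [lra|]. assert (0 < s * / c) by (apply Rmult_lt_0_compat; lra). lra. }
  apply Rle_trans with (exp (- ln (1 - s + s * / c))).
  - rewrite exp_Ropp, exp_ln by exact Hpos. lra.
  - rewrite <- (exp_ln (cos ((1 - s) * 0 + s * Im L))) at 1 by exact Hcos2. rewrite <- exp_plus.
    assert (Hle : - ln (1 - s + s * / c) <= s * Re L + ln (cos ((1 - s) * 0 + s * Im L))) by nra.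
    destruct Hle as [Hlt|Heq]; [apply Rlt_le, exp_increasing, Hlt | rewrite Heq; lra].
Qed.

(** exp(3/4) = exp(1/8)^6 >= (9/8)^6 > 2. *)
Lemma ln_2_lt : ln 2 < 3 / 4.
Proof.
  rewrite <- (ln_exp (3 / 4)). apply ln_increasing; [lra|].
  replace (3 / 4) with (1 / 8 + 1 / 8 + 1 / 8 + 1 / 8 + 1 / 8 + 1 / 8) by field. rewrite !exp_plus.
  pose proof (exp_ineq1_le (1 / 8)) as H. set (x := exp (1 / 8)) in *.
  assert (81 / 64 <= x * x) by nra. assert (81 / 64 * (81 / 64) <= x * x * (x * x)) by nra.
  replace (x * x * x * x * x * x) with (x * x * (x * x) * (x * x)) by ring. nra.
Qed.

(* The exact bound is [beta]; a bound above [alpha] suffices. For [a <= 0],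
   [Q z] is the integral of [((1 - z)/(1 - t z))^(1 + a)] over [0 <= t <= 1]. *)
Lemma Re_inv_Q_gt a : -1 < a <= 1 -> exists kappa, (1 - a) / 2 < kappa /\
  forall z, Cmod z < 1 -> kappa <= Re (/ Qfun a z).
Proof.
  intros Ha. destruct (Rle_or_lt a 0) as [Hneg|Hpos].
  (* For a > 0, that is alpha < 1/2, the bound |1 - Q| <= 1 is already enough. *)
  2:{ exists (1 / 2). split; [lra|]. intros z Hz.
      replace (1 / 2) with (/ (2 * 1)) by field. apply Re_Cinv_ge; [lra | now apply Q_neq_0|].
      rewrite Cmod_minus_sym. pose proof (Cmod_one_minus_Q a z Ha Hz). lra. }
  (* [k] is the integral over [0, 1] of the radius [k' t] below, half the bound of [Re_power_ge]
     with c = (1 + t)/2. *)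
  set (s := 1 + a). set (k := (1 - s + 2 * s * ln 2) / 2).
  assert (Hl2 : 0 < ln 2) by (pose proof ln_lt_2; lra). pose proof ln_2_lt as Hl2'.
  assert (Hs : 0 < s <= 1) by (unfold s; lra).
  assert (Hk : 0 < k) by (unfold k; assert (0 < s * ln 2) by (apply Rmult_lt_0_compat; lra); lra).
  exists (/ (2 * k)). split.
  (* With 2 ln 2 < 3/2 the claim becomes (1 - s/2)(1 + s/2) < 1. *)
  { apply Rmult_lt_reg_r with (2 * k); [lra|]. rewrite Rinv_l by lra.
    replace ((1 - a) / 2 * (2 * k)) with ((1 - s / 2) * (1 - s + 2 * s * ln 2)) by (unfold k, s; field).
    assert (s * ln 2 < s * (3 / 4)) by (apply Rmult_lt_compat_l; lra). nra. }
  intros z Hz. pose proof (Re_one_minus_pos z Hz) as Hp.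
  apply Re_Cinv_ge; [exact Hk | now apply Q_neq_0|].
  destruct (Ceq_dec z 0) as [->|Hz0].
  { rewrite Qfun_0 by exact Ha. rewrite <- RtoC_minus, Cmod_R. pose proof ln_lt_2.
    assert (1 <= 2 * k). { unfold k. nra. }
    apply Rabs_le. lra. }
  assert (Hin : forall t, 0 <= t <= 1 -> Cmod (0 + RtoC t * z) < 1).
  { intros t Ht. replace (0 + RtoC t * z)%C with (RtoC t * z)%C by ring.
    rewrite Cmod_mult, Cmod_R, Rabs_pos_eq by lra. pose proof (Cmod_ge_0 z). nra. }
  set (P := Cpower (1 - z) s).
  set (N' := fun t : R => (P * Cpower (1 - (0 + RtoC t * z)) (- (1 + a)))%C).
  set (k' := fun t : R => (1 - s + s * / ((1 + t) / 2)) / 2).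
  assert (B : forall t, 0 <= t <= 1 -> Cmod (N' t - k' t) <= k' t).
  { intros t Ht. pose proof (Hin t Ht) as Htz. pose proof (Re_one_minus_pos _ Htz) as Hpt.
    set (y := (0 + RtoC t * z)%C) in *.
    assert (Hk' : 0 < k' t).
    { unfold k'. assert (0 < / ((1 + t) / 2)) by (apply Rinv_0_lt_compat; lra).
      assert (0 < s * / ((1 + t) / 2)) by (apply Rmult_lt_0_compat; lra). lra. }
    apply Re_Cinv_ge; [exact Hk' | apply Cmult_neq_0; apply Cpower_neq_0|].
    set (x := ((1 - y) / (1 - z))%C).
    (* Here x = t + (1 - t)/(1 - z), and Re (1/(1 - z)) >= 1/2. *)
    assert (Hx : (1 + t) / 2 <= Re x).
    { pose proof (one_minus_neq_0 z Hz) as Hn.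
      assert (I : / (2 * 1) <= Re (/ (1 - z))).
      { apply Re_Cinv_ge; [lra | exact Hn|]. replace (1 - z - 1)%C with (- z)%C by ring. rewrite Cmod_opp. lra. }
      replace x with (RtoC t + RtoC (1 - t) * / (1 - z))%C.
      - change (Re (RtoC t + RtoC (1 - t) * / (1 - z))) with (t + Re (RtoC (1 - t) * / (1 - z))).
        rewrite Re_Cmult. change (Re (RtoC (1 - t))) with (1 - t). change (Im (RtoC (1 - t))) with 0. nra.
      - unfold x, y. rewrite RtoC_minus. field. exact Hn. }
    (* No multiple of 2 pi i intervenes, because the argument of 1 - y lies between 0 and that of 1
       - z. *)
    assert (EL : (Clog (1 - y) - Clog (1 - z))%C = Clog x).
    { pose proof (arg_one_minus_between z t Hz Ht) as Hb. cbv zeta in Hb.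
      replace (RtoC t * z)%C with y in Hb by (unfold y; ring).
      pose proof (Im_Clog_bound _ Hp) as BA. assert (Hx0 : 0 < Re x) by lra.
      pose proof (Im_Clog_bound _ Hx0) as Bx.
      assert (EC : Cexp (Clog (1 - y) - Clog (1 - z)) = Cexp (Clog x)).
      { unfold Cminus at 1. rewrite Cexp_plus, Cexp_opp, !Cexp_Clog by assumption. unfold x. reflexivity. }
      apply Cexp_inj_strip; [|exact Bx | exact EC].
      change (Im (Clog (1 - y) - Clog (1 - z))) with (Im (Clog (1 - y)) - Im (Clog (1 - z))). lra. }
    replace (/ N' t)%C with (Cexp (RtoC s * Clog x)).
    - replace (2 * k' t) with (1 - s + s * / ((1 + t) / 2)) by (unfold k'; field; lra).
      apply Re_power_ge; lra.
    - rewrite <- EL. unfold N', P, Cpower. fold y. rewrite <- Cexp_plus, <- Cexp_opp. f_equal.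
      unfold s. rewrite RtoC_plus. ring. }
  (* Integrating |N' - k'| <= k' over [0, 1] gives |Q z - k| <= k. *)
  assert (D : Cmod ((P * Kfun a (0 + 1 * z)%C / z - (ln (1 + 1) * s + (1 - s) / 2 * 1)%R)
     - (P * Kfun a (0 + 0 * z)%C / z - (ln (1 + 0) * s + (1 - s) / 2 * 0)%R))
     <= (ln (1 + 1) * s + (1 - s) / 2 * 1) - (ln (1 + 0) * s + (1 - s) / 2 * 0)).
  { apply (Cmod_diff_le_rder (fun t => P * Kfun a (0 + RtoC t * z)%C / z - RtoC (ln (1 + t) * s + (1 - s) / 2 * t))%C
       (fun t => N' t - RtoC (k' t))%C (fun t => ln (1 + t) * s + (1 - s) / 2 * t) k').
    - intros t Ht. apply (rder_minus (fun t => P * Kfun a (0 + RtoC t * z)%C / z)%C).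
      + eapply rder_eq.
        * apply (cder_along (fun y => P * Kfun a y / z)%C 0 z t).
          apply (cder_ext_loc (fun y => P / z * Kfun a y)%C _ _ _ 1); [lra | intros; field; exact Hz0 |].
          apply cder_scal, cder_K; auto.
        * unfold N'. field. exact Hz0.
      + apply (rder_RtoC (fun t => ln (1 + t) * s + (1 - s) / 2 * t)). auto_derive; [lra|].
        unfold k'. field. lra.
    - intros t Ht. auto_derive; [lra|]. unfold k'. field. lra.
    - intros t Ht. apply B. lra. }
  assert (K0 : Kfun a (0 + 0 * z)%C = 0%C).
  { unfold Kfun. replace (0 + 0 * z)%C with (RtoC 0) by ring.
    rewrite (pser_0 1 _ _ ltac:(lra) (pser_V a Ha)). simpl. ring. }
  rewrite K0 in D. replace (0 + 1 * z)%C with z in D by ring.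
  assert (KQ : (P * Kfun a z / z)%C = Qfun a z).
  { unfold P, s. rewrite RtoC_plus, K_Q by assumption. field. exact Hz0. }
  rewrite KQ, Rplus_0_r, ln_1 in D.
  replace (ln (1 + 1) * s + (1 - s) / 2 * 1) with k in D
    by (unfold k; replace (1 + 1) with 2 by ring; field).
  replace (0 * s + (1 - s) / 2 * 0) with 0 in D by ring.
  replace (Qfun a z - k - (P * 0 / z - 0))%C with (Qfun a z - k)%C in D by (field; exact Hz0).
  lra.
Qed.

(** * Taylor coefficients, the bound by beta, and the Basel series *)

(** The Cauchy product, unfolded by peeling off the constant term of the first factor, so that
    shifting that series drives the induction. *)
Fixpoint conv (a b : nat -> C) (n : nat) : C :=
  match n with
  | O => (a O * b O)%C
  | S m => (a O * b (S m) + conv (fun k => a (S k)) b m)%C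
  end.

Lemma pser_mult_conv f g a b c n :
  pser 1 f a -> pser 1 g b -> pser 1 (fun z => f z * g z)%C c -> c n = conv a b n.
Proof.
  revert f a c. induction n as [|n IH]; intros f a c Hf Hg Hc.
  - simpl. rewrite <- (pser_0 1 _ _ ltac:(lra) Hc), <- (pser_0 1 _ _ ltac:(lra) Hf),
      <- (pser_0 1 _ _ ltac:(lra) Hg). reflexivity.
  - pose proof (pser_shift 1 _ _ ltac:(lra) Hf) as Hf1.
    destruct (pser_mult_ex 1 _ _ _ _ ltac:(lra) Hf1 Hg) as [e He].
    simpl. rewrite <- (IH _ _ e Hf1 Hg He).
    rewrite (pser_unique 1 _ c (fun k => a O * b k + match k with O => 0 | S m => e m end)%C ltac:(lra) Hc);
      [reflexivity|].
    eapply pser_ext; [|exact (pser_plus _ _ _ _ _ (pser_scal _ (a O) _ _ Hg) (pser_mult_z _ _ _ He))].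
    intros z Hz. cbv beta. rewrite (pser_factor 1 _ _ z Hf Hz). ring.
Qed.

Lemma pser_inv_Q a : -1 < a <= 1 -> exists d, pser 1 (fun z => / Qfun a z)%C d.
Proof.
  intros Ha. pose proof (pser_hol _ _ _ (pser_Q a Ha)) as H.
  eapply (hol_pser 1 _ (fun z => - / (Qfun a z * Qfun a z) * PS (dseq (Qcoef a)) z)%C); [lra|].
  intros z Hz. destruct (H z Hz) as [H1 H2]. pose proof (Q_neq_0 a z Ha Hz) as Hn. split.
  - exact (cder_comp Cinv (Qfun a) z _ _ (cder_inv _ Hn) H1).
  - pose proof (cder_ccont _ _ _ H1) as C1.
    apply ccont_mult; [|exact H2].
    apply (ccont_ext_loc (fun z => (-1) * / (Qfun a z * Qfun a z))%C _ _ 1); [lra | intros; ring |].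
    apply ccont_mult; [apply ccont_const|].
    apply (ccont_comp Cinv (fun z => Qfun a z * Qfun a z)%C); [apply ccont_inv; now apply Cmult_neq_0|].
    now apply ccont_mult.
Qed.

(** The term with d 0 = 1 contributes b_(m+n); the others are at most M times b_m, ..., b_(m+n-1),
    whose sum telescopes. The offset [m] follows the shifts made by [conv]. *)
Lemma conv_bcoef_bound a (d : nat -> C) M n m : -1 < a <= 1 -> 0 <= M ->
  d O = 1%C -> (forall j, (1 <= j <= n)%nat -> exists x, d j = RtoC x /\ 0 <= x <= M) ->
  exists x, conv (fun k => RtoC (bcoef a (m + k))) d n = RtoC x /\
    0 <= x <= bcoef a (m + n) + M * (Tcoef a m - Tcoef a (m + n)).
Proof.
  intros Ha HM H0. revert m. induction n as [|n IH]; intros m Hd.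
  - exists (bcoef a m). simpl. rewrite Nat.add_0_r, H0. split; [ring|].
    pose proof (bcoef_nonneg a m Ha). split; [lra|]. right; ring.
  - destruct (Hd (S n) ltac:(lia)) as [x [Ex Hx]].
    destruct (IH (S m)) as [y [Ey Hy]]; [intros j Hj; apply Hd; lia|].
    exists (bcoef a m * x + y). simpl conv. rewrite Nat.add_0_r, Ex.
    assert (Ec : conv (fun k => RtoC (bcoef a (m + S k))) d n = RtoC y).
    { rewrite <- Ey. f_equal. apply FunctionalExtensionality.functional_extensionality.
      intros k. now rewrite Nat.add_succ_r. }
    rewrite Ec. split; [now rewrite RtoC_plus, RtoC_mult|].
    pose proof (bcoef_nonneg a m Ha). pose proof (Tcoef_S a m).
    replace (m + S n)%nat with (S m + n)%nat by lia. nra.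
Qed.

(** With M = (1 + a)/2 the renewal bound reads b_n + M (1 - T_n), and b_n <= M T_n keeps it below M,
    so the induction closes. *)
Lemma G_taylor a : -1 < a <= 1 -> exists d : nat -> R,
  pser 1 (fun z => / Qfun a z)%C (fun n => RtoC (d n)) /\ d O = 1 /\
  forall n, 0 <= d (S n) <= (1 + a) / 2.
Proof.
  intros Ha. destruct (pser_inv_Q a Ha) as [d Hd].
  assert (Hd0 : d O = 1%C).
  { rewrite <- (pser_0 1 _ _ ltac:(lra) Hd), Qfun_0 by exact Ha. field. }
  assert (Rec : forall n, d (S n) = conv (fun k => RtoC (bcoef a (0 + k))) d n).
  { intros n.
    assert (H1 : pser 1 (fun z => 1 - Qfun a z)%C
        (fun n => match n with O => 0%C | S m => RtoC (bcoef a m) end)).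
    { eapply pser_ext; [|intros z Hz; eapply is_cseries_ext;
        [|exact (pser_plus _ _ _ _ _ (pser_const 1 1) (pser_scal _ (-1) _ _ (pser_Q a Ha)) z Hz)]].
      - intros z _. cbv beta. ring.
      - intros [|k]; simpl; [ring|]. rewrite RtoC_opp. ring. }
    assert (H2 : pser 1 (fun z => (1 - Qfun a z) * / Qfun a z)%C
        (fun n => d n + match n with O => -1 | S _ => 0 end)%C).
    { eapply pser_ext; [|exact (pser_plus _ _ _ _ _ Hd (pser_const 1 (-1)))].
      intros z Hz. cbv beta. field. now apply Q_neq_0. }
    pose proof (pser_mult_conv _ _ _ _ _ (S n) H1 Hd H2) as E. simpl in E.
    replace (d (S n)) with (d (S n) + 0)%C by ring. rewrite E. simpl. ring. }
  assert (B : forall n j, (1 <= j <= n)%nat -> exists x, d j = RtoC x /\ 0 <= x <= (1 + a) / 2).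
  { induction n as [|n IH]; intros j Hj; [lia|].
    destruct (Nat.eq_dec j (S n)) as [->|Hne]; [|apply IH; lia].
    destruct (conv_bcoef_bound a d ((1 + a) / 2) n 0 Ha ltac:(lra) Hd0 IH) as [x [Ex Hx]].
    exists x. rewrite Rec. split; [exact Ex|]. simpl in Hx.
    pose proof (bcoef_le a n Ha). lra. }
  assert (Real : forall n, d n = RtoC (Re (d n))).
  { intros [|n]; [now rewrite Hd0|]. destruct (B (S n) (S n) ltac:(lia)) as [x [Ex _]]. now rewrite Ex. }
  exists (fun n => Re (d n)). split; [|split].
  - intros z Hz. eapply is_cseries_ext; [|exact (Hd z Hz)]. intros n. cbv beta. now rewrite <- Real.
  - now rewrite Hd0.
  - intros n. destruct (B (S n) (S n) ltac:(lia)) as [x [Ex Hx]]. rewrite Ex. exact Hx.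
Qed.

(** exp(-1/24) >= 23/24 gives exp(2/3) = exp(1/24)^16 <= (24/23)^16 < 2. *)
Lemma ln_2_gt : 2 / 3 < ln 2.
Proof.
  rewrite <- (ln_exp (2 / 3)). apply ln_increasing; [apply exp_pos|].
  assert (H : exp (1 / 24) <= 24 / 23).
  { pose proof (exp_ineq1_le (- (1 / 24))) as T. rewrite exp_Ropp in T.
    pose proof (exp_pos (1 / 24)). rewrite <- (Rinv_inv (exp (1 / 24))).
    replace (24 / 23) with (/ (23 / 24)) by field. apply Rinv_le_contravar; lra. }
  replace (2 / 3) with (INR 16 * (1 / 24)) by (simpl; field).
  assert (E : exp (INR 16 * (1 / 24)) = exp (1 / 24) ^ 16).
  { generalize 16%nat. induction n as [|n IH]; [simpl; rewrite Rmult_0_l; apply exp_0|].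
    rewrite S_INR, Rmult_plus_distr_r, exp_plus, IH, Rmult_1_l. simpl; ring. }
  rewrite E. apply Rle_lt_trans with ((24 / 23) ^ 16); [|lra].
  apply pow_incr. split; [apply Rlt_le, exp_pos | exact H].
Qed.

(** Both sides agree at 0 and 1. The function ln(3 - x) - ln(3 + x) is concave, hence above its
    chord -x ln 2. *)
Lemma two_power_ge x : 0 <= x <= 1 -> (3 + x) / (3 - x) <= Rpower 2 x.
Proof.
  intros Hx.
  pose proof (concave_chord (fun t => ln (3 - t) - ln (3 + t)) (fun t => - / (3 - t) - / (3 + t)) 0 1 0 1 x) as C.
  cbv beta in C.
  assert (H : (1 - x) * (ln (3 - 0) - ln (3 + 0)) + x * (ln (3 - 1) - ln (3 + 1)) <=
              ln (3 - ((1 - x) * 0 + x * 1)) - ln (3 + ((1 - x) * 0 + x * 1))).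
  { apply C; try lra.
    - intros y Hy. auto_derive; [lra|]. field. lra.
    - intros y w H1 H2 H3.
      assert (E : / (3 - y) + / (3 + y) <= / (3 - w) + / (3 + w)); [|lra].
      replace (/ (3 - y) + / (3 + y)) with (6 * / (9 - y * y)) by (field; nra).
      replace (/ (3 - w) + / (3 + w)) with (6 * / (9 - w * w)) by (field; nra).
      apply Rmult_le_compat_l; [lra|]. apply Rinv_le_contravar; nra. }
  replace (3 - 0) with 3 in H by ring. replace (3 + 0) with 3 in H by ring.
  replace (3 - 1) with 2 in H by ring. replace (3 + 1) with (2 * 2) in H by ring.
  replace ((1 - x) * 0 + x * 1) with x in H by ring. rewrite (ln_mult 2 2) in H by lra.
  unfold Rpower. rewrite <- (exp_ln ((3 + x) / (3 - x))) by (apply Rdiv_lt_0_compat; lra).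
  rewrite ln_div by lra.
  assert (Hle : ln (3 + x) - ln (3 - x) <= x * ln 2) by lra.
  destruct Hle as [Hlt|Heq]; [apply Rlt_le, exp_increasing, Hlt | rewrite Heq; lra].
Qed.

Lemma beta_bound alpha : 0 <= alpha < 1 -> (2 - 2 * alpha) / 4 <= 1 - beta alpha.
Proof.
  intros Ha. unfold beta. destruct (Req_EM_T alpha (1 / 2)) as [->|Hne].
  - pose proof ln_2_gt. assert (1 / (2 * ln 2) <= 3 / 4); [|lra].
    apply Rle_div_l; lra.
  - set (a := 1 - 2 * alpha). assert (Ha1 : -1 < a <= 1) by (unfold a; lra).
    assert (Ha0 : a <> 0) by (unfold a; lra).
    replace ((2 - 2 * alpha) / 4) with (1 - (3 - a) / 4) by (unfold a; field).
    assert (a / (2 * (Rpower 2 a - 1)) <= (3 - a) / 4); [|lra].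
    destruct (Rle_or_lt 0 a) as [Hp|Hn].
    + pose proof (two_power_ge a ltac:(lra)) as P.
      assert (E : (3 + a) / (3 - a) = 1 + 2 * a / (3 - a)) by (field; lra).
      assert (0 < 2 * a / (3 - a)) by (apply Rdiv_lt_0_compat; lra).
      apply Rle_div_l; [lra|].
      replace a with ((3 - a) / 4 * (2 * (2 * a / (3 - a)))) at 1 by (field; lra).
      apply Rmult_le_compat_l; lra.
    (* Negative exponents reduce to positive ones, since both 2^x and (3 + x)/(3 - x) are inverted
       by changing the sign of x. *)
    + pose proof (two_power_ge (- a) ltac:(lra)) as P. rewrite Rpower_Ropp in P.
      assert (Hpos : 0 < Rpower 2 a) by (unfold Rpower; apply exp_pos).
      assert (P2 : Rpower 2 a <= (3 + a) / (3 - a)).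
      { rewrite <- (Rinv_inv (Rpower 2 a)).
        replace ((3 + a) / (3 - a)) with (/ ((3 + - a) / (3 - - a))) by (field; lra).
        apply Rinv_le_contravar; [apply Rdiv_lt_0_compat; lra | exact P]. }
      assert (E : (3 + a) / (3 - a) = 1 - 2 * - a / (3 - a)) by (field; lra).
      assert (0 < 2 * - a / (3 - a)) by (apply Rdiv_lt_0_compat; lra).
      replace (a / (2 * (Rpower 2 a - 1))) with (- a / (2 * (1 - Rpower 2 a))) by (field; lra).
      apply Rle_div_l; [lra|].
      replace (- a) with ((3 - a) / 4 * (2 * (2 * - a / (3 - a)))) at 1 by (field; lra).
      apply Rmult_le_compat_l; lra.
Qed.

(** * The Basel series *)

Definition cosI (n : nat) : R := RInt (fun x => cos x ^ (2 * n)) 0 (PI / 2).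
Definition cosJ (n : nat) : R := RInt (fun x => x ^ 2 * cos x ^ (2 * n)) 0 (PI / 2).

Lemma continuous_of_derive (f : R -> R) (f' : R -> R) : (forall x, is_derive f x (f' x)) -> forall x, continuous f x.
Proof. intros H x. apply (ex_derive_continuous f x). eexists; apply H. Qed.

Lemma is_derive_cos_pow n x : is_derive (fun x => cos x ^ n) x (- INR n * cos x ^ pred n * sin x).
Proof. auto_derive; trivial. ring. Qed.

Lemma continuous_cos_pow n x : continuous (fun x => cos x ^ n) x.
Proof. eapply (continuous_of_derive (fun x => cos x ^ n)); intros; apply is_derive_cos_pow. Qed.

Lemma continuous_sq_cos_pow n x : continuous (fun x => x ^ 2 * cos x ^ n) x.
Proof.
  apply (continuous_mult (fun x => x ^ 2) (fun x => cos x ^ n)); [|apply continuous_cos_pow].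
  apply (continuous_of_derive (fun x => x ^ 2) (fun x => 2 * x)). intros y; auto_derive; trivial; ring.
Qed.

Lemma is_RInt_cosI n : is_RInt (fun x => cos x ^ (2 * n)) 0 (PI / 2) (cosI n).
Proof. apply (RInt_correct (V := R_CompleteNormedModule)), ex_RInt_cont, continuous_cos_pow. Qed.

Lemma is_RInt_cosJ n : is_RInt (fun x => x ^ 2 * cos x ^ (2 * n)) 0 (PI / 2) (cosJ n).
Proof. apply (RInt_correct (V := R_CompleteNormedModule)), ex_RInt_cont, continuous_sq_cos_pow. Qed.

Lemma cosI_rec n : (2 * INR n + 2) * cosI (S n) = (2 * INR n + 1) * cosI n.
Proof.
  set (f := fun x => (2 * INR n + 2) * cos x ^ (2 * S n) - (2 * INR n + 1) * cos x ^ (2 * n)).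
  assert (H1 : is_RInt f 0 (PI / 2) ((2 * INR n + 2) * cosI (S n) - (2 * INR n + 1) * cosI n)).
  { apply (is_RInt_minus (V := R_NormedModule)).
    - apply (is_RInt_scal (V := R_NormedModule) (fun x => cos x ^ (2 * S n)) 0 (PI / 2) (2 * INR n + 2)), is_RInt_cosI.
    - apply (is_RInt_scal (V := R_NormedModule) (fun x => cos x ^ (2 * n)) 0 (PI / 2) (2 * INR n + 1)), is_RInt_cosI. }
  (* A primitive of the difference of the two sides, vanishing at both ends. *)
  set (F := fun x => sin x * cos x ^ (2 * n + 1)).
  assert (HF : forall x, is_derive F x (f x)).
  { intros x.
    pose proof (is_derive_Rmult sin _ x _ _ (is_derive_sin x) (is_derive_cos_pow (2 * n + 1) x)) as D.
    replace (f x) with (cos x * cos x ^ (2 * n + 1) + sin x * (- INR (2 * n + 1) * cos x ^ pred (2 * n + 1) * sin x));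
      [exact D|].
    unfold f. replace (pred (2 * n + 1)) with (2 * n)%nat by lia.
    replace (2 * S n)%nat with (2 * n + 2)%nat by lia.
    rewrite !pow_add, plus_INR, mult_INR. change (INR 1) with 1. change (INR 2) with (1 + 1).
    pose proof (sin2_cos2 x) as T. unfold Rsqr in T. set (c := cos x ^ (2 * n)).
    transitivity (c * (cos x ^ 2 - (2 * INR n + 1) * (sin x * sin x))); [ring|].
    replace (sin x * sin x) with (1 - cos x * cos x) by lra. ring. }
  assert (H2 : is_RInt f 0 (PI / 2) (F (PI / 2) - F 0)).
  { apply (is_RInt_derive F f); intros x _; [apply HF|].
    apply (continuous_minus (fun x => (2 * INR n + 2) * cos x ^ (2 * S n)) (fun x => (2 * INR n + 1) * cos x ^ (2 * n)));
      [apply (continuous_scal_r (2 * INR n + 2) (fun x => cos x ^ (2 * S n)))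
      |apply (continuous_scal_r (2 * INR n + 1) (fun x => cos x ^ (2 * n)))]; apply continuous_cos_pow. }
  pose proof (is_RInt_unique _ _ _ _ H1) as E1. pose proof (is_RInt_unique _ _ _ _ H2) as E2.
  rewrite E1 in E2. unfold F in E2. rewrite sin_0, cos_PI2, pow_ne_zero in E2 by lia. lra.
Qed.

Lemma cosJ_rec n : cosI (S n) + 2 * (INR n + 1) ^ 2 * cosJ (S n) = (INR n + 1) * (2 * INR n + 1) * cosJ n.
Proof.
  set (m := INR n + 1).
  set (f := fun x => cos x ^ (2 * S n) + 2 * m ^ 2 * (x ^ 2 * cos x ^ (2 * S n)) - m * (2 * INR n + 1) * (x ^ 2 * cos x ^ (2 * n))).
  assert (H1 : is_RInt f 0 (PI / 2) (cosI (S n) + 2 * m ^ 2 * cosJ (S n) - m * (2 * INR n + 1) * cosJ n)).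
  { apply (is_RInt_minus (V := R_NormedModule)); [apply (is_RInt_plus (V := R_NormedModule)); [apply is_RInt_cosI|]|].
    - apply (is_RInt_scal (V := R_NormedModule) (fun x => x ^ 2 * cos x ^ (2 * S n)) 0 (PI / 2) (2 * m ^ 2)), is_RInt_cosJ.
    - apply (is_RInt_scal (V := R_NormedModule) (fun x => x ^ 2 * cos x ^ (2 * n)) 0 (PI / 2) (m * (2 * INR n + 1))), is_RInt_cosJ. }
  (* Two integrations by parts packed into one primitive, which again vanishes at both ends. *)
  set (F := fun x => x * cos x ^ (2 * n + 2) + m * (x ^ 2 * (sin x * cos x ^ (2 * n + 1)))).
  assert (HF : forall x, is_derive F x (f x)).
  { intros x.
    assert (Dx : is_derive (fun x : R => x) x 1) by apply (is_derive_id (K := R_AbsRing)).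
    assert (Dx2 : is_derive (fun x => x ^ 2) x (2 * x)) by (auto_derive; trivial; ring).
    pose proof (is_derive_Rmult _ _ x _ _ Dx (is_derive_cos_pow (2 * n + 2) x)) as D1.
    pose proof (is_derive_scal _ x m _ (is_derive_Rmult _ _ x _ _ Dx2
      (is_derive_Rmult sin _ x _ _ (is_derive_sin x) (is_derive_cos_pow (2 * n + 1) x)))) as D2.
    pose proof (is_derive_plus _ _ x _ _ D1 D2) as D.
    replace (f x) with
      (1 * cos x ^ (2 * n + 2) + x * (- INR (2 * n + 2) * cos x ^ pred (2 * n + 2) * sin x)
       + m * (2 * x * (sin x * cos x ^ (2 * n + 1))
           + x ^ 2 * (cos x * cos x ^ (2 * n + 1)
               + sin x * (- INR (2 * n + 1) * cos x ^ pred (2 * n + 1) * sin x))));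
      [exact D|].
    unfold f. replace (pred (2 * n + 1)) with (2 * n)%nat by lia.
    replace (pred (2 * n + 2)) with (2 * n + 1)%nat by lia.
    replace (2 * S n)%nat with (2 * n + 2)%nat by lia.
    rewrite !pow_add, !plus_INR, !mult_INR. change (INR 1) with 1. change (INR 2) with (1 + 1).
    pose proof (sin2_cos2 x) as T. unfold Rsqr in T. set (c := cos x ^ (2 * n)). set (k := INR n) in *.
    transitivity (c * cos x ^ 2 + m * (x ^ 2 * (c * (cos x ^ 2 - (2 * k + 1) * (sin x * sin x))))).
    - unfold m. ring.
    - replace (sin x * sin x) with (1 - cos x * cos x) by lra. unfold m. ring. }
  assert (H2 : is_RInt f 0 (PI / 2) (F (PI / 2) - F 0)).
  { apply (is_RInt_derive F f); intros x _; [apply HF|].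
    apply (continuous_minus (fun x => cos x ^ (2 * S n) + 2 * m ^ 2 * (x ^ 2 * cos x ^ (2 * S n)))
       (fun x => m * (2 * INR n + 1) * (x ^ 2 * cos x ^ (2 * n)))).
    - apply (continuous_plus (fun x => cos x ^ (2 * S n)) (fun x => 2 * m ^ 2 * (x ^ 2 * cos x ^ (2 * S n)))).
      + apply continuous_cos_pow.
      + apply (continuous_scal_r (2 * m ^ 2) (fun x => x ^ 2 * cos x ^ (2 * S n))), continuous_sq_cos_pow.
    - apply (continuous_scal_r (m * (2 * INR n + 1)) (fun x => x ^ 2 * cos x ^ (2 * n))), continuous_sq_cos_pow. }
  pose proof (is_RInt_unique _ _ _ _ H1) as E1. pose proof (is_RInt_unique _ _ _ _ H2) as E2.
  rewrite E1 in E2. unfold F in E2. rewrite sin_0, cos_PI2, !(pow_ne_zero) in E2 by lia. lra.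
Qed.

Lemma cosI_0 : cosI 0 = PI / 2.
Proof. unfold cosI. simpl. rewrite RInt_const. unfold scal; simpl; unfold mult; simpl. ring. Qed.

Lemma cosI_pos n : 0 < cosI n.
Proof.
  induction n as [|n IH]; [rewrite cosI_0; pose proof PI_RGT_0; lra|].
  pose proof (cosI_rec n) as E. pose proof (pos_INR n).
  apply Rmult_lt_reg_l with (2 * INR n + 2); [lra|]. rewrite E, Rmult_0_r. apply Rmult_lt_0_compat; lra.
Qed.

Lemma cosJ_0 : cosJ 0 = PI ^ 3 / 24.
Proof.
  unfold cosJ. apply is_RInt_unique.
  replace (PI ^ 3 / 24) with ((fun x => x ^ 3 / 3) (PI / 2) - (fun x => x ^ 3 / 3) 0) by (simpl; field).
  apply (is_RInt_derive (fun x => x ^ 3 / 3) (fun x => x ^ 2 * cos x ^ (2 * 0))).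
  - intros x _. auto_derive; trivial. simpl. field.
  - intros x _. apply continuous_sq_cos_pow.
Qed.

(** Jordan's inequality sin x >= 2x/pi gives x^2 <= (pi^2/4) sin^2 x, and the integral of sin^2
    cos^(2n) is cosI n - cosI (n+1). *)
Lemma cosJ_bounds n : 0 <= cosJ n <= PI ^ 2 / 4 * (cosI n / (2 * INR n + 2)).
Proof.
  pose proof PI_RGT_0 as HP.
  assert (Hc : forall x, 0 < x < PI / 2 -> 0 <= cos x) by (intros; apply cos_ge_0; lra).
  split.
  - replace 0 with (RInt (fun _ => 0) 0 (PI / 2)).
    + apply RInt_le; [lra | apply ex_RInt_const | eexists; apply is_RInt_cosJ |].
      intros x Hx. apply Rmult_le_pos; [apply pow2_ge_0 | apply pow_le; auto].
    + rewrite RInt_const. unfold scal; simpl; unfold mult; simpl. ring.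
  - replace (PI ^ 2 / 4 * (cosI n / (2 * INR n + 2))) with (PI ^ 2 / 4 * (cosI n - cosI (S n))).
    2:{ pose proof (cosI_rec n) as E. pose proof (pos_INR n).
        replace (cosI (S n)) with ((2 * INR n + 2) * cosI (S n) / (2 * INR n + 2)) by (field; lra).
        rewrite E. field. lra. }
    pose proof (is_RInt_scal (V := R_NormedModule) _ _ _ (PI ^ 2 / 4) _
       (is_RInt_minus (V := R_NormedModule) _ _ _ _ _ _ (is_RInt_cosI n) (is_RInt_cosI (S n)))) as H.
    assert (E : RInt (fun y => PI ^ 2 / 4 * (cos y ^ (2 * n) - cos y ^ (2 * S n))) 0 (PI / 2)
                = PI ^ 2 / 4 * (cosI n - cosI (S n))) by exact (is_RInt_unique _ _ _ _ H).
    rewrite <- E. apply RInt_le; [lra | eexists; apply is_RInt_cosJ | eexists; exact H |].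
    intros x Hx.
    assert (Hs : 2 * x / PI <= sin x).
    { pose proof (concave_chord sin cos 0 (PI / 2) 0 (PI / 2) (2 * x / PI)) as K.
      assert (Hl : 0 <= 2 * x / PI <= 1).
      { split; [apply Rdiv_le_0_compat; lra|]. apply Rle_div_l; lra. }
      assert (K' := K ltac:(intros; apply is_derive_sin) ltac:(intros; apply Rlt_le, cos_decreasing_1; lra) ltac:(lra) ltac:(lra) Hl).
      rewrite sin_0, sin_PI2 in K'.
      replace ((1 - 2 * x / PI) * 0 + 2 * x / PI * (PI / 2)) with x in K' by (field; lra). lra. }
    assert (Hx2 : x * x <= PI * PI / 4 * (sin x * sin x)).
    { assert (0 <= 2 * x / PI) by (apply Rdiv_le_0_compat; lra).
      replace (x * x) with (PI * PI / 4 * (2 * x / PI * (2 * x / PI))) by (field; lra).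
      apply Rmult_le_compat_l; [nra|]. apply Rmult_le_compat; lra. }
    replace (2 * S n)%nat with (2 * n + 2)%nat by lia. rewrite pow_add.
    pose proof (pow_le _ (2 * n) (Hc x Hx)) as Hpw.
    pose proof (sin2_cos2 x) as T. unfold Rsqr in T.
    set (c := cos x ^ (2 * n)) in *.
    replace (PI ^ 2 / 4 * (c - c * cos x ^ 2)) with (PI * PI / 4 * (1 - cos x * cos x) * c) by field.
    replace (1 - cos x * cos x) with (sin x * sin x) by lra.
    apply Rmult_le_compat_r; [exact Hpw|]. simpl. lra.
Qed.

(* Daners' proof: the ratios of [int x^2 cos^(2n)] to [int cos^(2n)] telescope. *)
Lemma Basel : is_series (fun n => / INR (S n) ^ 2) (PI ^ 2 / 6).
Proof.
  pose proof PI_RGT_0 as HP.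
  assert (Hsum : forall n, sum_n (fun n => / INR (S n) ^ 2) n = PI ^ 2 / 6 - 2 * (cosJ (S n) / cosI (S n))).
  { assert (Step : forall n, / INR (S n) ^ 2 = 2 * (cosJ n / cosI n) - 2 * (cosJ (S n) / cosI (S n))).
    { intros n. pose proof (cosI_rec n) as E1. pose proof (cosJ_rec n) as E2.
      pose proof (cosI_pos n). pose proof (cosI_pos (S n)). pose proof (pos_INR n). rewrite S_INR.
      assert (EJ : cosJ n = (cosI (S n) + 2 * (INR n + 1) ^ 2 * cosJ (S n)) / ((INR n + 1) * (2 * INR n + 1))).
      { rewrite E2. field. lra. }
      assert (EI : cosI n = (2 * INR n + 2) * cosI (S n) / (2 * INR n + 1)).
      { rewrite E1. field. lra. }
      rewrite EJ, EI. field. lra. }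
    induction n as [|n IH].
    - rewrite sum_O, Step, cosJ_0, cosI_0.
      match goal with |- @eq _ ?x ?y => change (@eq R x y) end. pose proof (cosI_pos 1). field. lra.
    - rewrite sum_Sn, IH, (Step (S n)).
      change (PI ^ 2 / 6 - 2 * (cosJ (S n) / cosI (S n)) + (2 * (cosJ (S n) / cosI (S n)) - 2 * (cosJ (S (S n)) / cosI (S (S n))))
        = PI ^ 2 / 6 - 2 * (cosJ (S (S n)) / cosI (S (S n)))). ring. }

  apply is_series_R_eps. intros eps He.
  destruct (INR_unbounded (PI ^ 2 / 2 / eps)) as [N HN].
  exists N. intros n Hn. rewrite Hsum.
  replace (PI ^ 2 / 6 - 2 * (cosJ (S n) / cosI (S n)) - PI ^ 2 / 6) with (- (2 * (cosJ (S n) / cosI (S n)))) by ring.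
  pose proof (cosJ_bounds (S n)) as [B1 B2]. pose proof (cosI_pos (S n)) as HI.
  assert (0 <= cosJ (S n) / cosI (S n)) by (apply Rdiv_le_0_compat; lra).
  rewrite Rabs_Ropp, Rabs_pos_eq by lra.
  apply le_INR in Hn. pose proof (pos_INR n) as Hp.
  rewrite S_INR in B2.
  assert (B3 : cosJ (S n) / cosI (S n) <= PI ^ 2 / 4 / (2 * (INR n + 1) + 2)).
  { apply Rle_div_l; [exact HI|]. eapply Rle_trans; [exact B2|]. right. field. lra. }
  assert (HPP : 0 < PI ^ 2) by (apply pow_lt; lra).
  apply Rlt_div_l in HN; [|lra].
  apply Rle_lt_trans with (2 * (PI ^ 2 / 4 / (2 * (INR n + 1) + 2))); [lra|].
  replace (2 * (PI ^ 2 / 4 / (2 * (INR n + 1) + 2))) with (PI ^ 2 / 2 / (2 * (INR n + 1) + 2)) by (field; lra).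
  apply Rlt_div_l; [lra|]. nra.
Qed.

(** * Convexity of the extremal functions *)

Lemma V_neq_0 a z : -1 < a <= 1 -> Cmod z < 1 -> z <> 0%C -> Vfun a z <> 0%C.
Proof.
  intros Ha Hz Hz0 E. apply (Cmult_neq_0 z (Qfun a z)); [exact Hz0 | now apply Q_neq_0|].
  rewrite zQ_V, E by assumption. ring.
Qed.

Lemma G_inv_Q alpha z : 0 <= alpha < 1 -> Cmod z < 1 -> G alpha z = (/ Qfun (1 - 2 * alpha) z)%C.
Proof.
  intros Ha Hz. set (a := 1 - 2 * alpha). assert (Ha1 : -1 < a <= 1) by (unfold a; lra).
  unfold G. destruct (Ceq_dec z (RtoC 0)) as [->|Hz0].
  { rewrite Qfun_0 by exact Ha1. field. }
  pose proof (V_neq_0 a z Ha1 Hz Hz0) as HV. pose proof (one_minus_neq_0 z Hz) as H1.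
  assert (EQ : Qfun a z = ((1 - z) * Vfun a z / z)%C).
  { rewrite <- zQ_V by assumption. field. exact Hz0. }
  rewrite EQ. destruct (Req_EM_T alpha (1 / 2)) as [E|E].
  - assert (Ea : a = 0) by (unfold a; lra). rewrite Ea in *.
    replace (Clog (1 - z)) with (- Vfun 0 z)%C by (rewrite V_log by exact Hz; ring).
    field. auto.
  - assert (Ea : RtoC a <> 0%C) by (intros E'; apply RtoC_inj in E'; unfold a in E'; lra).
    fold a. replace (Cpower (1 - z) a) with (1 - a * Vfun a z)%C by (rewrite aV_power by assumption; ring).
    replace (2 * alpha - 1) with (- a) by (unfold a; ring). rewrite RtoC_opp.
    replace (1 - a * Vfun a z - 1)%C with (- (a * Vfun a z))%C by ring.
    field. auto.
Qed.

Lemma K_Kfun alpha z : 0 <= alpha < 1 -> Cmod z < 1 -> K alpha z = Kfun (1 - 2 * alpha) z.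
Proof.
  intros Ha Hz. set (a := 1 - 2 * alpha). assert (Ha1 : -1 < a <= 1) by (unfold a; lra).
  unfold K, Kfun. destruct (Req_EM_T alpha (1 / 2)) as [E|E].
  - assert (Ea : a = 0) by (unfold a; lra). rewrite Ea, V_log by exact Hz.
    replace (- RtoC 0)%C with (RtoC 0) by ring. rewrite Cpower_0. ring.
  - assert (Ea : RtoC a <> 0%C) by (intros E'; apply RtoC_inj in E'; unfold a in E'; lra).
    fold a. replace (2 * alpha - 1) with (- a) by (unfold a; ring). rewrite RtoC_opp.
    replace (Vfun a z) with ((a * Vfun a z) / a)%C by (field; exact Ea).
    rewrite aV_power by assumption.
    assert (P : (Cpower (1 - z) (- a) * Cpower (1 - z) a = 1)%C).
    { rewrite <- Cpower_plus. transitivity (Cpower (1 - z) 0); [f_equal; ring | apply Cpower_0]. }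
    transitivity ((Cpower (1 - z) (- a) - Cpower (1 - z) (- a) * Cpower (1 - z) a) / a)%C.
    + rewrite P. reflexivity.
    + field. exact Ea.
Qed.

Lemma class_S_intro f f' : (forall z, Cmod z < 1 -> cder f z (f' z)) ->
  (forall z w, Cmod z < 1 -> Cmod w < 1 -> f z = f w -> z = w) ->
  f 0%C = 0%C -> f' 0%C = 1%C -> class_S f.
Proof.
  intros Hd Hi H0 H1. split; [|split; [|split]].
  - intros z Hz. exists (f' z). now apply cder_is_derive, Hd.
  - exact Hi.
  - exact H0.
  - rewrite <- H1. apply is_C_derive_unique, cder_is_derive, Hd. rewrite Cmod_0; lra.
Qed.

Lemma cder_C_derive f z d : cder f z d -> C_derive f z = d.
Proof. intros H. now apply is_C_derive_unique, cder_is_derive. Qed.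

Lemma disc_ball z w r : Cmod (w - z) < r - Cmod z -> Cmod w < r.
Proof. intros H. pose proof (Cmod_triangle_rev w z). lra. Qed.

(** For |a| <= 1 and a <> 0 the power -a keeps the arguments of the right half-plane inside a strip
    on which the exponential is injective. *)
Lemma K_injective a z w : -1 < a <= 1 -> Cmod z < 1 -> Cmod w < 1 -> Kfun a z = Kfun a w -> z = w.
Proof.
  intros Ha Hz Hw E.
  pose proof (Re_one_minus_pos z Hz) as Hpz. pose proof (Re_one_minus_pos w Hw) as Hpw.
  pose proof (Im_Clog_bound _ Hpz) as Bz. pose proof (Im_Clog_bound _ Hpw) as Bw.
  assert (EL : Clog (1 - z) = Clog (1 - w)).
  { destruct (Req_dec a 0) as [->|Ha0].
    - unfold Kfun in E. replace (- RtoC 0)%C with (RtoC 0) in E by ring.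
      rewrite !Cpower_0, !V_log in E by assumption.
      replace (Clog (1 - z)) with (- (1 * - Clog (1 - z)))%C by ring. rewrite E. ring.
    - assert (Ea : RtoC a <> 0%C) by (intros E'; apply RtoC_inj in E'; lra).
      assert (P : forall x, Cmod x < 1 -> (a * Kfun a x = Cpower (1 - x) (- a) - 1)%C).
      { intros x Hx. unfold Kfun.
        transitivity (Cpower (1 - x) (- a) * (a * Vfun a x))%C; [ring|]. rewrite aV_power by assumption.
        assert (P : (Cpower (1 - x) (- a) * Cpower (1 - x) a = 1)%C).
        { rewrite <- Cpower_plus. transitivity (Cpower (1 - x) 0); [f_equal; ring | apply Cpower_0]. }
        transitivity (Cpower (1 - x) (- a) - Cpower (1 - x) (- a) * Cpower (1 - x) a)%C; [ring|].
        now rewrite P. }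
      assert (E2 : Cpower (1 - z) (- a) = Cpower (1 - w) (- a)).
      { replace (Cpower (1 - z) (- a)) with (a * Kfun a z + 1)%C by (rewrite P by exact Hz; ring).
        rewrite E, P by exact Hw. ring. }
      apply Cexp_inj_strip in E2.
      + replace (Clog (1 - z)) with (- / a * (- a * Clog (1 - z)))%C by (field; exact Ea).
        rewrite E2. field. exact Ea.
      + replace (Im (- a * Clog (1 - z))) with (- a * Im (Clog (1 - z))) by (unfold Im, Re; simpl; ring).
        split; nra.
      + replace (Im (- a * Clog (1 - w))) with (- a * Im (Clog (1 - w))) by (unfold Im, Re; simpl; ring).
        split; nra. }
  apply (f_equal Cexp) in EL. rewrite !Cexp_Clog in EL by assumption.
  replace z with (1 - (1 - z))%C by ring. rewrite EL. ring.
Qed.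

Lemma cosh_scale_le t x : -1 <= t <= 1 -> exp (t * x) + exp (- (t * x)) <= exp x + exp (- x).
Proof.
  intros Ht.
  assert (C : forall l, 0 <= l <= 1 -> exp ((1 - l) * (- x) + l * x) <= (1 - l) * exp (- x) + l * exp x).
  { intros l Hl.
    pose proof (concave_chord (fun u => - exp u) (fun u => - exp u) (Rmin x (- x)) (Rmax x (- x)) (- x) x l) as T.
    cbv beta in T.
    assert ((1 - l) * - exp (- x) + l * - exp x <= - exp ((1 - l) * - x + l * x)); [|lra].
    apply T; [| | split; [apply Rmin_r | apply Rmax_r] | split; [apply Rmin_l | apply Rmax_l] | exact Hl].
    - intros y _. auto_derive; trivial; ring.
    - intros y w _ H _. apply Ropp_le_contravar, Rlt_le, exp_increasing, H. }
  pose proof (C ((1 + t) / 2) ltac:(lra)) as C1. pose proof (C ((1 - t) / 2) ltac:(lra)) as C2.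
  replace ((1 - (1 + t) / 2) * - x + (1 + t) / 2 * x) with (t * x) in C1 by field.
  replace ((1 - (1 - t) / 2) * - x + (1 - t) / 2 * x) with (- (t * x)) in C2 by field.
  lra.
Qed.

Lemma cos_scale_le t y : -1 <= t <= 1 -> - PI <= y <= PI -> cos y <= cos (t * y).
Proof.
  intros Ht Hy.
  assert (A : forall u, cos (Rabs u) = cos u).
  { intros u. unfold Rabs. destruct (Rcase_abs u); [apply cos_neg | reflexivity]. }
  rewrite <- (A y), <- (A (t * y)), Rabs_mult.
  assert (Ht' : Rabs t <= 1) by (apply Rabs_le; lra).
  assert (Hy' : Rabs y <= PI) by (apply Rabs_le; lra).
  pose proof (Rabs_pos t). pose proof (Rabs_pos y). apply cos_decr_1; nra.
Qed.

(** Up to the common scale, this is 2 cosh of the real difference minus 2 cos of the imaginary one.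
    Both terms decrease the total when the difference is scaled by |t| <= 1. *)
Lemma Cmod_Cexp_diff u v :
  Cmod (Cexp u - Cexp v) ^ 2 = exp (Re u + Re v)
    * (exp (Re u - Re v) + exp (- (Re u - Re v)) - 2 * cos (Im u - Im v)).
Proof.
  assert (Em : forall p q, exp (p - q) = exp p / exp q).
  { intros p q. unfold Rminus, Rdiv. now rewrite exp_plus, exp_Ropp. }
  rewrite Cmod2_alt, cos_minus, Ropp_minus_distr, !Em, exp_plus.
  pose proof (exp_pos (Re u)). pose proof (exp_pos (Re v)).
  pose proof (sin2_cos2 (Im u)) as T1. pose proof (sin2_cos2 (Im v)) as T2. unfold Rsqr in *.
  change (Re (Cexp u - Cexp v)) with (exp (Re u) * cos (Im u) + - (exp (Re v) * cos (Im v))).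
  change (Im (Cexp u - Cexp v)) with (exp (Re u) * sin (Im u) + - (exp (Re v) * sin (Im v))).
  set (U := exp (Re u)) in *. set (V := exp (Re v)) in *.
  transitivity (U * U * (sin (Im u) * sin (Im u) + cos (Im u) * cos (Im u))
    + V * V * (sin (Im v) * sin (Im v) + cos (Im v) * cos (Im v))
    - 2 * U * V * (cos (Im u) * cos (Im v) + sin (Im u) * sin (Im v))); [ring|].
  rewrite T1, T2. field. lra.
Qed.

(* If [z (1 - z)^(-s) = w (1 - w)^(-s)] and [e^D = (1 - z)/(1 - w)], then [z = w e^(s D)] and
   [w (e^(s D) - e^D) = 1 - e^D], which forces [|z w| >= 1] unless [D = 0]. *)
Lemma zK'_injective s z w : 0 <= s <= 2 -> Cmod z < 1 -> Cmod w < 1 ->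
  (z * Cpower (1 - z) (- s) = w * Cpower (1 - w) (- s))%C -> z = w.
Proof.
  intros Hs Hz Hw E.
  pose proof (Re_one_minus_pos z Hz) as Hpz. pose proof (Re_one_minus_pos w Hw) as Hpw.
  pose proof (Im_Clog_bound _ Hpz) as Bz. pose proof (Im_Clog_bound _ Hpw) as Bw.
  set (A := Clog (1 - z)) in *. set (B := Clog (1 - w)) in *. set (D := (A - B)%C).
  assert (EA : Cexp A = (1 - z)%C) by now apply Cexp_Clog.
  assert (EB : Cexp B = (1 - w)%C) by now apply Cexp_Clog.
  assert (ED : (Cexp D * (1 - w) = 1 - z)%C).
  { rewrite <- EA, <- EB. rewrite <- Cexp_plus. f_equal. unfold D. ring. }
  assert (Ez : z = (w * Cexp (s * D))%C).
  { assert (Eu : (Cpower (1 - z) (- s) * Cexp (s * A) = 1)%C).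
    { unfold Cpower. fold A. rewrite <- Cexp_plus, <- Cexp_0. f_equal. ring. }
    transitivity (z * (Cpower (1 - z) (- s) * Cexp (s * A)))%C; [rewrite Eu; ring|].
    rewrite Cmult_assoc, E. unfold Cpower. fold B. rewrite <- Cmult_assoc, <- Cexp_plus. f_equal. f_equal.
    unfold D. ring. }
  assert (Ew : (w * (Cexp (s * D) - Cexp D) = 1 - Cexp D)%C).
  { replace (w * (Cexp (s * D) - Cexp D))%C with (w * Cexp (s * D) - 1 + Cexp D * (1 - w) + 1 - Cexp D)%C by ring.
    rewrite <- Ez, ED. ring. }
  destruct (Ceq_dec (1 - Cexp D) 0) as [E0|E0].
  { assert (E1 : Cexp D = 1%C) by (replace (Cexp D) with (1 - (1 - Cexp D))%C by ring; rewrite E0; ring).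
    rewrite E1 in ED. replace z with (1 - (1 - z))%C by ring. rewrite <- ED. ring. }
  exfalso. apply Cmod_gt_0 in E0.
  set (x := Re D). set (y := Im D).
  assert (Hy : - PI <= y <= PI).
  { unfold y, D. change (Im (A - B)) with (Im A - Im B). lra. }
  (* The difference of the exponents is (s - 1) D on the left and -D on the right, and |s - 1| <=
     1. *)
  assert (Claim : Cmod (Cexp (s * D) - Cexp D) ^ 2 <= Cmod (1 - Cexp D) ^ 2 * Cmod (Cexp (s * D))).
  { replace (1 - Cexp D)%C with (Cexp 0 - Cexp D)%C by (now rewrite Cexp_0).
    rewrite !Cmod_Cexp_diff, Cmod_Cexp.
    replace (Re (s * D)) with (s * x) by (unfold x, Re, Im; simpl; ring).
    replace (Im (s * D)) with (s * y) by (unfold y, Re, Im; simpl; ring).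
    fold x y. change (Re 0) with 0. change (Im 0) with 0.
    replace (s * x - x) with ((s - 1) * x) by ring. replace (s * y - y) with ((s - 1) * y) by ring.
    replace (0 - x) with (- x) by ring. replace (0 - y) with (- y) by ring.
    rewrite Ropp_involutive, cos_neg. rewrite (Rplus_comm 0), Rplus_0_r.
    replace (exp x * (exp (- x) + exp x - 2 * cos y) * exp (s * x))
      with (exp (s * x + x) * (exp x + exp (- x) - 2 * cos y)) by (rewrite exp_plus; ring).
    apply Rmult_le_compat_l; [apply Rlt_le, exp_pos|].
    pose proof (cosh_scale_le (s - 1) x ltac:(lra)). pose proof (cos_scale_le (s - 1) y ltac:(lra) Hy). lra. }
  set (d := Cmod (Cexp (s * D) - Cexp D)) in *. set (e := Cmod (1 - Cexp D)) in *.
  assert (Em : Cmod w * d = e) by (unfold d, e; rewrite <- Cmod_mult; now rewrite Ew).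
  assert (Ezm : Cmod z = Cmod w * Cmod (Cexp (s * D))) by (rewrite <- Cmod_mult; now rewrite <- Ez).
  set (k := Cmod (Cexp (s * D))) in *.
  assert (Hww := Cmod_ge_0 w). assert (Hzz := Cmod_ge_0 z).
  assert (H1 : e ^ 2 <= Cmod w * Cmod z * e ^ 2).
  { rewrite <- Em at 1. rewrite Ezm. replace ((Cmod w * d) ^ 2) with (Cmod w ^ 2 * d ^ 2) by ring.
    replace (Cmod w * (Cmod w * k) * e ^ 2) with (Cmod w ^ 2 * (e ^ 2 * k)) by ring.
    apply Rmult_le_compat_l; [apply pow2_ge_0 | exact Claim]. }
  assert (He2 : 0 < e ^ 2) by (apply pow_lt; exact E0).
  assert (Cmod w * Cmod z < 1) by nra. nra.
Qed.

(** The constant alpha plus a multiple of the Poisson kernel at 1, which is small near the circle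
    away from 1. *)
Lemma Re_h a w : Cmod w < 1 ->
  Re (hfun a w) = (1 - a) / 2 + (1 + a) / 2 * (1 - Cmod w ^ 2) / Cmod (1 - w) ^ 2.
Proof.
  intros Hw. pose proof (one_minus_neq_0 w Hw) as Hn.
  assert (HM : 0 < Cmod (1 - w) ^ 2) by (apply pow_lt; now apply Cmod_gt_0).
  assert (E : Re (hfun a w) = ((1 + a * Re w) * (1 - Re w) - a * Im w * Im w) / Cmod (1 - w) ^ 2).
  { unfold hfun, Cdiv. rewrite Re_Cmult.
    change (Re (/ (1 - w))) with (Re (1 - w) / (Re (1 - w) ^ 2 + Im (1 - w) ^ 2)).
    change (Im (/ (1 - w))) with (- Im (1 - w) / (Re (1 - w) ^ 2 + Im (1 - w) ^ 2)).
    rewrite <- Cmod2_alt. set (M := Cmod (1 - w) ^ 2) in *.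
    unfold Re, Im; simpl. field. lra. }
  rewrite E. set (M := Cmod (1 - w) ^ 2) in *. apply Rmult_eq_reg_r with M; [|lra].
  replace (((1 - a) / 2 + (1 + a) / 2 * (1 - Cmod w ^ 2) / M) * M)
    with ((1 - a) / 2 * M + (1 + a) / 2 * (1 - Cmod w ^ 2)) by (field; lra).
  replace (((1 + a * Re w) * (1 - Re w) - a * Im w * Im w) / M * M)
    with ((1 + a * Re w) * (1 - Re w) - a * Im w * Im w) by (field; lra).
  unfold M. rewrite !Cmod2_alt. unfold Re, Im; simpl. field.
Qed.

Lemma Re_h_gt a w : -1 < a -> Cmod w < 1 -> (1 - a) / 2 < Re (hfun a w).
Proof.
  intros Ha Hw. rewrite Re_h by exact Hw. pose proof (one_minus_neq_0 w Hw) as Hn.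
  assert (HM : 0 < Cmod (1 - w) ^ 2) by (apply pow_lt; now apply Cmod_gt_0).
  pose proof (Cmod_ge_0 w). assert (Cmod w ^ 2 < 1) by (simpl; nra).
  assert (0 < (1 + a) / 2 * (1 - Cmod w ^ 2) / Cmod (1 - w) ^ 2); [|lra].
  apply Rdiv_lt_0_compat; [apply Rmult_lt_0_compat; lra | exact HM].
Qed.

(** The class asks for univalence of both K and z K'; each is proved directly, and the real part
    condition is that of h. *)
Lemma convex_K a f : -1 < a <= 1 -> (forall z, Cmod z < 1 -> f z = Kfun a z) ->
  convex_of_order ((1 - a) / 2) f.
Proof.
  intros Ha Hf. set (k' := fun z => Cpower (1 - z) (- (1 + a))).
  assert (Hd : forall z, Cmod z < 1 -> cder f z (k' z)).
  { intros z Hz. apply (cder_ext_loc (Kfun a) _ _ _ (1 - Cmod z)); [lra | | now apply cder_K].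
    intros w Hw. symmetry. apply Hf. now apply (disc_ball z). }
  assert (Hz0 : Cmod 0 < 1) by (rewrite Cmod_0; lra).
  assert (Hk0 : k' 0%C = 1%C).
  { unfold k'. replace (1 - 0)%C with (RtoC 1) by ring. apply Cpower_one. }
  assert (HC : forall z, Cmod z < 1 -> C_derive f z = k' z).
  { intros z Hz. apply cder_C_derive; auto. }
  set (g := fun z => (z * C_derive f z)%C).
  set (g' := fun z => (k' z * hfun a z)%C).
  assert (Hg : forall z, Cmod z < 1 -> cder g z (g' z)).
  { intros z Hz. apply (cder_ext_loc (fun z => z * k' z)%C _ _ _ (1 - Cmod z)); [lra | |].
    - intros w Hw. unfold g. rewrite HC; [reflexivity | now apply (disc_ball z)].
    - eapply cder_eq; [apply cder_mult; [apply cder_id | now apply cder_Cpower_one_minus]|].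
      cbv beta. fold (k' z). pose proof (one_minus_neq_0 z Hz) as Hn.
      replace (Cpower (1 - z) (- (1 + RtoC a) - 1)) with (k' z / (1 - z))%C.
      + unfold g', hfun. field. exact Hn.
      + unfold k'. rewrite <- (Cpower_succ (1 - z) (- (1 + RtoC a) - 1) (- (1 + RtoC a)))
          by (try (now apply Re_one_minus_pos); ring). field. exact Hn. }
  split; [|split].
  - apply (class_S_intro f k'); auto.
    + intros z w Hz Hw E. rewrite !Hf in E by assumption. exact (K_injective a z w Ha Hz Hw E).
    + rewrite Hf by exact Hz0. unfold Kfun. rewrite (pser_0 1 _ _ ltac:(lra) (pser_V a Ha)). simpl. ring.
  - apply (class_S_intro g g'); auto.
    + intros z w Hz Hw E. unfold g in E. rewrite !HC in E by assumption.
      apply (zK'_injective (1 + a)); try assumption; [lra|]. unfold k' in E. rewrite RtoC_plus. exact E.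
    + unfold g. ring.
    + unfold g'. rewrite Hk0. unfold hfun. replace (1 - 0)%C with (RtoC 1) by ring. field.
  - intros z Hz Hzn. fold g. rewrite (cder_C_derive g z _ (Hg z Hz)).
    rewrite HC by exact Hz. assert (Hk : k' z <> 0%C) by apply Cpower_neq_0.
    replace (z * g' z / (z * k' z))%C with (hfun a z); [apply Re_h_gt; [lra | exact Hz]|].
    unfold g'. field. auto.
Qed.

(** * Logarithmic coefficients *)

(** The branch L is built backwards, by solving z L' = G - 1 on coefficients. That e^L is K/z
    follows because e^(-L) K/z has zero derivative. *)
Lemma log_coefficients_K a f d : -1 < a <= 1 -> (forall z, Cmod z < 1 -> f z = Kfun a z) ->
  pser 1 (fun z => / Qfun a z)%C (fun n => RtoC (d n)) -> d O = 1 -> (forall n, 0 <= d (S n) <= 1) ->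
  log_coefficients f (fun n => RtoC (d n / (2 * INR n))).
Proof.
  intros Ha Hf Hd Hd0 Hdb.
  set (lc := fun n => match n with O => RtoC 0 | S m => RtoC (d (S m) / INR (S m)) end).
  assert (HINR : forall n, 1 <= INR (S n)) by (intros n; rewrite S_INR; pose proof (pos_INR n); lra).
  assert (HL : pser 1 (PS lc) lc).
  { apply cbd_pser, (cbd_of_bound _ 1). intros [|n]; unfold lc; [rewrite Cmod_0; lra|].
    pose proof (HINR n). specialize (Hdb n).
    rewrite Cmod_R, Rabs_pos_eq by (apply Rdiv_le_0_compat; lra). apply Rle_div_l; lra. }
  set (L := PS lc) in *. set (L' := PS (dseq lc)).
  pose proof (pser_dseq 1 _ _ ltac:(lra) HL) as HL'. fold L' in HL'.
  assert (EL' : forall z, Cmod z < 1 -> (1 + z * L' z = / Qfun a z)%C).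
  { intros z Hz.
    refine (pser_eq 1 (fun z => 1 + z * L' z)%C (fun z => / Qfun a z)%C _ _ z
      (pser_plus _ _ _ _ _ (pser_const 1 1) (pser_mult_z _ _ _ HL')) Hd _ Hz).
    intros [|n]; [rewrite Hd0; ring|]. unfold dseq, lc. pose proof (HINR n).
    rewrite RtoC_div by lra. field. intros E; apply RtoC_inj in E; lra. }
  assert (L0 : L 0%C = 0%C) by (rewrite (pser_0 1 _ _ ltac:(lra) HL); reflexivity).
  pose proof (pser_V a Ha) as HV.
  pose proof (pser_shift 1 _ _ ltac:(lra) HV) as HT. set (T := PS (fun n => Vcoef a (S n))) in *.
  assert (EV : forall z, Cmod z < 1 -> Vfun a z = (z * T z)%C).
  { intros z Hz. rewrite (pser_factor 1 _ _ z HV Hz). fold T. simpl. ring. }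
  set (T' := PS (dseq (fun n => Vcoef a (S n)))).
  (* With T = V/z the second factor is K/z. The derivative is shown to vanish after dividing by x,
     hence only away from 0. *)
  assert (EM : forall z, Cmod z < 1 -> (Cexp (- L z) * (Cpower (1 - z) (- a) * T z) = 1)%C).
  { intros z Hz.
    rewrite (cder_zero_const (fun z => Cexp (- L z) * (Cpower (1 - z) (- a) * T z))%C 1) with (z := z); [| |exact Hz].
    - cbv beta. rewrite L0. replace (- 0)%C with (RtoC 0) by ring. rewrite Cexp_0.
      replace (1 - 0)%C with (RtoC 1) by ring. rewrite Cpower_one.
      rewrite (pser_0 1 _ _ ltac:(lra) HT). simpl. ring.
    - intros x Hx. eexists. split.
      + apply cder_mult; [apply (cder_comp Cexp (fun z => - L z)%C); [apply cder_Cexp | apply cder_opp, (pser_cder 1 _ _ x HL Hx)]|].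
        apply cder_mult; [now apply cder_Cpower_one_minus | apply (pser_cder 1 _ _ x HT Hx)].
      + intros Hx0. cbv beta. fold L' T'. pose proof (one_minus_neq_0 x Hx) as Hn.
        assert (EQ : Qfun a x = ((1 - x) * T x)%C).
        { transitivity (x * Qfun a x / x)%C; [field; exact Hx0|].
          rewrite zQ_V, EV by assumption. field. exact Hx0. }
        assert (HTx : T x <> 0%C).
        { intros E. apply (Q_neq_0 a x Ha Hx). rewrite EQ, E. ring. }
        assert (ET' : (T x + x * T' x = (1 - a * (x * T x)) / (1 - x))%C).
        { rewrite <- EV, <- V_ode by assumption.
          transitivity (PS (dseq (Vcoef a)) x); [|field; exact Hn].
          apply (cder_unique (Vfun a) x); [|apply (pser_cder 1 _ _ x HV Hx)].
          apply (cder_ext_loc (fun z => z * T z)%C _ _ _ (1 - Cmod x)); [lra | |].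
          - intros w Hw. symmetry. apply EV. now apply (disc_ball x).
          - eapply cder_eq; [apply cder_mult; [apply cder_id | apply (pser_cder 1 _ _ x HT Hx)]|].
            cbv beta. fold T'. ring. }
        assert (EP : Cpower (1 - x) (- RtoC a - 1) = (Cpower (1 - x) (- a) / (1 - x))%C).
        { rewrite <- (Cpower_succ (1 - x) (- RtoC a - 1) (- RtoC a))
            by (try (now apply Re_one_minus_pos); ring). field. exact Hn. }
        rewrite EP. set (P := Cpower (1 - x) (- a)). set (E := Cexp (- L x)).
        transitivity (E * P / x * ((T x + x * T' x) - (1 + x * L' x) * T x + a * (x * T x) / (1 - x)))%C.
        * field. auto.
        * rewrite ET', EL', EQ by exact Hx. field. auto. }
  assert (EK : forall z, Cmod z < 1 -> Kfun a z = (z * Cexp (L z))%C).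
  { intros z Hz. unfold Kfun. rewrite EV by exact Hz.
    assert (EE : (Cexp (L z) * Cexp (- L z) = 1)%C).
    { rewrite Cexp_opp. apply Cinv_r, Cexp_neq_0. }
    transitivity (z * (Cexp (L z) * Cexp (- L z)) * (Cpower (1 - z) (- a) * T z))%C; [rewrite EE; ring|].
    transitivity (z * Cexp (L z) * (Cexp (- L z) * (Cpower (1 - z) (- a) * T z)))%C; [ring|].
    rewrite EM by exact Hz. ring. }
  exists L. split; [split; [|split]|].
  - intros z Hz. eexists. apply cder_is_derive, (pser_cder 1 _ _ z HL Hz).
  - exact L0.
  - intros z Hz Hz0. rewrite Hf, EK by exact Hz. field. exact Hz0.
  - intros z Hz. pose proof (is_cseries_scal (RtoC (1 / 2)) _ _ (is_cseries_S _ _ (HL z Hz))) as H.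
    replace (RtoC (1 / 2) * L z)%C with (RtoC (1 / 2) * (L z - lc O * z ^ 0))%C by (simpl; ring).
    eapply is_cseries_ext; [|exact H]. intros n. cbv beta. unfold lc.
    pose proof (HINR n). rewrite Cmult_assoc, <- RtoC_mult. do 2 f_equal. field. lra.
Qed.

Lemma Abel_comparison (A B c : nat -> R) :
  (forall n, sum_n A n <= sum_n B n) -> (forall n, 0 <= c (S n) <= c n) ->
  forall n, sum_n (fun k => c k * A k) n <= sum_n (fun k => c k * B k) n.
Proof.
  intros H Hc.
  (* The induction keeps the slack of the partial sums, weighted by the current c n; as c decreases,
     it can only shrink at the next step. *)
  assert (P : forall n, sum_n (fun k => c k * A k) n + c n * (sum_n B n - sum_n A n)
                        <= sum_n (fun k => c k * B k) n).
  { induction n as [|n IH].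
    - rewrite !sum_O. lra.
    - rewrite !sum_Sn. unfold plus; cbn [AbelianMonoid.plus].
      change (sum_n (fun k => c k * A k) n + c (S n) * A (S n)
        + c (S n) * (sum_n B n + B (S n) - (sum_n A n + A (S n)))
        <= sum_n (fun k => c k * B k) n + c (S n) * B (S n)).
      specialize (H n). specialize (Hc n). nra. }
  intros n. specialize (P n). specialize (H n).
  assert (0 <= c n) by (specialize (Hc n); lra). nra.
Qed.

Lemma nsum_sum_n a n : nsum a (S n) 1 = sum_n (fun k => Cmod (a k) ^ 2) n.
Proof.
  induction n as [|n IH].
  - rewrite sum_O. cbn [nsum]. rewrite pow1. ring.
  - rewrite sum_Sn, <- IH.
    change (nsum a (S (S n)) 1) with (nsum a (S n) 1 + Cmod (a (S n)) ^ 2 * 1 ^ (2 * S n)).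
    rewrite pow1, Rmult_1_r. reflexivity.
Qed.

(** * Subordination and the coefficient bound *)

Lemma convex_subordination a p pc : -1 < a <= 1 ->
  pser 1 p pc -> p 0%C = 1%C -> (forall z, Cmod z < 1 -> p z <> 0%C) ->
  (forall z, Cmod z < 1 -> (1 - a) / 2 < Re (p z + z * PS (dseq pc) z / p z)) ->
  exists g b, pser 1 g b /\ (forall z, Cmod z < 1 -> Cmod (g z) <= 1) /\
    forall z, Cmod z < 1 -> (/ p z = Qfun a (z * g z))%C.
Proof.
  intros Ha Hp Hp0 Hpn HP. set (p' := PS (dseq pc)) in *.
  pose proof (pser_dseq 1 _ _ ltac:(lra) Hp) as Hp'. fold p' in Hp'.
  assert (Dq : forall z, Cmod z < 1 -> cder (fun z => / p z)%C z (- / (p z * p z) * p' z)).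
  { intros z Hz. exact (cder_comp Cinv p z _ _ (cder_inv _ (Hpn z Hz)) (pser_cder 1 _ _ z Hp Hz)). }
  destruct (hol_pser 1 (fun z => / p z)%C (fun z => (-1) * / (p z * p z) * p' z)%C ltac:(lra)) as [qa Hq].
  { intros z Hz. split.
    - eapply cder_eq; [now apply Dq|]. ring.
    - apply ccont_mult; [apply ccont_mult; [apply ccont_const|] | apply (pser_ccont 1 _ _ z Hp' Hz)].
      apply (ccont_comp Cinv (fun z => p z * p z)%C); [apply ccont_inv; now apply Cmult_neq_0; auto|].
      apply ccont_mult; apply (pser_ccont 1 _ _ z Hp Hz). }
  assert (Eq' : forall z, Cmod z < 1 -> PS (dseq qa) z = (- / (p z * p z) * p' z)%C).
  { intros z Hz. eapply cder_unique; [apply (pser_cder 1 _ _ z Hq Hz) | now apply Dq]. }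
  apply (Miller_Mocanu (Qfun a) (Qcoef a) (fun z => / p z)%C qa (Q_conformal a Ha) Hq).
  { rewrite Hp0, Qfun_0 by exact Ha. field. }
  intros r1 Hr1.
  set (P := fun z => (p z + z * p' z / p z)%C) in *.
  assert (HPc : forall z, Cmod z < 1 -> ccont P z).
  { intros z Hz. pose proof (pser_ccont 1 _ _ z Hp Hz) as C1.
    apply ccont_plus; [exact C1|]. apply ccont_mult.
    - apply ccont_mult; [apply ccont_id | apply (pser_ccont 1 _ _ z Hp' Hz)].
    - apply (ccont_comp Cinv p); [apply ccont_inv; now apply Hpn | exact C1]. }
  destruct (disc_min (fun z => Re (P z)) r1 (proj1 Hr1)) as [z1 [Hz1 Hmin]].
  { intros z Hz. apply ccontR_Re, HPc. lra. }
  destruct (disc_max (fun z => Cmod (p z)) r1 (proj1 Hr1)) as [z2 [Hz2 Hmax]].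
  { intros z Hz. apply ccontR_Cmod, (pser_ccont 1 _ _ z Hp). lra. }
  pose proof (HP z1 ltac:(lra)) as HPz1. fold (P z1) in HPz1.
  assert (Hpz2 : 0 < Cmod (p z2)) by (apply Cmod_gt_0, Hpn; lra).
  (* On |z| <= r1 the value Q w = 1/p z is at least 1/max|p| in modulus, which keeps w at distance
     [eta] from 1. *)
  destruct (Q_to_0 a (/ Cmod (p z2)) Ha (Rinv_0_lt_compat _ Hpz2)) as [eta [Heta Heta2]].
  destruct (Re_inv_Q_gt a Ha) as [kappa [Hk1 Hk2]].
  (* The smaller of the two margins above alpha: that of Re P on |z| <= r1 and that of Re (1/Q) on
     the disc. *)
  set (mu := Rmin (Re (P z1) - (1 - a) / 2) (kappa - (1 - a) / 2)).
  assert (Hmu : 0 < mu /\ mu <= Re (P z1) - (1 - a) / 2 /\ mu <= kappa - (1 - a) / 2).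
  { unfold mu. split; [apply Rmin_pos; lra|]. split; [apply Rmin_l | apply Rmin_r]. }
  assert (Heta3 : 0 < mu * eta ^ 2) by (apply Rmult_lt_0_compat; [lra | apply pow_lt; exact Heta]).
  (* For |w| > 1 - th one has 1 - |w|^2 < 2 th <= mu eta^2, so the Poisson term of Re h stays below
     mu. *)
  set (th := Rmin (1 / 2) (mu * eta ^ 2 / 2)).
  assert (Hth : 0 < th /\ th <= 1 / 2 /\ th <= mu * eta ^ 2 / 2).
  { unfold th. split; [apply Rmin_pos; lra|]. split; [apply Rmin_l | apply Rmin_r]. }
  exists (1 - th). split; [lra|].
  intros z w m Hz Hw Hqw Hm E.
  assert (Hz1' : Cmod z < 1) by lra. assert (Hw1 : Cmod w < 1) by lra.
  pose proof (Hpn z Hz1') as Hpz. pose proof (Q_neq_0 a w Ha Hw1) as HQw.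
  assert (Hetaw : eta <= Cmod (1 - w)).
  { apply Heta2; [exact Hw1|]. rewrite <- Hqw, Cmod_inv by exact Hpz.
    apply Rinv_le_contravar; [now apply Cmod_gt_0 | apply Hmax; exact Hz]. }
  assert (Hh : Re (hfun a w) < (1 - a) / 2 + mu).
  { rewrite Re_h by exact Hw1. apply Rplus_lt_compat_l.
    assert (Heta4 : eta ^ 2 <= Cmod (1 - w) ^ 2) by (apply pow_incr; lra).
    assert (0 < eta ^ 2) by (apply pow_lt; exact Heta).
    apply Rlt_div_l; [lra|].
    assert (mu * eta ^ 2 <= mu * Cmod (1 - w) ^ 2) by (apply Rmult_le_compat_l; lra).
    pose proof (Cmod_ge_0 w). assert (1 - Cmod w ^ 2 < 2 * th) by (simpl; nra).
    assert (0 <= 1 - Cmod w ^ 2) by (simpl; nra).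
    assert ((1 + a) / 2 * (1 - Cmod w ^ 2) <= 1 * (1 - Cmod w ^ 2)) by (apply Rmult_le_compat_r; lra).
    lra. }
  (* As z (1/p)' = 1 - P/p and z Q' = 1 - h Q, the forbidden relation becomes a formula for P in
     terms of h and 1/Q at w. *)
  rewrite Eq', zQ'_eq in E by assumption.
  assert (EP : (P z = hfun a w + RtoC (m - 1) * (hfun a w - / Qfun a w))%C).
  { assert (EP1 : (1 - P z * / p z = RtoC m * (1 - hfun a w * Qfun a w))%C).
    { rewrite <- E. unfold P. field. exact Hpz. }
    rewrite Hqw in EP1. 
    transitivity ((1 - (1 - P z * Qfun a w)) / Qfun a w)%C; [field; exact HQw|].
    rewrite EP1, RtoC_minus. field. exact HQw. }
  pose proof (Hmin z Hz) as HRe. rewrite EP in HRe.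
  replace (Re (hfun a w + RtoC (m - 1) * (hfun a w - / Qfun a w)))
    with (Re (hfun a w) + (m - 1) * (Re (hfun a w) - Re (/ Qfun a w))) in HRe by (unfold Re, Im; simpl; ring).
  pose proof (Hk2 w Hw1). nra.
Qed.

(** The default value of division matters: at a zero of p the quotient in the starlikeness condition
    equals 0, which does not exceed alpha >= 0, so p has no zero. *)
Lemma Cdiv_0_r x : (x / 0)%C = 0%C.
Proof.
  unfold Cdiv. replace (/ 0)%C with (RtoC 0); [ring|].
  unfold Cinv, RtoC; simpl. f_equal; unfold Rdiv; ring.
Qed.

(** Stated for partial sums, so that convergence of the series of |gamma_n|^2 is a consequence. *)
Lemma log_coefficients_bound a f gamma d n : -1 < a <= 1 ->
  pser 1 (fun z => / Qfun a z)%C (fun n => RtoC (d n)) ->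
  convex_of_order ((1 - a) / 2) f -> log_coefficients f gamma ->
  sum_n (fun k => Cmod (gamma (S k)) ^ 2) n
    <= sum_n (fun k => 1 / 4 * (d (S k) ^ 2 / INR (S k) ^ 2)) n.
Proof.
  intros Ha Hd [[_ [_ [Hf0 _]]] [_ Hst]] [L [[_ [_ HLf]] HLs]].
  set (lc := fun n => match n with O => RtoC 0 | S _ => (2 * gamma n)%C end).
  assert (HL : pser 1 L lc).
  { intros z Hz. pose proof (is_cseries_scal 2 _ _ (HLs z Hz)) as H.
    replace (L z) with (lc O * z ^ 0 + 2 * (RtoC (1 / 2) * L z))%C.
    - apply (is_cseries_S_rev (fun n => lc n * z ^ n)%C). eapply is_cseries_ext; [|exact H].
      intros k. cbv beta. unfold lc. ring.
    - simpl. rewrite RtoC_div by lra. field. }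
  set (L' := PS (dseq lc)). pose proof (pser_dseq 1 _ _ ltac:(lra) HL) as HL'. fold L' in HL'.
  set (p := fun z => (1 + z * L' z)%C).
  (* Since z f'/f = 1 + z L', the coefficient of z^n is n times that of L, that is 2 n gamma_n. *)
  set (pc := fun n => match n with O => RtoC 1 | S m => dseq lc m end).
  assert (Hp : pser 1 p pc).
  { intros z Hz. eapply is_cseries_ext;
      [|exact (pser_plus _ _ _ _ _ (pser_const 1 1) (pser_mult_z _ _ _ HL') z Hz)].
    intros [|k]; unfold pc; cbv beta; ring. }
  set (p' := PS (dseq pc)).
  assert (Hp0 : p 0%C = 1%C) by (unfold p; ring).
  assert (Hf : forall z, Cmod z < 1 -> f z = (z * Cexp (L z))%C).
  { intros z Hz. destruct (Ceq_dec z 0) as [->|Hz0]; [rewrite Hf0; ring|].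
    rewrite HLf by assumption. field. exact Hz0. }
  assert (DE : forall z, Cmod z < 1 -> cder (fun z => Cexp (L z)) z (Cexp (L z) * L' z)).
  { intros z Hz. apply (cder_comp Cexp L); [apply cder_Cexp | apply (pser_cder 1 _ _ z HL Hz)]. }
  assert (HCf : forall z, Cmod z < 1 -> C_derive f z = (Cexp (L z) * p z)%C).
  { intros z Hz. apply cder_C_derive.
    apply (cder_ext_loc (fun z => z * Cexp (L z))%C _ _ _ (1 - Cmod z)); [lra | |].
    - intros w Hw. symmetry. apply Hf. now apply (disc_ball z).
    - eapply cder_eq; [apply cder_mult; [apply cder_id | now apply DE]|]. unfold p. cbv beta. ring. }
  assert (HCg : forall z, Cmod z < 1 ->
     C_derive (fun z => z * C_derive f z)%C z = (Cexp (L z) * (p z * p z + z * p' z))%C).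
  { intros z Hz. apply cder_C_derive.
    apply (cder_ext_loc (fun z => z * (Cexp (L z) * p z))%C _ _ _ (1 - Cmod z)); [lra | |].
    - intros w Hw. rewrite HCf; [reflexivity | now apply (disc_ball z)].
    - eapply cder_eq; [apply cder_mult; [apply cder_id | apply cder_mult; [now apply DE | apply (pser_cder 1 _ _ z Hp Hz)]]|].
      cbv beta. fold p'. transitivity (Cexp (L z) * (p z * (1 + z * L' z) + z * p' z))%C; [ring|]. reflexivity. }
  assert (Hpn : forall z, Cmod z < 1 -> p z <> 0%C).
  { intros z Hz E. destruct (Ceq_dec z 0) as [->|Hz0].
    - rewrite Hp0 in E. apply RtoC_inj in E. lra.
    - specialize (Hst z Hz Hz0). cbv beta in Hst. rewrite HCf, E in Hst by exact Hz.
      replace (z * (Cexp (L z) * 0))%C with (RtoC 0) in Hst by ring. rewrite Cdiv_0_r in Hst.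
      change (Re 0) with 0 in Hst. lra. }
  assert (HP : forall z, Cmod z < 1 -> (1 - a) / 2 < Re (p z + z * p' z / p z)).
  { intros z Hz. destruct (Ceq_dec z 0) as [->|Hz0].
    - rewrite Hp0. replace (1 + 0 * p' 0%C / 1)%C with (RtoC 1) by field. change (Re 1) with 1. lra.
    - specialize (Hst z Hz Hz0). cbv beta in Hst. rewrite HCg, HCf in Hst by exact Hz.
      replace (p z + z * p' z / p z)%C
        with (z * (Cexp (L z) * (p z * p z + z * p' z)) / (z * (Cexp (L z) * p z)))%C; [exact Hst|].
      pose proof (Cexp_neq_0 (L z)). pose proof (Hpn z Hz). field. auto. }
  destruct (convex_subordination a p pc Ha Hp Hp0 Hpn HP) as [g [b [Hg [Hg1 Hpg]]]].
  assert (Hn : forall n, nsum pc n 1 <= nsum (fun n => RtoC (d n)) n 1).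
  { intros k. apply (Rogosinski _ g b (fun z => / Qfun a z)%C p pc k Hd Hg Hg1 Hp).
    intros z Hz. rewrite <- Hpg by exact Hz. field. now apply Hpn. }
  assert (E0 : pc O = RtoC (d O)).
  { rewrite <- (pser_0 1 _ _ ltac:(lra) Hd), Qfun_0 by exact Ha. unfold pc. field. }
  apply Rle_trans with (sum_n (fun k => / (4 * INR (S k) ^ 2) * Cmod (pc (S k)) ^ 2) n).
  - right. apply sum_n_ext. intros k. unfold pc, dseq, lc.
    rewrite !Cmod_mult, !Cmod_R, (Rabs_pos_eq 2), (Rabs_pos_eq (INR (S k))) by (try apply pos_INR; lra).
    assert (0 < INR (S k)) by (apply lt_0_INR; lia).
    match goal with |- @eq _ ?x ?y => change (@eq R x y) end. field. lra.
  - apply Rle_trans with (sum_n (fun k => / (4 * INR (S k) ^ 2) * Cmod (RtoC (d (S k))) ^ 2) n).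
    + apply (Abel_comparison (fun k => Cmod (pc (S k)) ^ 2) (fun k => Cmod (RtoC (d (S k))) ^ 2)
         (fun k => / (4 * INR (S k) ^ 2))).
      (* The equal constant terms cancel, which leaves the sums starting at index 1. *)
      * intros k. pose proof (Hn (S (S k))) as H. rewrite !(nsum_S_shift _ (S k)), E0, !nsum_sum_n in H. lra.
      * intros k. rewrite (S_INR (S k)). assert (H : 0 < INR (S k)) by (apply lt_0_INR; lia).
        assert (0 < INR (S k) ^ 2) by (apply pow_lt; exact H).
        assert (INR (S k) ^ 2 <= (INR (S k) + 1) ^ 2) by (apply pow_incr; lra).
        split; [apply Rlt_le, Rinv_0_lt_compat; lra|]. apply Rinv_le_contravar; lra.
    + right. apply sum_n_ext. intros k. rewrite Cmod_R, pow2_abs.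
      assert (0 < INR (S k)) by (apply lt_0_INR; lia).
      match goal with |- @eq _ ?x ?y => change (@eq R x y) end. field. lra.
Qed.

Lemma ex_series_of_bounded (a : nat -> R) B : (forall n, 0 <= a n) -> (forall n, sum_n a n <= B) ->
  ex_series a /\ Series a <= B.
Proof.
  intros Ha HB.
  assert (Hex : ex_series a).
  { destruct (ex_finite_lim_seq_incr (sum_n a) B) as [l Hl]; [|exact HB|exists l; exact Hl].
    intros n. rewrite sum_Sn. specialize (Ha (S n)). change (sum_n a n <= sum_n a n + a (S n)). lra. }
  split; [exact Hex|]. apply Series_correct in Hex.
  apply (is_lim_seq_le (sum_n a) (fun _ => B) (Series a) B HB Hex). apply is_lim_seq_const.
Qed.

(** One sequence [delta] serves the bound and the extremal function; the inequality for convex f is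
    read off at alpha = 0. *)
Theorem convex_log_coefficients alpha : 0 <= alpha < 1 ->
    exists delta : nat -> R,
      G_coefficients alpha delta /\
      ex_series (fun n : nat => delta (S n) ^ 2 / INR (S n) ^ 2) /\
      (forall (f : C -> C) (gamma : nat -> C),
         convex_of_order alpha f -> log_coefficients f gamma ->
         ex_series (fun n : nat => Cmod (gamma (S n)) ^ 2) /\
         Series (fun n : nat => Cmod (gamma (S n)) ^ 2)
           <= 1 / 4 * Series (fun n : nat => delta (S n) ^ 2 / INR (S n) ^ 2)) /\
      1 / 4 * Series (fun n : nat => delta (S n) ^ 2 / INR (S n) ^ 2)
        <= (1 - beta alpha) ^ 2 * (PI ^ 2 / 6) /\
      convex_of_order alpha (K alpha) /\
      (exists gamma : nat -> C,
         log_coefficients (K alpha) gamma /\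
         is_series (fun n : nat => Cmod (gamma (S n)) ^ 2)
           (1 / 4 * Series (fun n : nat => delta (S n) ^ 2 / INR (S n) ^ 2))).
Proof.
  intros Hal. set (a := 1 - 2 * alpha). assert (Ha : -1 < a <= 1) by (unfold a; lra).
  assert (Eal : (1 - a) / 2 = alpha) by (unfold a; field).
  destruct (G_taylor a Ha) as [d [Hd [Hd0 Hdb]]].
  assert (HK : forall z, Cmod z < 1 -> K alpha z = Kfun a z) by (intros; now apply K_Kfun).
  assert (HI : forall n, 0 < INR (S n)) by (intros n; apply lt_0_INR; lia).
  assert (Hnn : forall n, 0 <= d (S n) ^ 2 / INR (S n) ^ 2).
  { intros n. apply Rdiv_le_0_compat; [apply pow2_ge_0 | apply pow_lt, HI]. }
  set (M := ((1 + a) / 2) ^ 2).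
  assert (HB : is_series (fun n => M * / INR (S n) ^ 2) (M * (PI ^ 2 / 6))).
  { apply (is_series_scal (M : R_AbsRing) (fun n => / INR (S n) ^ 2)), Basel. }
  assert (Hcmp : forall n, d (S n) ^ 2 / INR (S n) ^ 2 <= M * / INR (S n) ^ 2).
  { intros n. apply Rmult_le_compat_r; [apply Rlt_le, Rinv_0_lt_compat, pow_lt, HI|].
    apply pow_incr, Hdb. }
  assert (Hex : ex_series (fun n => d (S n) ^ 2 / INR (S n) ^ 2)).
  { apply (ex_series_le_R _ (fun n => M * / INR (S n) ^ 2)); [split; auto | eexists; exact HB]. }
  assert (HS : is_series (fun n => 1 / 4 * (d (S n) ^ 2 / INR (S n) ^ 2))
                 (1 / 4 * Series (fun n => d (S n) ^ 2 / INR (S n) ^ 2))).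
  { apply (is_series_scal (1 / 4 : R_AbsRing) (fun n => d (S n) ^ 2 / INR (S n) ^ 2)), Series_correct, Hex. }
  exists d. split; [|split; [exact Hex | split; [|split; [|split]]]].
  - intros z Hz. rewrite G_inv_Q by assumption. fold a.
    pose proof (is_cseries_S _ _ (Hd z Hz)) as H. cbv beta in H. rewrite Hd0 in H.
    replace (/ Qfun a z - 1)%C with (/ Qfun a z - 1 * z ^ 0)%C by (simpl; ring). exact H.
  - intros f gamma Hf Hg. rewrite <- Eal in Hf. apply ex_series_of_bounded; [intros; apply pow2_ge_0|].
    intros n. eapply Rle_trans; [apply (log_coefficients_bound a f gamma d n Ha Hd Hf Hg)|].
    apply (sum_n_le_is_series _ _ n HS). intros k. specialize (Hnn k). lra.
  - assert (H1 : Series (fun n => d (S n) ^ 2 / INR (S n) ^ 2) <= M * (PI ^ 2 / 6)).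
    { rewrite <- (is_series_unique _ _ HB). apply Series_le; [split; auto | eexists; exact HB]. }
    pose proof (beta_bound alpha Hal) as Hb.
    (* (1 + a)/4 is half of delta_1 = 1 - alpha; the factor 1/4 in front of the series supplies the
       square of that half. *)
    assert (H2 : ((1 + a) / 4) ^ 2 <= (1 - beta alpha) ^ 2).
    { replace ((1 + a) / 4) with ((2 - 2 * alpha) / 4) by (unfold a; field). apply pow_incr. lra. }
    assert (HP : 0 <= PI ^ 2 / 6) by (pose proof (pow2_ge_0 PI); lra).
    apply Rle_trans with (((1 + a) / 4) ^ 2 * (PI ^ 2 / 6)); [|apply Rmult_le_compat_r; assumption].
    replace (((1 + a) / 4) ^ 2 * (PI ^ 2 / 6)) with (1 / 4 * (M * (PI ^ 2 / 6))) by (unfold M; field). lra.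
  - rewrite <- Eal at 1. now apply convex_K.
  - exists (fun n => RtoC (d n / (2 * INR n))). split.
    + apply (log_coefficients_K a (K alpha) d Ha HK Hd Hd0). intros n. specialize (Hdb n). lra.
    + eapply is_series_ext; [|exact HS]. intros n. cbv beta. rewrite Cmod_R, pow2_abs.
      specialize (HI n).
      match goal with |- @eq _ ?x ?y => change (@eq R x y) end. field. lra.
Qed.

Theorem mainTheorem6 :
  (forall alpha : R, 0 <= alpha < 1 ->
    exists delta : nat -> R,
      G_coefficients alpha delta /\
      ex_series (fun n : nat => delta (S n) ^ 2 / INR (S n) ^ 2) /\
      (forall (f : C -> C) (gamma : nat -> C),
         convex_of_order alpha f -> log_coefficients f gamma ->
         ex_series (fun n : nat => Cmod (gamma (S n)) ^ 2) /\
         Series (fun n : nat => Cmod (gamma (S n)) ^ 2)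
           <= 1 / 4 * Series (fun n : nat => delta (S n) ^ 2 / INR (S n) ^ 2)) /\
      1 / 4 * Series (fun n : nat => delta (S n) ^ 2 / INR (S n) ^ 2)
        <= (1 - beta alpha) ^ 2 * (PI ^ 2 / 6) /\
      convex_of_order alpha (K alpha) /\
      (exists gamma : nat -> C,
         log_coefficients (K alpha) gamma /\
         is_series (fun n : nat => Cmod (gamma (S n)) ^ 2)
           (1 / 4 * Series (fun n : nat => delta (S n) ^ 2 / INR (S n) ^ 2)))) /\
  (forall (f : C -> C) (gamma : nat -> C),
     convex_of_order 0 f -> log_coefficients f gamma ->
     ex_series (fun n : nat => Cmod (gamma (S n)) ^ 2) /\
     Series (fun n : nat => Cmod (gamma (S n)) ^ 2) <= PI ^ 2 / 24) /\
  convex_of_order 0 (fun z : C => (z / (1 - z))%C) /\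
  (exists gamma : nat -> C,
     log_coefficients (fun z : C => (z / (1 - z))%C) gamma /\
     is_series (fun n : nat => Cmod (gamma (S n)) ^ 2) (PI ^ 2 / 24)).
Proof.
  assert (Ha : -1 < 1 <= 1) by lra.
  (* For alpha = 0 one has a = 1, V = z, Q = 1 - z and G = 1/(1 - z), so every delta_n equals 1. *)
  assert (HV : forall z, Cmod z < 1 -> Vfun 1 z = z).
  { intros z Hz. pose proof (aV_power 1 z Ha Hz) as E.
    rewrite Cpower_1 in E by now apply Re_one_minus_pos.
    replace (Vfun 1 z) with (1 * Vfun 1 z)%C by ring. rewrite E. ring. }
  assert (HK : forall z, Cmod z < 1 -> (z / (1 - z))%C = Kfun 1 z).
  { intros z Hz. pose proof (one_minus_neq_0 z Hz) as Hn. unfold Kfun. rewrite HV by exact Hz.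
    assert (P : ((1 - z) * Cpower (1 - z) (- (1)) = 1)%C).
    { rewrite (Cpower_succ (1 - z) (- (1)) 0); [apply Cpower_0 | now apply Re_one_minus_pos | ring]. }
    transitivity ((1 - z) * Cpower (1 - z) (- (1)) * z / (1 - z))%C; [rewrite P; field; exact Hn | field; exact Hn]. }
  split; [exact convex_log_coefficients|]. split; [|split].
  - intros f gamma Hf Hg.
    destruct (convex_log_coefficients 0 ltac:(lra)) as [delta [_ [_ [H1 [H2 _]]]]].
    destruct (H1 f gamma Hf Hg) as [H3 H4]. split; [exact H3|].
    assert (Eb : beta 0 = 1 / 2).
    { unfold beta. destruct (Req_EM_T 0 (1 / 2)) as [E|_]; [lra|].
      replace (1 - 2 * 0) with 1 by ring. rewrite Rpower_1 by lra. field. }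
    rewrite Eb in H2. lra.
  - replace 0 with ((1 - 1) / 2) by field. now apply convex_K.
  - set (d := fun _ : nat => 1).
    exists (fun n => RtoC (d n / (2 * INR n))). split.
    + apply (log_coefficients_K 1 _ d Ha HK); [|reflexivity | unfold d; intros; lra].
      destruct (pser_inv_Q 1 Ha) as [e He].
      assert (HQ : forall z, Cmod z < 1 -> Qfun 1 z = (1 - z)%C).
      { intros z Hz. destruct (Ceq_dec z 0) as [->|Hz0]; [rewrite Qfun_0 by exact Ha; ring|].
        transitivity (z * Qfun 1 z / z)%C; [field; exact Hz0|]. rewrite zQ_V, HV by assumption. field. exact Hz0. }
      assert (E : forall n, e n = 1%C).
      (* Multiplying 1/Q by 1 - z gives 1, so consecutive coefficients of 1/Q are equal. *)
      { assert (H1 : pser 1 (fun _ => 1%C) (fun n => e n + (-1) * match n with O => 0 | S m => e m end)%C).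
        { eapply pser_ext; [|exact (pser_plus _ _ _ _ _ He (pser_scal _ (-1) _ _ (pser_mult_z _ _ _ He)))].
          intros z Hz. cbv beta. rewrite HQ by exact Hz. field. now apply one_minus_neq_0. }
        intros n. induction n as [|n IH].
        - rewrite <- (pser_0 1 _ _ ltac:(lra) He), Qfun_0 by exact Ha. field.
        - pose proof (pser_unique 1 _ _ _ ltac:(lra) (pser_const 1 1) H1 (S n)) as U. cbv beta iota in U.
          rewrite IH in U. replace (e (S n)) with (e (S n) + -1 * 1 + 1)%C by ring. rewrite <- U. ring. }
      intros z Hz. eapply is_cseries_ext; [|exact (He z Hz)]. intros n. cbv beta. rewrite E. reflexivity.
    + replace (PI ^ 2 / 24) with (1 / 4 * (PI ^ 2 / 6)) by field.
      eapply is_series_ext; [|exact (is_series_scal (1 / 4 : R_AbsRing) (fun n => / INR (S n) ^ 2) _ Basel)].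
      intros n. cbv beta. unfold d. rewrite Cmod_R, pow2_abs.
      assert (0 < INR (S n)) by (apply lt_0_INR; lia).
      change (1 / 4 * / INR (S n) ^ 2 = (1 / (2 * INR (S n))) ^ 2). field. lra.
Qed.
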